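(* In the basic coercive setting described in the context, for every $\mu_i\in\mathcal M(X_i)$ ($i=1,2$), every $\gamma\in\mathcal M(X_1\times X_2)$ and every $\varphi\in\Phi$ one has $$\mathscr R(\mu_1,\mu_2|\gamma)\ \ge\ \mathscr H(\mu_1,\mu_2|\gamma)\ \ge\ \mathscr D(\varphi|\mu_1,\mu_2).$$ In particular $$\mathsf{ET}(\mu_1,\mu_2)=\min_{\gamma\in\mathcal M(X_1\times X_2)}\mathscr H(\mu_1,\mu_2|\gamma),$$ and $\gamma\in\mathrm{Opt}_{\mathsf{ET}}(\mu_1,\mu_2)$ (that is, $\gamma$ minimizes $\mathscr E(\cdot|\mu_1,\mu_2)$ in $\mathcal M(X_1\times X_2)$) if and only if it minimizes $\mathscr H(\mu_1,\mu_2|\cdot)$ in $\mathcal M(X_1\times X_2)$ and satisfies $$H(x_1,\varrho_1(x_1);x_2,\varrho_2(x_2))=R_1(\varrho_1(x_1))+R_2(\varrho_2(x_2))+c(x_1,x_2)\quad\text{for }\gamma\text{-a.e. }(x_1,x_2),$$ where $\mu_i=\varrho_i\gamma_i+\mu_i^\perp$ is the Lebesgue decomposition of $\mu_i$ with respect to $\gamma_i$. If moreover both of the following hold: [$F_1(0)=+\infty$ or there exists $\bar x_2\in X_2$ with $\mu_2(\{\bar x_2\})=0$] and [$F_2(0)=+\infty$ or there exists $\bar x_1\in X_1$ with $\mu_1(\{\bar x_1\})=0$], then $$\mathsf{ET}(\mu_1,\mu_2)=\min\Big\{\int_{X_1\times X_2}H(x_1,\varrho_1(x_1);x_2,\varrho_2(x_2))\,d\gamma:\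 \gamma\in\mathcal M(X_1\times X_2),\ \mu_i=\varrho_i\gamma_i\Big\}.$$
   Context: For a Hausdorff space $X$, $\mathcal M(X)$ is the set of finite nonnegative Radon measures on $X$. $\Gamma(\mathbb R_+)$: convex lower semicontinuous $F:[0,\infty)\to[0,\infty]$ with $\mathrm{Dom}(F)\cap(0,\infty)\ne\emptyset$, $\mathrm{Dom}(F)=\{F<\infty\}$. $F'_\infty=\lim_{s\to\infty}F(s)/s$. Reverse entropy: $R(r)=rF(1/r)$ for $r>0$, $R(0)=F'_\infty$. $F^\circ(\varphi)=\inf_{s\ge0}(F(s)+s\varphi)$. For $\gamma=\sigma\mu+\gamma^\perp$ (Lebesgue decomposition), $\mathscr F(\gamma|\mu)=\int F(\sigma)\,d\mu+F'_\infty\gamma^\perp(X)$. Convention $0\cdot\infty=0$. Basic setting: $X_1,X_2$ Hausdorff, $F_1,F_2\in\Gamma(\mathbb R_+)$, $c:X_1\times X_2\to[0,+\infty]$ lower semicontinuous and not identically $+\infty$, $\mu_i\in\mathcal M(X_i)$, $m_i=\mu_i(X_i)$, with $(m_1\mathrm{Dom}(F_1))\cap(m_2\mathrm{Dom}(F_2))\ne\emptyset$. Coercive: at least one of: (1) $(F_1)'_\infty=(F_2)'_\infty=+\infty$; (2) $(F_1)'_\infty+(F_2)'_\infty+\inf c>0$ and $c$ has compact sublevels. For $\gamma\in\mathcal M(X_1\times X_2)$ with marginals $\gamma_i$: $\mathscr E(\gamma|\mu_1,\mu_2)=\sum_i\mathscr F_i(\gamma_i|\mu_i)+\int c\,d\gamma$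 ($\mathscr F_i$ being the functional induced by $F_i$), $\mathsf{ET}(\mu_1,\mu_2)=\inf_\gamma\mathscr E(\gamma|\mu_1,\mu_2)$, and $\mathrm{Opt}_{\mathsf{ET}}(\mu_1,\mu_2)$ is the set of all minimizers. $\Phi$: pairs $\varphi=(\varphi_1,\varphi_2)$ of lower semicontinuous functions $\varphi_i:X_i\to\mathbb R$ with finitely many values, $F_i^\circ(\varphi_i)$ bounded, $\varphi_1(x_1)+\varphi_2(x_2)\le c(x_1,x_2)$ everywhere; $\mathscr D(\varphi|\mu_1,\mu_2)=\sum_i\int F_i^\circ(\varphi_i)\,d\mu_i$. With $\mu_i=\varrho_i\gamma_i+\mu_i^\perp$, $\mu_i^\perp\perp\gamma_i$ ($\varrho_i$ Borel), and $R_i$ the reverse entropy of $F_i$, $$\mathscr R(\mu_1,\mu_2|\gamma)=\int\big(R_1(\varrho_1(x_1))+R_2(\varrho_2(x_2))+c(x_1,x_2)\big)d\gamma+\sum_iF_i(0)\mu_i^\perp(X_i),$$ $$\mathscr H(\mu_1,\mu_2|\gamma)=\int H(x_1,\varrho_1(x_1);x_2,\varrho_2(x_2))\,d\gamma+\sum_iF_i(0)\mu_i^\perp(X_i).$$ Marginal perspective cost: for $b\in[0,\infty)$, $H_b:[0,\infty)^2\to[0,\infty]$ is the lower semicontinuous envelope of $(r_1,r_2)\mapsto\inf_{\theta>0}\theta\big(R_1(r_1/\theta)+R_2(r_2/\theta)+b\big)$; $H_\infty(r_1,r_2)=F_1(0)r_1+F_2(0)r_2$; and $H(x_1,r_1;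x_2,r_2)=H_{c(x_1,x_2)}(r_1,r_2)$.
   Formalization: In the optimality criterion the γ-a.e. identity H = R_1+R_2+c is required only when ET(μ_1,μ_2) < +∞; if ET = +∞ every γ minimizes both E and H, and the identity can fail, so the equivalence as literally stated is false there. *)

(* Defs.v *)
(* Built on MathComp-Analysis; the reals are an arbitrary [realType]. *)
From HB Require Import structures.
From mathcomp Require Import all_boot all_order all_algebra.
From mathcomp Require Import all_classical all_reals all_analysis.
From mathcomp Require Import measurable_realfun.

Set Implicit Arguments.
Unset Strict Implicit.
Unset Printing Implicit Defensive.

Import Order.TTheory GRing.Theory Num.Theory.
Import numFieldNormedType.Exports.

Local Open Scope classical_set_scope.
Local Open Scope ring_scope.
Local Open Scope ereal_scope.

HB.instance Definition _ (X Y : ptopologicalType) := Pointed.on (X * Y)%type.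

(* [X] with its Borel sigma-algebra. For a product, [borel (X * Y)%type] is the
   Borel sigma-algebra of the product topology, which may be strictly larger
   than the product of the Borel sigma-algebras. Measurable types are pointed,
   hence the pointed spaces; a cost that is not identically +oo already forces
   both spaces to be nonempty. *)
Definition borel (X : ptopologicalType) : measurableType (@open X).-sigma :=
  g_sigma_algebraType (@open X).

Section optimization.
Context {R : realType}.

Definition is_minimum (m : \bar R) (A : set (\bar R)) : Prop :=
  A m /\ lbound A m.

Definition minimizes (T : Type) (f : T -> \bar R) (A : set T) (x : T) : Prop :=
  A x /\ forall y, A y -> f x <= f y.

(* the greatest lower semicontinuous minorant *)
Definition lsc_envelope (X : topologicalType) (f : X -> \bar R) (x : X) :
    \bar R :=
  ereal_sup [set g x | g in [set g : X -> \bar R |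
    lower_semicontinuous g /\ forall y, g y <= f y]].

End optimization.

Section lebesgue_decomposition.
Context {d : measure_display} {T : measurableType d} {R : realType}.
Implicit Types nu mu : {finite_measure set T -> \bar R}.

Definition mutually_singular nu mu : Prop :=
  exists N, [/\ measurable N, nu N = 0 & mu (~` N) = 0].

(* nu = sigma mu + nu' with nu' singular with respect to mu *)
Definition is_lebesgue_decomposition nu mu (sigma : T -> R)
    (nu' : {finite_measure set T -> \bar R}) : Prop :=
  [/\ measurable_fun setT sigma, forall x, (0 <= sigma x)%R,
      mutually_singular nu' mu &
      forall A, measurable A -> nu A = \int[mu]_(x in A) (sigma x)%:E + nu' A].

(* nu = sigma mu *)
Definition has_density nu mu (sigma : T -> R) : Prop :=
  [/\ measurable_fun setT sigma, forall x, (0 <= sigma x)%R &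
      forall A, measurable A -> nu A = \int[mu]_(x in A) (sigma x)%:E].

Lemma exists_maximal_null_set nu mu : exists N, [/\ measurable N, mu N = 0 &
  forall A, measurable A -> mu A = 0 -> nu (A `\` N) = 0].
Proof.
pose S := [set nu N | N in [set N : set T | measurable N /\ mu N = 0]].
have S0 : S (nu set0) by exists set0 => //=; rewrite measure0.
have Sub : ubound S (nu setT).
  by move=> _ [N [mN _] <-]; apply: le_measure; rewrite ?inE.
have Sfin : ereal_sup S \is a fin_num.
  rewrite ge0_fin_numE.
    apply: (@le_lt_trans _ _ (nu setT)); first exact: ge_ereal_sup.
    by rewrite ltey_eq fin_num_measure.
  by apply: (@le_trans _ _ (nu set0)) => //; exact: ereal_sup_ubound.
have /choice[F HF] (n : nat) : exists N : set T, [/\ measurable N, mu N = 0 &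
    ereal_sup S - (n.+1%:R^-1)%:E < nu N].
  have n0 : (0 < n.+1%:R^-1 :> R)%R by rewrite invr_gt0.
  have [_ [N [mN N0] <-] h] := ub_ereal_sup_adherent n0 Sfin.
  by exists N.
have mF n : measurable (F n) by have [] := HF n.
pose U := \bigcup_n F n.
have mU : measurable U by exact: bigcup_measurable.
have U0 : mu U = 0.
  apply/negligibleP => //; apply: negligible_bigcup => n.
  by apply/negligibleP => //; have [] := HF n.
have SU : ereal_sup S <= nu U.
  apply/lee_addgt0Pr => e e0.
  have [n _ hn] := near_infty_natSinv_lt (PosNum e0).
  have [_ _ /ltW] := HF n.
  rewrite leeBlDr// => /le_trans; apply; apply: leeD.
    by apply: le_measure; rewrite ?inE//; exact: bigcup_sup.
  by rewrite lee_fin ltW//; apply: (hn n) => /=.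
exists U; split => // A mA A0.
have mD : measurable (A `\` U) by exact: measurableD.
have D0 : mu (A `\` U) = 0 by apply: (subset_measure0 mD mA).
have DU : (A `\` U) `&` U = set0 by rewrite setIC setDIK.
have : nu (A `\` U) + nu U <= ereal_sup S.
  rewrite -measureU//; apply: ereal_sup_ubound.
  exists (A `\` U `|` U) => //; split; first exact: measurableU.
  transitivity (mu (A `\` U) + mu U); first exact: measureU.
  by rewrite [mu (_ `\` _)]D0 U0 adde0.
move=> /le_trans/(_ SU); rewrite -[leRHS]add0e leeD2rE ?fin_num_measure//.
by move=> h; apply/eqP; rewrite eq_le h measure_ge0.
Qed.

Lemma lebesgue_decomposition_exists nu mu :
  exists p : (T -> R) * {finite_measure set T -> \bar R},
    is_lebesgue_decomposition nu mu p.1 p.2.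
Proof.
have [N [mN N0 Nmax]] := exists_maximal_null_set nu mu.
have mNC : measurable (~` N) by exact: measurableC.
have dom : mrestr nu mNC `<< mu.
  apply/null_content_dominatesP => A mA A0.
  by rewrite /mrestr -setDE; exact: Nmax.
have [f [f0 ffin intf fE]] := @radon_nikodym_sigma_finite _ _ _ mu
  (mrestr nu mNC) dom.
exists (fine \o f, (mrestr nu mN : {finite_measure set T -> \bar R})); split => /=.
- exact: (measurableT_comp (fine_measurable measurableT) (measurable_int _ intf)).
- by move=> x; rewrite fine_ge0.
- exists (~` N); rewrite setCK; split => //.
  by change (nu (~` N `&` N) = 0); rewrite setICl measure0.
- move=> A mA; under eq_integral do rewrite fineK//.
  rewrite -fE// /mrestr addeC -measureU; [|exact: measurableI..|].
    by rewrite -setIUr setUv setIT.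
  by rewrite setIACA setICr setI0.
Qed.

Definition lebesgue_decomposition nu mu :
    (T -> R) * {finite_measure set T -> \bar R} :=
  sval (cid (lebesgue_decomposition_exists nu mu)).

Definition lebesgue_density nu mu : T -> R := (lebesgue_decomposition nu mu).1.

Definition singular_part nu mu : {finite_measure set T -> \bar R} :=
  (lebesgue_decomposition nu mu).2.

End lebesgue_decomposition.

Section borel_measures.
Context {R : realType}.

Definition Radon {X : ptopologicalType} :
    set {finite_measure set (borel X) -> \bar R} :=
  [set mu | forall B : set (borel X), measurable B ->
     forall e : R, (0 < e)%R ->
     exists K : set X, [/\ compact K, K `<=` B & mu (B `\` K) <= e%:E]].

Section marginals.
Context {X1 X2 : ptopologicalType}.
Notation X := (X1 * X2)%type.

Lemma measurable_borel_fst :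
  measurable_fun [set: borel X] (fst : borel X -> borel X1).
Proof.
apply: (@measurability _ _ (borel X) (borel X1) setT fst (@open X1) erefl).
move=> _ [B oB <-].
rewrite setTI; apply: sub_sigma_algebra.
by move: B oB; apply/continuousP => x; exact: cvg_fst.
Qed.

Lemma measurable_borel_snd :
  measurable_fun [set: borel X] (snd : borel X -> borel X2).
Proof.
apply: (@measurability _ _ (borel X) (borel X2) setT snd (@open X2) erefl).
move=> _ [B oB <-].
rewrite setTI; apply: sub_sigma_algebra.
by move: B oB; apply/continuousP => x; exact: cvg_snd.
Qed.

Section pushforwards.
Variable gamma : {finite_measure set (borel X) -> \bar R}.

Definition marginal1 : set (borel X1) -> \bar R :=
  pushforward gamma (fst : borel X -> borel X1).

Definition marginal2 : set (borel X2) -> \bar R :=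
  pushforward gamma (snd : borel X -> borel X2).

Let mfst := measurable_borel_fst.
Let msnd := measurable_borel_snd.

Let marginal1_fin : fin_num_fun marginal1.
Proof.
move=> A mA; rewrite fin_num_measure// -[X in measurable X]setTI; exact: mfst.
Qed.

Let marginal2_fin : fin_num_fun marginal2.
Proof.
move=> A mA; rewrite fin_num_measure// -[X in measurable X]setTI; exact: msnd.
Qed.

Let marginal1_0 : marginal1 set0 = 0. Proof. exact: measure0. Qed.
Let marginal1_ge0 A : 0 <= marginal1 A. Proof. exact: measure_ge0. Qed.
Let marginal1_sigma_additive : semi_sigma_additive marginal1.
Proof.
exact: (@measure_semi_sigma_additive _ _ _
  (measure_function_pushforward__canonical__measure_function_Measure gamma mfst)).
Qed.

HB.instance Definition _ := isMeasure.Build _ _ _ marginal1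
  marginal1_0 marginal1_ge0 marginal1_sigma_additive.
HB.instance Definition _ := @Measure_isFinite.Build _ _ _ marginal1
  marginal1_fin.

Let marginal2_0 : marginal2 set0 = 0. Proof. exact: measure0. Qed.
Let marginal2_ge0 A : 0 <= marginal2 A. Proof. exact: measure_ge0. Qed.
Let marginal2_sigma_additive : semi_sigma_additive marginal2.
Proof.
exact: (@measure_semi_sigma_additive _ _ _
  (measure_function_pushforward__canonical__measure_function_Measure gamma msnd)).
Qed.

HB.instance Definition _ := isMeasure.Build _ _ _ marginal2
  marginal2_0 marginal2_ge0 marginal2_sigma_additive.
HB.instance Definition _ := @Measure_isFinite.Build _ _ _ marginal2
  marginal2_fin.

End pushforwards.
End marginals.
End borel_measures.

Section entropy_functions.
Context {R : realType}.
Implicit Types F : R -> \bar R.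

(* A function on [0, +oo[ is represented by a function on R whose values at
   negative arguments are never used. *)
Definition Gamma : set (R -> \bar R) := [set F |
  [/\ forall s, (0 <= s)%R -> 0 <= F s,
      forall s t l, (0 <= s)%R -> (0 <= t)%R -> (0 <= l <= 1)%R ->
        F (l * s + (1 - l) * t)%R <= l%:E * F s + (1 - l)%:E * F t,
      lower_semicontinuous (F : subspace `[0%R, +oo[%classic -> \bar R) &
      exists2 s, (0 < s)%R & F s < +oo]].

Definition Dom F : set R := [set s | (0 <= s)%R /\ F s < +oo].

Definition recession F : \bar R := lim (F s * (s^-1)%:E @[s --> +oo%R]).

Definition reverse_entropy F (r : R) : \bar R :=
  if r == 0%R then recession F else r%:E * F (r^-1)%R.

Definition concave_conjugate F (phi : R) : \bar R :=
  ereal_inf [set F s + (s * phi)%:E | s in [set s | (0 <= s)%R]].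

Definition entropy_functional F d (T : measurableType d)
    (gamma mu : {finite_measure set T -> \bar R}) : \bar R :=
  \int[mu]_x F (lebesgue_density gamma mu x) +
  recession F * singular_part gamma mu setT.

(* The function whose lower semicontinuous envelope is H_b. *)
Definition perspective_cost F1 F2 (b : R) (r : R * R) : \bar R :=
  ereal_inf [set theta%:E * (reverse_entropy F1 (r.1 / theta)%R +
                             reverse_entropy F2 (r.2 / theta)%R + b%:E)
            | theta in [set theta : R | (0 < theta)%R]].

Definition quadrant : set (R * R) := [set r | (0 <= r.1)%R /\ (0 <= r.2)%R].

(* The subspace topology makes the envelope that of the restriction to the
   quadrant. The value at b = -oo is irrelevant, costs being nonnegative. *)
Definition marginal_perspective_cost F1 F2 (b : \bar R) (r1 r2 : R) : \bar R :=
  match b with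
  | b'%:E => lsc_envelope
      (perspective_cost F1 F2 b' : subspace quadrant -> \bar R) (r1, r2)
  | _ => F1 0%R * r1%:E + F2 0%R * r2%:E
  end.

End entropy_functions.

Section entropy_transport.
Context {R : realType} {X1 X2 : ptopologicalType}.
Variables (F1 F2 : R -> \bar R) (c : X1 * X2 -> \bar R).

Definition coercive : Prop :=
  (recession F1 = +oo /\ recession F2 = +oo) \/
  (0 < recession F1 + recession F2 + ereal_inf (range c) /\
   forall a : R, compact [set x | c x <= a%:E]).

Definition Phi : set ((X1 -> R) * (X2 -> R)) := [set phi |
  [/\ lower_semicontinuous (EFin \o phi.1) /\
        lower_semicontinuous (EFin \o phi.2),
      finite_set (range phi.1) /\ finite_set (range phi.2),
      (exists M : R, forall x, `|concave_conjugate F1 (phi.1 x)| <= M%:E) /\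
        (exists M : R, forall x, `|concave_conjugate F2 (phi.2 x)| <= M%:E) &
      forall x1 x2, (phi.1 x1 + phi.2 x2)%:E <= c (x1, x2)]].

Variables (mu1 : {finite_measure set (borel X1) -> \bar R})
          (mu2 : {finite_measure set (borel X2) -> \bar R}).

Definition basic_setting : Prop :=
  [/\ hausdorff_space X1 /\ hausdorff_space X2, Gamma F1 /\ Gamma F2,
      [/\ forall x, 0 <= c x, lower_semicontinuous c & exists x, c x != +oo],
      Radon mu1 /\ Radon mu2 &
      [set fine (mu1 setT) * s | s in Dom F1]%R `&`
      [set fine (mu2 setT) * s | s in Dom F2]%R !=set0].

Definition dual_functional (phi : (X1 -> R) * (X2 -> R)) : \bar R :=
  \int[mu1]_x concave_conjugate F1 (phi.1 x) +
  \int[mu2]_x concave_conjugate F2 (phi.2 x).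

Implicit Types gamma : {finite_measure set (borel (X1 * X2)%type) -> \bar R}.

Definition ET_functional gamma : \bar R :=
  entropy_functional F1 (marginal1 gamma) mu1 +
  entropy_functional F2 (marginal2 gamma) mu2 + \int[gamma]_x c x.

Definition ET : \bar R :=
  ereal_inf [set ET_functional gamma | gamma in Radon].

Definition OptET : set {finite_measure set (borel (X1 * X2)%type) -> \bar R} :=
  [set gamma | minimizes ET_functional Radon gamma].

Definition singular_cost gamma : \bar R :=
  F1 0%R * singular_part mu1 (marginal1 gamma) setT +
  F2 0%R * singular_part mu2 (marginal2 gamma) setT.

Definition reverse_integrand (rho1 : X1 -> R) (rho2 : X2 -> R) (x : X1 * X2) :
    \bar R :=
  reverse_entropy F1 (rho1 x.1) + reverse_entropy F2 (rho2 x.2) + c x.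

Definition perspective_integrand (rho1 : X1 -> R) (rho2 : X2 -> R)
    (x : X1 * X2) : \bar R :=
  marginal_perspective_cost F1 F2 (c x) (rho1 x.1) (rho2 x.2).

Definition reverse_functional gamma : \bar R :=
  \int[gamma]_x reverse_integrand
    (lebesgue_density mu1 (marginal1 gamma))
    (lebesgue_density mu2 (marginal2 gamma)) x + singular_cost gamma.

Definition perspective_functional gamma : \bar R :=
  \int[gamma]_x perspective_integrand
    (lebesgue_density mu1 (marginal1 gamma))
    (lebesgue_density mu2 (marginal2 gamma)) x + singular_cost gamma.

End entropy_transport.

(* Main.v *)
Require Import Defs.
From HB Require Import structures.
From mathcomp Require Import all_boot all_order all_algebra finmap.
From mathcomp Require Import all_classical all_reals all_analysis.
From mathcomp Require Import measurable_realfun lra.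

(** For a Radon plan gamma, let mu_i = rho_i gamma_i + mu_i' be the Lebesgue
    decompositions and S = F_1(0) mu_1'(X_1) + F_2(0) mu_2'(X_2) the cost of the
    singular parts. Every assertion but the last comes from the chain

      D(phi) <= ET <= \int K dgamma + S <= H(gamma) <= R(gamma) = E(gamma)

    and from the existence of a plan with E(gamma) = ET. Here K is the reduced
    cost: at a point with densities r_1, r_2 and cost c it is the infimum over
    t >= 0 of t (R_1(r_1 / t) + R_2(r_2 / t) + c), read as
    F_1(0) r_1 + F_2(0) r_2 at t = 0. If gamma is optimal and ET is finite, the
    chain collapses, hence K = H = R_1 + R_2 + c almost everywhere; conversely this
    equality gives E(gamma) = H(gamma).

    The common tool is that each F_i is the supremum of countably many affine
    functions a_k s + b_k, one of which is 0 ([affine_rep_exists]). The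
    perspective r F(t / r) is then sup_k (a_k t + b_k r), an expression symmetric
    in the two measures, and the entropy of gamma relative to mu is the supremum
    of sum_k (a_k gamma(A_k) + b_k mu(A_k)) over the finite measurable partitions
    ([variational_le], [variational_lt]). Exchanging the roles of gamma and mu in
    this formula gives R(gamma) = E(gamma) ([entropy_reverse]); it also bounds
    the entropy of the marginals of a plan given by a density
    ([entropy_image_le]), gives D <= E by taking the a_k and b_k from the
    finitely many values of phi ([dual_le_ET_functional]), and shows that the
    entropy is weakly lower semicontinuous ([affine_sum_lsc]).

    - K <= H, because K is lower semicontinuous in (r_1, r_2) and lies below the
      function whose envelope is H ([reduced_cost_le_marginal]).
    - ET <= \int K dgamma + S, because coercivity lets the infimum defining K be
      attained at some theta(x), measurably in x ([measurable_optimal_plan]), and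
      the plan theta gamma costs at most \int K dgamma + S ([ET_le_reduced]).
    - A minimizer of E is a limit of a minimizing sequence along an ultrafilter
      ([minimizer_exists]): the limits of the masses of compact sets form a
      content, which extends to a Radon measure ([tight_weak_cvg]). Mass and
      tightness are controlled by coercivity.

    For the last assertion an optimal plan gamma is completed to
    gamma + (x, z_2)_# mu_1' + (z_1, y)_# mu_2', whose marginals dominate mu_1 and
    mu_2. As mu_1 does not charge z_1 and mu_2 does not charge z_2, the density of
    mu_2 may be taken to vanish at z_2, so that the perspective cost on the first
    added part is at most F_1(0), and symmetrically; the completed plan therefore
    costs at most E(gamma) ([full_mass_plan_le]).

    The integrals of the perspective integrand are compared with others by
    pointwise bounds alone: the integral of a nonnegative function is the supremum
    of the integrals of the simple functions below it, hence monotone without any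
    measurability ([le_integral_ge0]). *)

Set Implicit Arguments.
Unset Strict Implicit.
Unset Printing Implicit Defensive.

Import Order.TTheory GRing.Theory Num.Theory.
Import numFieldNormedType.Exports.

Local Open Scope classical_set_scope.
Local Open Scope ring_scope.
Local Open Scope ereal_scope.

(** * Radon measures from contents on compact sets *)

Lemma separate_compacts (T : topologicalType) (A B : set T) :
  hausdorff_space T -> compact A -> compact B -> A `&` B = set0 ->
  exists U V, [/\ open U, open V, A `<=` U, B `<=` V & U `&` V = set0].
Proof.
move=> hT cA cB AB0.
have pt (a : T) : A a -> exists U : set T, nbhs a U /\ B `<=` (~` U)°.
  move=> Aa.
  have [] := (compact_near_coveringP B).1 cB _ (powerset_filter_from (nbhs a))
    (fun U => (~` U)°) _.
    move=> y By.
    have aNy : a != y.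
      by apply/eqP => ay; have : set0 y by rewrite -AB0; split => //; rewrite -ay.
    have := hT; rewrite open_hausdorff => /(_ _ _ aNy).
    move=> [[W V] /= [/set_mem Wa /set_mem Vy] [oW oV /eqP WV0]].
    exists (V, [set U : set T | nbhs a U /\ U `<=` W]) => /=.
      split; first exact: open_nbhs_nbhs.
      exact/powerset_filter_fromP/open_nbhs_nbhs.
    move=> [y' U] /= [Vy' [_ UW]].
    apply: (@filterS _ _ _ V); last exact: open_nbhs_nbhs.
    by move=> z Vz Uz; have : set0 z by rewrite -WV0; split => //; exact: UW.
  move=> P [PU Pd [U PUU] H].
  by exists U; split; [exact: PU|exact: H].
have [->|/set0P B0] := eqVneq B set0.
  by exists setT, set0; split; [exact: openT|exact: open0| | |exact: setI0].
pose F := powerset_filter_from (set_nbhs B).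
have BF : ProperFilter (set_nbhs B) by exact: set_nbhs_pfilter.
have FF : Filter F by exact: powerset_filter_from_filter.
have [] := (compact_near_coveringP A).1 cA _ F (fun U => (~` U)°) _.
  move=> a Aa; have [U [Ua BU]] := pt a Aa.
  exists (U°, [set V : set T | set_nbhs B V /\ V `<=` (~` U)]) => /=.
    split; first exact: nbhs_interior.
    apply: powerset_filter_fromP => b Bb; exact: BU.
  move=> [a' V] /= [Ua' [_ VU]].
  apply: (@filterS _ _ _ U); last exact: Ua'.
  by move=> z Uz Vz; exact: (VU z Vz).
move=> P [PU Pd [V PV] H].
have [W [oW BW WV]] := (set_nbhsP B V).1 (PU V PV).
exists (~` V)°, W; split => //; first exact: open_interior.
- exact: H.
- by apply/seteqP; split => // z [/interior_subset zV /WV].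
Qed.

(** The parts of [K] outside [V] and outside [U] are disjoint compact sets; removing
    disjoint open neighbourhoods of them from [K] gives the two pieces. *)
Lemma split_compact (T : topologicalType) (K U V : set T) :
  hausdorff_space T -> compact K -> open U -> open V -> K `<=` U `|` V ->
  exists K1 K2, [/\ compact K1, compact K2, K1 `<=` U, K2 `<=` V &
                    K = K1 `|` K2].
Proof.
move=> hT cK oU oV KUV.
have cD (W : set T) : open W -> compact (K `\` W).
  by move=> oW; rewrite setDE; apply: compact_closedI => //; exact: open_closedC.
have [] := separate_compacts hT (cD _ oU) (cD _ oV).
  by apply/seteqP; split => // z [[/KUV [|]]]// ? ? [].
move=> A [B [oA oB KA KB AB0]].
exists (K `\` A), (K `\` B); split; [exact: cD|exact: cD| | |].
- by move=> z [Kz nA]; apply: contrapT => nU; apply: nA; exact: KA.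
- by move=> z [Kz nB]; apply: contrapT => nV; apply: nB; exact: KB.
- apply/seteqP; split => [z Kz|z [[]|[]]//].
  have [Az|nA] := pselect (A z); last by left.
  by right; split => // Bz; have : set0 z by rewrite -AB0.
Qed.

Section borel_sets.
Context {T : ptopologicalType}.

Lemma open_borel (G : set T) : open G -> measurable (G : set (borel T)).
Proof. by move=> oG; apply: sub_sigma_algebra. Qed.

Lemma closed_borel (C : set T) : closed C -> measurable (C : set (borel T)).
Proof.
move=> cC; rewrite -[C]setCK; apply: measurableC; apply: open_borel.
exact: closed_openC.
Qed.

Lemma compact_borel (K : set T) : hausdorff_space T -> compact K ->
  measurable (K : set (borel T)).
Proof. by move=> hT cK; apply: closed_borel; exact: compact_closed. Qed.

End borel_sets.

(** A content on the compact sets of a Hausdorff space, which need not be locally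
    compact, yields a measure in three steps: inner extension to the open sets,
    outer extension to all sets, and the theorem of Caratheodory. *)
Section radon_of_content.
Context {R : realType} {T : ptopologicalType}.
Variables (lam : set T -> R) (M : R).
Hypothesis hT : hausdorff_space T.
Hypothesis lam0 : lam set0 = 0%R.
Hypothesis lamU_le : forall K L, compact K -> compact L ->
  (lam (K `|` L) <= lam K + lam L)%R.
Hypothesis lamU_disj : forall K L, compact K -> compact L -> K `&` L = set0 ->
  (lam K + lam L <= lam (K `|` L))%R.
Hypothesis lam_bnd : forall K, compact K -> (lam K <= M)%R.

Definition inner_content (G : set T) : \bar R :=
  ereal_sup [set (lam K)%:E | K in [set K | compact K /\ K `<=` G]].

Definition outer_content (A : set T) : \bar R :=
  ereal_inf [set inner_content G | G in [set G | open G /\ A `<=` G]].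

Local Notation inn := inner_content.
Local Notation out := outer_content.

Let inn_ub G K : compact K -> K `<=` G -> (lam K)%:E <= inn G.
Proof. by move=> cK KG; apply: ereal_sup_ubound; exists K. Qed.

Let inn_ge0 G : 0 <= inn G.
Proof.
apply: (@le_trans _ _ (lam set0)%:E); first by rewrite lam0.
by apply: inn_ub; [exact: compact0|].
Qed.

Let inn_bnd G : inn G <= M%:E.
Proof. by apply: ge_ereal_sup => _ [K [cK _] <-]; rewrite lee_fin lam_bnd. Qed.

Let innS G H : G `<=` H -> inn G <= inn H.
Proof.
move=> GH; apply: ge_ereal_sup => _ [K [cK KG] <-].
by apply: inn_ub => //; exact: subset_trans GH.
Qed.

Let inn0 : inn set0 = 0.
Proof.
apply/eqP; rewrite eq_le inn_ge0 andbT; apply: ge_ereal_sup.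
by move=> x [K [_]]; rewrite subset0 => -> <-; rewrite lam0.
Qed.

Let out_le G A : open G -> A `<=` G -> out A <= inn G.
Proof. by move=> oG AG; apply: ereal_inf_lbound; exists G. Qed.

Let out_open G : open G -> out G = inn G.
Proof.
move=> oG; apply/eqP; rewrite eq_le out_le//=.
by apply: le_ereal_inf_tmp => _ [H [oH GH] <-]; exact: innS.
Qed.

Let outS A B : A `<=` B -> out A <= out B.
Proof.
move=> AB; apply: le_ereal_inf_tmp => _ [H [oH GH] <-].
by apply: out_le => //; exact: subset_trans GH.
Qed.

Let out_ge0 A : 0 <= out A.
Proof. by apply: le_ereal_inf_tmp => _ [H [oH GH] <-]. Qed.

Let out_bnd A : out A <= M%:E.
Proof. by apply: le_trans (inn_bnd setT); apply: out_le => //; exact: openT. Qed.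

Let out0 : out set0 = 0.
Proof. by rewrite out_open//; exact: open0. Qed.

(** Finite subadditivity: [K] is cut into compact pieces along the open cover. *)
Let lam_bigU (G : nat -> set T) n K : (forall i, open (G i)) -> compact K ->
  K `<=` \big[setU/set0]_(i < n) G i -> (lam K)%:E <= \sum_(i < n) inn (G i).
Proof.
move=> oG; elim: n K => [K _|n IH K cK].
  by rewrite !big_ord0 subset0 => ->; rewrite lam0.
rewrite !big_ord_recr/= => KG.
have oU : open (\big[setU/set0]_(i < n) G i) by rewrite -bigcup_mkord; exact: bigcup_open.
have [K1 [K2 [c1 c2 K1G K2G ->]]] := split_compact hT cK oU (oG n) KG.
apply: (@le_trans _ _ ((lam K1)%:E + (lam K2)%:E)).
  by rewrite -EFinD lee_fin lamU_le.
by apply: leeD; [exact: IH|exact: inn_ub].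
Qed.

Let inn_bigcup (G : nat -> set T) : (forall i, open (G i)) ->
  inn (\bigcup_i G i) <= \sum_(i <oo) inn (G i).
Proof.
move=> oG; apply: ge_ereal_sup => _ [K [cK KG] <-].
have : cover_compact K by rewrite -compact_cover.
move=> /(_ nat setT G (fun i _ => oG i) KG) [D _ KD].
pose n := (\max_(i <- enum_fset D) i).+1.
apply: (@le_trans _ _ (\sum_(i < n) inn (G i))).
  apply: lam_bigU => //; apply: (subset_trans KD) => z [i /= iD Giz].
  rewrite -bigcup_mkord; exists i => //=.
  by rewrite ltnS; apply: (@leq_bigmax_seq _ _ (fun=> true) id).
rewrite -(big_mkord xpredT (fun i => inn (G i))).
exact: nneseries_lim_ge.
Qed.

Let out_sigma_subadditive : sigma_subadditive out.
Proof.
move=> F; apply/lee_addgt0Pr => e e0.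
apply: (le_trans _ (epsilon_trick _ (fun n => out_ge0 (F n)) (ltW e0))).
have /choice[G HG] (n : nat) : exists G, [/\ open G, F n `<=` G &
    inn G <= out (F n) + (e / (2 ^ n.+1)%:R)%:E].
  have en0 : (0 < e / (2 ^ n.+1)%:R)%R by rewrite divr_gt0// ltr0n expn_gt0.
  have fo : out (F n) \is a fin_num.
    by rewrite ge0_fin_numE// (le_lt_trans (out_bnd _))// ltry.
  have [_ [G [oG FG] <-] /ltW lt] := lb_ereal_inf_adherent en0 fo.
  by exists G.
apply: (@le_trans _ _ (inn (\bigcup_n G n))).
  apply: out_le; first by apply: bigcup_open => n _; have [] := HG n.
  by move=> z [n _ Fz]; exists n => //; have [_ + _] := HG n; apply.
apply: (le_trans (inn_bigcup _)); first by move=> n; have [] := HG n.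
by apply: lee_nneseries => n _ //; have [] := HG n.
Qed.

HB.instance Definition _ := isOuterMeasure.Build R T out
  out0 out_ge0 outS out_sigma_subadditive.

(** Inside an open [W] containing the test set, a compact [K] in the intersection
    of [W] and [G] and a compact [L] in [W] minus [K] are disjoint, so their
    contents add up to at most that of [W]. *)
Let out_caratheodory G : open G -> out.-caratheodory G.
Proof.
move=> oG; apply: le_caratheodory_measurable => X.
apply: le_ereal_inf_tmp => _ [W [oW XW] <-].
apply: (@le_trans _ _ (out (W `&` G) + out (W `&` ~` G))).
  by apply: leeD; apply: outS; exact: setSI.
rewrite out_open; last exact: openI.
apply/lee_addgt0Pr => e e0.
have e20 : (0 < e / 2)%R by rewrite divr_gt0.
have fin H : inn H \is a fin_num.
  by rewrite ge0_fin_numE// (le_lt_trans (inn_bnd _))// ltry.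
have [_ [K [cK KWG] <-] ltK] := ub_ereal_sup_adherent e20 (fin (W `&` G)).
have clK : closed K by exact: compact_closed.
have oWK : open (W `\` K) by rewrite setDE; apply: openI => //; exact: closed_openC.
have [_ [L [cL LWK] <-] ltL] := ub_ereal_sup_adherent e20 (fin (W `\` K)).
have le1 : out (W `&` ~` G) <= inn (W `\` K).
  by apply: out_le => // z [Wz nG]; split => // /KWG[].
have le2 : (lam K)%:E + (lam L)%:E <= inn W.
  apply: (@le_trans _ _ (lam (K `|` L))%:E).
    rewrite -EFinD lee_fin; apply: lamU_disj => //.
    by apply/seteqP; split => // z [Kz /LWK []].
  apply: inn_ub; first exact: compactU.
  by move=> z [/KWG []|/LWK []].
have -> : e = (e / 2 + e / 2)%R by rewrite -splitr.
rewrite EFinD addeA.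
apply: (@le_trans _ _ (((lam K)%:E + (e / 2)%:E) + ((lam L)%:E + (e / 2)%:E))).
  apply: leeD.
    by rewrite -leeBlDr//; exact: ltW.
  by apply: (le_trans le1); rewrite -leeBlDr//; exact: ltW.
by rewrite addeACA -[leRHS]addeA; exact: leeD.
Qed.

Let out_borel (A : set (borel T)) : measurable A -> out.-caratheodory A.
Proof.
apply: smallest_sub => /=; last by move=> G; exact: out_caratheodory.
split.
- exact: caratheodory_measurable_set0.
- by move=> B mB; rewrite setTD; exact: caratheodory_measurable_setC.
- by move=> F mF; exact: caratheodory_measurable_bigcup.
Qed.

Definition content_measure : set (borel T) -> \bar R := outer_content.

Let mu0 : content_measure set0 = 0. Proof. exact: out0. Qed.
Let mu_ge0 A : 0 <= content_measure A. Proof. exact: out_ge0. Qed.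

Let mu_sigma_additive : semi_sigma_additive content_measure.
Proof.
move=> F mF tF mUF.
apply: (@caratheodory_measure_sigma_additive R T out F) => //.
- by move=> i; exact: out_borel.
- exact: out_borel.
Qed.

HB.instance Definition _ := isMeasure.Build _ _ _ content_measure
  mu0 mu_ge0 mu_sigma_additive.

Let mu_fin : fin_num_fun content_measure.
Proof.
move=> A _; rewrite ge0_fin_numE; last exact: out_ge0.
by rewrite (le_lt_trans (out_bnd _))// ltry.
Qed.

HB.instance Definition _ := @Measure_isFinite.Build _ _ _ content_measure mu_fin.

(** Inner regularity: the complement of [B] lies in an open [U] of almost the same
    measure, the total mass is almost reached on a compact [K], and [K] minus [U]
    is a compact subset of [B]. *)
Lemma exists_radon_of_content :
  exists mu : {finite_measure set (borel T) -> \bar R},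
    Radon mu /\ forall G : set T, open G -> mu G = inner_content G.
Proof.
pose mu : {finite_measure set (borel T) -> \bar R} := content_measure.
have muE A : mu A = out A by [].
have muG (G : set T) : open G -> mu G = inn G by exact: out_open.
exists mu; split; last exact: muG.
move=> B mB e e0.
have e20 : (0 < e / 2)%R by rewrite divr_gt0.
have lmu K : compact K -> (lam K)%:E <= mu K.
  by move=> cK; apply: le_ereal_inf_tmp => _ [H [oH KH] <-]; exact: inn_ub.
have mBC : measurable (~` B) by exact: measurableC.
have fout : out (~` B) \is a fin_num.
  by rewrite -muE fin_num_measure.
have [_ [U [oU BU] <-]] := lb_ereal_inf_adherent e20 fout.
rewrite -/(out (~` B)) -muE -muG// => /ltW ltU.
have finn : inn setT \is a fin_num.
  by rewrite -muG ?fin_num_measure//; exact: openT.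
have [_ [K [cK _] <-]] := ub_ereal_sup_adherent e20 finn.
rewrite -/(inn setT) -muG; last exact: openT.
move=> /ltW ltK.
have mU := open_borel oU.
have mK := compact_borel hT cK.
exists (K `&` ~` U); split.
- by apply: compact_closedI => //; exact: open_closedC.
- by move=> x [_ nU]; apply: contrapT => nB; apply: nU; exact: BU.
- have -> : e = (e / 2 + e / 2)%R by rewrite -splitr.
  apply: (@le_trans _ _ (mu (U `\` ~` B) + mu (~` K))).
    apply: (@le_trans _ _ (mu ((U `\` ~` B) `|` ~` K))).
      apply: le_measure; rewrite ?inE.
      - by apply: measurableD => //; apply: measurableI => //; exact: measurableC.
      - apply: measurableU; last exact: measurableC.
        exact: measurableD.
      - move=> x [Bx nKU]; have [Kx|] := pselect (K x); last by right.
        left; split; last by move=> /(_ Bx).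
        by apply: contrapT => nU; apply: nKU; split.
    apply: measureU2; [exact: measurableD|exact: measurableC].
  rewrite EFinD; apply: leeD.
    rewrite measureD//; last by rewrite ltey_eq fin_num_measure.
    rewrite (_ : U `&` ~` B = ~` B); last by apply/setIidPr.
    by rewrite leeBlDl// fin_num_measure.
  rewrite -setTD measureD//; last by rewrite ltey_eq fin_num_measure.
  rewrite setTI leeBlDr ?fin_num_measure//.
  rewrite leeBlDl// in ltK; apply: (le_trans ltK); rewrite leeD2l//.
  exact: lmu.
Qed.

End radon_of_content.

(** * Limits of tight sequences along an ultrafilter *)

Lemma ultra_bounded_cvg {R : realType} (U : set_system nat) (u : nat -> R) M :
  UltraFilter U -> (forall n, (0 <= u n <= M)%R) -> cvg (u @ U).
Proof.
move=> UU uM.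
have cM : compact `[0%R, M] by exact: segment_compact.
have PU : ProperFilter (u @ U) by exact: fmap_proper_filter.
have uI : (u @ U) `[0%R, M]%classic.
  by apply: (@filterE _ U) => n /=; rewrite in_itv/=; exact: uM.
have [p [_ clp]] := cM _ PU uI.
apply/cvg_ex; exists p => V pV.
have [//|nV] := in_ultra_setVsetC (u @^-1` V) UU.
have [x [+ Vx]] := clp (~` V) V nV pV.
by move=> /(_ Vx).
Qed.

(** Weak convergence, formulated by sets: the masses of open sets do not drop in
    the limit, and the total mass does not increase. *)
Definition weak_cvg {R : realType} {T : ptopologicalType} (U : set_system nat)
    (g : nat -> {finite_measure set (borel T) -> \bar R})
    (g0 : {finite_measure set (borel T) -> \bar R}) : Prop :=
  (forall (G : set T) (s : R), open G -> s%:E < g0 G ->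
     \forall n \near U, s%:E < g n G) /\
  (forall s : R, g0 setT < s%:E -> \forall n \near U, g n setT < s%:E).

(** On an ultrafilter the masses of each compact set converge. Their limits form a
    content, and the Radon measure it generates is the weak limit; tightness
    keeps the total mass from escaping. *)
Lemma tight_weak_cvg {R : realType} {T : ptopologicalType} (U : set_system nat)
    (g : nat -> {finite_measure set (borel T) -> \bar R}) (M : R) :
  UltraFilter U -> hausdorff_space T ->
  (forall n, g n setT <= M%:E) ->
  (forall e : R, (0 < e)%R -> exists2 K : set T, compact K &
     forall n, g n (~` K) <= e%:E) ->
  exists2 g0, Radon g0 & weak_cvg U g g0.
Proof.
move=> UU hT gM gt.
pose u (K : set T) n : R := fine (g n K).
pose lam (K : set T) : R := lim (u K n @[n --> U]).
have mK (K : set T) : compact K -> measurable (K : set (borel T)).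
  exact: compact_borel.
have uE (K : set T) n : measurable (K : set (borel T)) -> g n K = (u K n)%:E.
  by move=> mA; rewrite /u fineK// fin_num_measure.
have uM (K : set T) n : measurable (K : set (borel T)) -> (0 <= u K n <= M)%R.
  move=> mA; rewrite fine_ge0//= -lee_fin -uE//.
  by apply: le_trans (gM n); apply: le_measure; rewrite ?inE.
have cu (K : set T) : measurable (K : set (borel T)) -> u K n @[n --> U] --> lam K.
  by move=> mA; apply: (@ultra_bounded_cvg _ _ _ M) => // n; exact: uM.
have PU : ProperFilter U by exact: ultra_proper.
have [||||g0 [rg0 g0E]] := @exists_radon_of_content R T lam M hT.
- rewrite /lam/u; under eq_fun do rewrite measure0/=.
  exact: lim_cst.
- move=> K L cK cL.
  apply: (ler_cvg_to (cu _ (mK _ (compactU cK cL)))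
    (cvgD (cu _ (mK _ cK)) (cu _ (mK _ cL)))); apply: nearW => n /=.
  rewrite -lee_fin EFinD -!uE; [|by apply: mK => //; apply: compactU..].
  by apply: measureU2; exact: mK.
- move=> K L cK cL KL0.
  apply: (ler_cvg_to (cvgD (cu _ (mK _ cK)) (cu _ (mK _ cL)))
    (cu _ (mK _ (compactU cK cL)))); apply: nearW => n /=.
  rewrite -lee_fin EFinD -!uE; [|by apply: mK => //; apply: compactU..].
  by rewrite measureU//; exact: mK.
- move=> K cK.
  apply: (ler_cvg_to (cu _ (mK _ cK)) (cvg_cst M)).
  by apply: nearW => n; have /andP[] := uM K n (mK _ cK).
exists g0 => //; split.
- move=> G s oG; rewrite g0E// => /ereal_sup_gt/= [_ [K [cK KG] <-]].
  rewrite lte_fin => sK.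
  have H : \forall n \near U, (s < u K n)%R.
    exact: (cvgr_gt _ (cu _ (mK _ cK)) _ sK).
  apply: filterS H => n sun; apply: (@lt_le_trans _ _ (u K n)%:E).
    by rewrite lte_fin.
  rewrite -uE; last exact: mK.
  by apply: le_measure; rewrite ?inE//; [exact: mK|exact: open_borel].
- move=> s gs; pose t := fine (g0 setT).
  have gt0 : g0 setT = t%:E by rewrite /t fineK// fin_num_measure.
  rewrite gt0 lte_fin in gs.
  have e0 : (0 < (s - t) / 2)%R by rewrite divr_gt0// subr_gt0.
  have [K cK Ke] := gt _ e0.
  have Kt : (lam K < t + (s - t) / 2)%R.
    apply: (@le_lt_trans _ _ t); last by rewrite ltrDl.
    rewrite -lee_fin -gt0 g0E; last exact: openT.
    by apply: ereal_sup_ubound; exists K.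
  have H : \forall n \near U, (u K n < t + (s - t) / 2)%R.
    exact: (cvgr_lt _ (cu _ (mK _ cK)) _ Kt).
  apply: filterS H => n sun; have mKK := mK _ cK.
  have -> : g n setT = g n K + g n (~` K).
    by rewrite -(setUv K) measureU//; [exact: measurableC|rewrite setICr].
  rewrite uE//; have -> : s = (t + (s - t) / 2 + (s - t) / 2)%R.
    by rewrite -addrA -splitr addrC subrK.
  by rewrite EFinD lte_leD// ?lte_fin// ?ge0_fin_numE// (le_lt_trans (Ke n))// ltry.
Qed.

(** * Perspectives and the variational formula *)

Lemma real_between {R : realType} (x y : \bar R) : x < y ->
  exists s : R, x < s%:E /\ s%:E < y.
Proof.
case: x y => [x| |] [y| |]//.
- by rewrite lte_fin => xy; exists ((x + y) / 2)%R; rewrite !lte_fin; split; lra.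
- by move=> _; exists (x + 1)%R; rewrite ltry lte_fin; split; [lra|].
- by move=> _; exists (y - 1)%R; rewrite ltNyr lte_fin; split; [|lra].
- by move=> _; exists 0%R; rewrite ltNyr ltry.
Qed.

Lemma le_real_below {R : realType} (x y : \bar R) :
  (forall s : R, s%:E < x -> s%:E <= y) -> x <= y.
Proof.
move=> H; rewrite leNgt; apply/negP => /real_between[s [ys sx]].
by have := H _ sx; rewrite leNgt ys.
Qed.

Section integral_comparison.
Context {d : measure_display} {T : measurableType d} {R : realType}.
Variable mu : {measure set T -> \bar R}.
Import HBNNSimple.

(** Monotonicity for functions that are not assumed measurable: the integral of a
    nonnegative function is a supremum over the simple functions below it. *)
Lemma le_integral_ge0 (D : set T) (f g : T -> \bar R) :
  (forall x, D x -> 0 <= g x) -> (forall x, D x -> f x <= g x) ->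
  \int[mu]_(x in D) f x <= \int[mu]_(x in D) g x.
Proof.
move=> g0 fg; rewrite integralE.
have n0 : 0 <= \int[mu]_(x in D) f^\- x by apply: integral_ge0 => x _.
apply: (@le_trans _ _ (\int[mu]_(x in D) f^\+ x)); first by rewrite geeDl// oppe_le0.
rewrite !ge0_integralE//.
apply: le_ereal_sup => _ [h hf <-]; exists h => // x.
apply: (le_trans (hf x)); rewrite !patchE; case: ifPn => // /set_mem Dx.
by rewrite funeposE ge_max fg// g0.
Qed.

(** A simple function below [f] may be cut off on the null set where the comparison
    fails: this changes neither its measurability nor its integral. *)
Lemma ae_le_integral_ge0 (f g : T -> \bar R) :
  (forall x, 0 <= f x) -> (forall x, 0 <= g x) ->
  {ae mu, forall x, f x <= g x} ->
  \int[mu]_x f x <= \int[mu]_x g x.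
Proof.
move=> f0 g0 [N [mN N0 fgN]].
rewrite ge0_integralTE//; apply: ge_ereal_sup => _ [h hf <-].
rewrite -integralT_nnsfun.
have mh : measurable_fun setT (EFin \o h) by exact/measurable_EFinP.
rewrite (@ge0_negligible_integral _ _ _ _ _ N)//=; last first.
  by move=> x _; rewrite lee_fin.
rewrite setTD integral_mkcond.
apply: le_integral_ge0 => // x _; rewrite patchE; case: ifPn => [|_]; last first.
  exact: g0.
rewrite inE => Nx; apply: (le_trans (hf x)).
by apply: contrapT => nfg; apply: Nx; exact: fgN.
Qed.

Lemma integral_one (D : set T) : measurable D ->
  \int[mu]_(x in D) (@cst T R 1%R x)%:E = mu D.
Proof.
by move=> mD; rewrite -[RHS]mul1e; exact: (integral_cst mu mD 1%:E).
Qed.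

Lemma linear_le_integral (D : set T) (p q : T -> R) (a b : R) (f : T -> \bar R) :
  measurable D -> measurable_fun D p -> measurable_fun D q ->
  (forall x, 0 <= p x)%R -> (forall x, 0 <= q x)%R ->
  \int[mu]_(x in D) (p x)%:E < +oo -> \int[mu]_(x in D) (q x)%:E < +oo ->
  (forall x, D x -> 0 <= f x) ->
  (forall x, D x -> (a * p x + b * q x)%:E <= f x) ->
  a%:E * \int[mu]_(x in D) (p x)%:E + b%:E * \int[mu]_(x in D) (q x)%:E
    <= \int[mu]_(x in D) f x.
Proof.
move=> mD mp mq p0 q0 ip iq f0 pqf.
have ig (g : T -> R) : measurable_fun D g -> (forall x, 0 <= g x)%R ->
    \int[mu]_(x in D) (g x)%:E < +oo -> mu.-integrable D (EFin \o g).
  move=> mg g0 ig; apply/integrableP; split; first exact/measurable_EFinP.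
  by under eq_integral do rewrite /= ger0_norm//.
rewrite -!integralZl//; [|exact: ig..].
rewrite -integralD//; [|by apply: integrableZl => //; exact: ig..].
by apply: le_integral_ge0 => // x Dx; rewrite -!EFinM -EFinD; exact: pqf.
Qed.

End integral_comparison.

Section perspective.
Context {R : realType}.
Variables a b : nat -> R.

(** If [F s] is the supremum of the [a k * s + b k], this is the perspective
    [r F(t / r)] for [r > 0], and its recession limit at [r = 0]. It is also the
    perspective [t R(r / t)] of the reverse entropy when [t > 0]. *)
Definition persp (r t : R) : \bar R :=
  ereal_sup (range (fun k => (a k * t + b k * r)%:E)).

(** The maximum of finitely many of the functions in [persp]; the additional 0 is
    harmless once [a 0 = b 0 = 0]. *)
Fixpoint pmax (n : nat) (r t : R) : R :=
  if n is m.+1 then Num.max (pmax m r t) (a n * t + b n * r)%R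
  else Num.max 0%R (a 0 * t + b 0 * r)%R.

Lemma persp_ge k r t : (a k * t + b k * r)%:E <= persp r t.
Proof. by apply: ereal_sup_ubound; exists k. Qed.

Lemma pmax_ge0 n r t : (0 <= pmax n r t)%R.
Proof. by elim: n => [|n IH] /=; rewrite le_max ?lexx// IH. Qed.

Lemma pmax_homo r t : {homo (fun n => pmax n r t) : n m / (n <= m)%N >-> (n <= m)%R}.
Proof. by apply: homo_leq => [//||n]; [exact: le_trans|rewrite /= le_max lexx]. Qed.

Lemma pmax_ge k n r t : (k <= n)%N -> (a k * t + b k * r <= pmax n r t)%R.
Proof.
move=> kn; apply: le_trans (pmax_homo r t kn).
by case: k {kn} => [|k] /=; rewrite le_max lexx orbT.
Qed.

Lemma measurable_pmax d (T : measurableType d) n (r t : T -> R) :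
  measurable_fun setT r -> measurable_fun setT t ->
  measurable_fun setT (fun x => pmax n (r x) (t x)).
Proof.
move=> mr mt; elim: n => [|n IH].
  by apply: measurable_maxr => //; apply: measurable_funD; exact: measurable_funM.
by apply: measurable_maxr => //; apply: measurable_funD; exact: measurable_funM.
Qed.

Hypotheses (a0 : a 0 = 0%R) (b0 : b 0 = 0%R).

Lemma persp_ge0 r t : 0 <= persp r t.
Proof. by apply: le_trans (persp_ge 0 r t); rewrite a0 b0 !mul0r addr0. Qed.

Lemma pmax_attained n r t : exists2 k, (k <= n)%N & pmax n r t = (a k * t + b k * r)%R.
Proof.
elim: n => [|n [k kn IH]].
  exists 0%N => //=; rewrite a0 b0 !mul0r addr0.
  by rewrite maxxx.
rewrite /= IH; case: leP => _; first by exists n.+1.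
by exists k => //; exact: leqW.
Qed.

Lemma pmax_le n r t : (pmax n r t)%:E <= persp r t.
Proof. by have [k _ ->] := pmax_attained n r t; exact: persp_ge. Qed.

Lemma persp_pmax r t : persp r t = ereal_sup (range (fun n => (pmax n r t)%:E)).
Proof.
apply/eqP; rewrite eq_le; apply/andP; split.
  apply: ge_ereal_sup => _ [k _ <-].
  apply: (@le_trans _ _ (pmax k r t)%:E); first by rewrite lee_fin pmax_ge.
  by apply: ereal_sup_ubound; exists k.
by apply: ge_ereal_sup => _ [k _ <-]; exact: pmax_le.
Qed.

Lemma cvg_pmax r t : (pmax n r t)%:E @[n --> \oo] --> persp r t.
Proof.
rewrite persp_pmax; apply: ereal_nondecreasing_cvgn => m n mn.
by rewrite lee_fin pmax_homo.
Qed.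

Lemma measurable_persp d (T : measurableType d) (r t : T -> R) :
  measurable_fun setT r -> measurable_fun setT t ->
  measurable_fun setT (fun x => persp (r x) (t x)).
Proof.
move=> mr mt.
apply: (@emeasurable_fun_cvg _ _ _ _ (fun n x => (pmax n (r x) (t x))%:E)).
  by move=> n; apply/measurable_EFinP; exact: measurable_pmax.
by move=> x _; exact: cvg_pmax.
Qed.

Lemma cvg_integral_pmax d (T : measurableType d)
    (mu : {measure set T -> \bar R}) (r t : T -> R) :
  measurable_fun setT r -> measurable_fun setT t ->
  \int[mu]_x (pmax n (r x) (t x))%:E @[n --> \oo]
    --> \int[mu]_x persp (r x) (t x).
Proof.
move=> mr mt.
rewrite (_ : (fun x => persp (r x) (t x)) =
    (fun x => limn (fun n => (pmax n (r x) (t x))%:E))); last first.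
  by apply/funext => x; apply/esym/cvg_lim => //; exact: cvg_pmax.
apply: cvg_monotone_convergence => //.
- by move=> n; apply/measurable_EFinP; exact: measurable_pmax.
- by move=> n x _; rewrite lee_fin pmax_ge0.
- by move=> x _ m n mn; rewrite lee_fin pmax_homo.
Qed.

End perspective.

Lemma persp_swap {R : realType} (a b : nat -> R) r t : persp a b r t = persp b a t r.
Proof. by rewrite /persp; under eq_fun do rewrite addrC. Qed.

Section variational_formula.
Context {d : measure_display} {T : measurableType d} {R : realType}.
Implicit Types gam mu : {finite_measure set T -> \bar R}.
Variables a b : nat -> R.
Hypotheses (a0 : a 0 = 0%R) (b0 : b 0 = 0%R).

Definition fin_partition (n : nat) (A : nat -> set T) : Prop :=
  [/\ forall k, measurable (A k), trivIset setT A &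
      \big[setU/set0]_(k < n.+1) A k = setT].

(** The entropy functionals are suprema of these sums over the finite partitions;
    each sum is linear in the pair of measures. *)
Definition affine_sum gam mu n (A : nat -> set T) : \bar R :=
  \sum_(k < n.+1) ((a k)%:E * gam (A k) + (b k)%:E * mu (A k)).

Lemma integral_partition (nu : {measure set T -> \bar R}) n A (f : T -> \bar R) :
  fin_partition n A -> measurable_fun setT f -> (forall x, 0 <= f x) ->
  \int[nu]_x f x = \sum_(k < n.+1) \int[nu]_(x in A k) f x.
Proof.
move=> [mA tA UA] mf f0.
rewrite -UA -(big_mkord xpredT) ge0_integral_bigsetU//.
- by rewrite big_mkord.
- exact: iota_uniq.
- by move=> i j _ _; exact: tA.
- by rewrite big_mkord UA.
Qed.

(** On each cell the affine function indexed by the cell is integrated: it lies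
    below [f] against the absolutely continuous part, and its slope below [l]
    against the singular part. *)
Lemma affine_sum_le gam mu gam' (sigma : T -> R) n A (f : T -> \bar R) (l : \bar R) :
  measurable_fun setT sigma -> (forall x, 0 <= sigma x)%R ->
  (forall B, measurable B -> gam B = \int[mu]_(x in B) (sigma x)%:E + gam' B) ->
  measurable_fun setT f -> (forall x, 0 <= f x) ->
  (forall k x, (k <= n)%N -> (a k * sigma x + b k)%:E <= f x) ->
  0 <= l -> (forall k, (k <= n)%N -> (a k)%:E <= l) ->
  fin_partition n A ->
  affine_sum gam mu n A <= \int[mu]_x f x + l * gam' setT.
Proof.
move=> ms s0 dec mf f0 lf l0 al pA; have [mA tA UA] := pA.
rewrite (integral_partition mu pA mf f0).
rewrite -(integral_cst gam' measurableT) (@integral_partition _ _ _ _ pA)//.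
rewrite -big_split; apply: lee_sum => k _ /=.
have -> : \int[gam']_(x in A k) cst l x = l * gam' (A k) by exact: integral_cst.
rewrite dec// muleDr//; last first.
  by rewrite fin_num_adde_defl// fin_num_measure.
rewrite addeAC; apply: leeD; last first.
  by apply: lee_wpmul2r => //; apply: al; rewrite -ltnS.
rewrite -(integral_one mu (mA k)).
apply: linear_le_integral => //.
- exact: measurable_funS ms.
- apply: le_lt_trans (_ : gam (A k) < +oo); last by rewrite ltey_eq fin_num_measure.
  by rewrite dec// leeDl.
- by rewrite integral_one// ltey_eq fin_num_measure.
- by move=> x _; rewrite mulr1; apply: lf; rewrite -ltnS.
Qed.

Lemma variational_le gam mu gam' (sigma : T -> R) n A :
  measurable_fun setT sigma -> (forall x, 0 <= sigma x)%R ->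
  (forall B, measurable B -> gam B = \int[mu]_(x in B) (sigma x)%:E + gam' B) ->
  fin_partition n A ->
  affine_sum gam mu n A <=
    \int[mu]_x persp a b 1 (sigma x) + persp a b 0 1 * gam' setT.
Proof.
move=> ms s0 dec; apply: affine_sum_le => //.
- exact: ms.
- exact: (@measurable_persp _ a b a0 b0 _ T (cst 1%R) sigma).
- by move=> x; exact: persp_ge0.
- by move=> k x _; apply: le_trans (persp_ge a b k 1 (sigma x)); rewrite mulr1.
- exact: persp_ge0.
- by move=> k _; apply: le_trans (persp_ge a b k 0 1); rewrite mulr1 mulr0 addr0.
Qed.

(** A finite maximum [pmax n] nearly realizes both terms. The cells consist of the
    points where a given index attains the maximum: of the affine functions
    evaluated at [sigma] off the null set [N] carrying the singular part, of the
    slopes on [N]. *)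
Lemma variational_lt gam mu sigma gam' (s : R) :
  is_lebesgue_decomposition gam mu sigma gam' ->
  s%:E < \int[mu]_x persp a b 1 (sigma x) + persp a b 0 1 * gam' setT ->
  exists n A, fin_partition n A /\ s%:E < affine_sum gam mu n A.
Proof.
move=> [ms s0 [M [mM M0 MC0]] dec] slt.
pose N := ~` M.
have mN : measurable N by exact: measurableC.
pose J n := \int[mu]_x (pmax a b n 1 (sigma x))%:E +
            \int[gam']_x (pmax a b n (cst 0%R x) (cst 1%R x))%:E.
have Jcvg : J n @[n --> \oo] -->
    \int[mu]_x persp a b 1 (sigma x) + persp a b 0 1 * gam' setT.
  rewrite -(integral_cst gam' measurableT).
  apply: cvgeD; last 2 first.
  - by apply: (@cvg_integral_pmax _ _ _ a0 b0 _ _ mu (cst 1%R) sigma).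
  - by apply: (@cvg_integral_pmax _ _ _ a0 b0 _ _ gam' (cst 0%R) (cst 1%R)).
  apply: ge0_adde_def; rewrite inE; apply: integral_ge0 => x _; exact: persp_ge0.
have [n sJ] : exists n, s%:E < J n.
  have /Jcvg [n _ Hn] : nbhs (\int[mu]_x persp a b 1 (sigma x) +
      persp a b 0 1 * gam' setT) [set y | s%:E < y].
    by apply: open_nbhs_nbhs; split => //; exact: open_ereal_gt_ereal.
  by exists n; exact: (Hn n (leqnn n)).
exists n.
pose u k x : R := if x \in N then a k else (a k * sigma x + b k)%R.
pose B k : set T := \bigcap_(i in `I_n.+1) [set x | (u i x <= u k x)%R].
have mu_ k : measurable_fun setT (u k).
  apply: measurable_fun_ifT => //.
    apply: (@measurable_fun_bool _ _ _ _ true) => //.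
    rewrite setTI (_ : _ @^-1` _ = N)//.
    by apply/seteqP; split => x /=; [move/set_mem|move/mem_set].
  by apply: measurable_funD => //; exact: measurable_funM.
have mB k : measurable (B k).
  apply: bigcap_measurableType => i _.
  rewrite -[X in measurable X]setTI.
  exact: measurable_fun_le.
(* The sets [B k] overlap where several indices attain the maximum; [seqDU] keeps
   the least such index. *)
exists (seqDU B).
have pA : fin_partition n (seqDU B).
  split.
  - move=> k; apply: measurableD => //; exact: bigsetU_measurable.
  - exact: trivIset_seqDU.
  - rewrite -bigsetU_seqDU; apply/seteqP; split => // x _.
    rewrite -bigcup_mkord.
    suff [k kn Bk] : exists2 k, (k <= n)%N & B k x by exists k.
    have [xN|xN] := boolP (x \in N).
      have [k kn kE] := pmax_attained a0 b0 n 0 1.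
      exists k => // i; rewrite /= /u ltnS => iN; rewrite xN.
      move: kE; rewrite mulr0 mulr1 addr0 => <-.
      by apply: le_trans (pmax_ge a b 0 1 iN); rewrite mulr0 mulr1 addr0.
    have [k kn kE] := pmax_attained a0 b0 n 1 (sigma x).
    exists k => // i; rewrite /= /u ltnS (negbTE xN) => iN.
    move: kE; rewrite mulr1 => <-.
    by apply: le_trans (pmax_ge a b 1 (sigma x) iN); rewrite mulr1.
split => //; apply: (lt_le_trans sJ).
have [mA tA UA] := pA.
have uE k x : (k < n.+1)%N -> seqDU B k x -> u k x =
    if x \in N then pmax a b n 0 1 else pmax a b n 1 (sigma x).
  move=> kn [Bkx _]; apply/eqP; rewrite eq_le; apply/andP; split.
    rewrite /u; case: ifPn => _.
      by apply: le_trans (pmax_ge a b 0 1 _); [|exact: kn]; rewrite mulr0 mulr1 addr0.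
    by apply: le_trans (pmax_ge a b 1 (sigma x) _); [|exact: kn]; rewrite mulr1.
  case: ifPn => xN.
    have [i iN ->] := pmax_attained a0 b0 n 0 1.
    by have := Bkx i iN; rewrite /= /u xN mulr0 mulr1 addr0.
  have [i iN ->] := pmax_attained a0 b0 n 1 (sigma x).
  by have := Bkx i iN; rewrite /= /u (negbTE xN) mulr1.
rewrite /J (@integral_partition mu _ _ _ pA)//; last 2 first.
- apply/measurable_EFinP; exact: measurable_pmax.
- by move=> x; rewrite lee_fin pmax_ge0.
rewrite (@integral_partition gam' _ _ _ pA)//; last 2 first.
- apply/measurable_EFinP; exact: measurable_pmax.
- by move=> x; rewrite lee_fin pmax_ge0.
rewrite -big_split; apply: lee_sum => k _ /=.
have mAk := mA k.
have fs : \int[mu]_(x in seqDU B k) (sigma x)%:E < +oo.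
  apply: le_lt_trans (_ : gam (seqDU B k) < +oo); last by rewrite ltey_eq fin_num_measure.
  by rewrite dec// leeDl.
have is_ : mu.-integrable (seqDU B k) (EFin \o sigma).
  apply/integrableP; split.
    by apply/measurable_EFinP; exact: measurable_funS ms.
  by under eq_integral do rewrite /= ger0_norm//.
rewrite [in leRHS]dec// muleDr//; last first.
  by rewrite fin_num_adde_defl// fin_num_measure.
rewrite [leRHS]addeAC; apply: leeD.
  have -> : mu (seqDU B k) = \int[mu]_(x in seqDU B k) (@cst T R 1%R x)%:E.
    by rewrite integral_one.
  rewrite -!integralZl//; last first.
    by apply: finite_measure_integrable_cst.
  rewrite -integralD//; [|exact: integrableZl|]; last first.
    by apply: integrableZl => //; exact: finite_measure_integrable_cst.
  rewrite le_eqVlt; apply/orP; left; apply/eqP; apply: ae_eq_integral => //.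
  - apply/measurable_EFinP; apply: (measurable_funS measurableT) => //.
    exact: measurable_pmax.
  - apply: emeasurable_funD; apply/measurable_EFinP.
      apply: measurable_funM => //; exact: measurable_funS ms.
    by apply: measurable_funM.
  - exists N; split => //.
    move=> x /= /not_implyP[Ax]; apply: contra_notP => xN.
    have := uE k x (ltn_ord k) Ax; rewrite /u ifN; last by rewrite notin_setE.
    by rewrite ifN ?notin_setE// => <- /=; rewrite mule1 EFinD EFinM.
rewrite -integral_cst//.
rewrite le_eqVlt; apply/orP; left; apply/eqP; apply: ae_eq_integral => //.
exists M; split => //.
move=> x /= /not_implyP[Ax]; apply: contra_notP => xM.
have := uE k x (ltn_ord k) Ax; rewrite /u ifT; last by rewrite inE.
by rewrite ifT ?inE// => ->.
Qed.

End variational_formula.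

(** * Weak lower semicontinuity of integrals *)

Section eventually_above.
Context {R : realType}.
Variable U : set_system nat.
Hypothesis FU : Filter U.

(** This says that [l] is at most the lower limit of [u] along [U]. *)
Definition eventually_above (u : nat -> R) (l : R) : Prop :=
  forall e : R, (0 < e)%R -> \forall m \near U, (l - e < u m)%R.

Lemma eventually_above_cst l : eventually_above (fun=> l) l.
Proof. by move=> e e0; apply: filterE => m; rewrite ltrBlDr ltrDl. Qed.

Lemma eventually_aboveD u v l k : eventually_above u l ->
  eventually_above v k -> eventually_above (fun m => u m + v m)%R (l + k)%R.
Proof.
move=> ul vk e e0; have e20 : (0 < e / 2)%R by rewrite divr_gt0.
apply: filterS2 (ul _ e20) (vk _ e20) => m H1 H2.
by rewrite [e]splitr opprD addrACA ltrD.
Qed.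

Lemma eventually_aboveZ c u l : (0 <= c)%R -> eventually_above u l ->
  eventually_above (fun m => c * u m)%R (c * l)%R.
Proof.
rewrite le_eqVlt => /predU1P[<- _|c0 ul e e0].
  by rewrite mul0r; under eq_fun do rewrite mul0r; exact: eventually_above_cst.
have ec : (0 < e / c)%R by rewrite divr_gt0.
apply: filterS (ul _ ec) => m.
rewrite -(ltr_pM2l c0) mulrBr mulrC (mulrC c (e / c)%R) divfK ?gt_eqF//.
Qed.

Lemma eventually_above_sum n (u : nat -> nat -> R) (l : nat -> R) :
  (forall k, (k < n)%N -> eventually_above (u k) (l k)) ->
  eventually_above (fun m => \sum_(k < n) u k m)%R (\sum_(k < n) l k)%R.
Proof.
elim: n => [|n IH] H.
  by rewrite big_ord0; under eq_fun do rewrite big_ord0; exact: eventually_above_cst.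
rewrite big_ord_recr/=; under eq_fun do rewrite big_ord_recr/=.
by apply: eventually_aboveD; [apply: IH => k kn; apply: H; exact: leqW|exact: H].
Qed.

End eventually_above.

Lemma fine_measureK {d} {T : measurableType d} {R : realType}
  (mu : {finite_measure set T -> \bar R}) A : measurable A ->
  mu A = (fine (mu A))%:E.
Proof. by move=> mA; rewrite fineK// fin_num_measure. Qed.

Section weak_lsc.
Import HBNNSimple.
Context {R : realType} {T : ptopologicalType}.
Variables (U : set_system nat) (g : nat -> {finite_measure set (borel T) -> \bar R})
  (g0 : {finite_measure set (borel T) -> \bar R}).
Hypotheses (UU : UltraFilter U) (gcvg : weak_cvg U g g0).

Let FU : Filter U. Proof. exact: filter_filter. Qed.

Lemma weak_cvg_open (G : set T) : open G ->
  eventually_above U (fun m => fine (g m G)) (fine (g0 G)).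
Proof.
move=> oG e e0; have mG := open_borel oG.
have : (fine (g0 G) - e)%:E < g0 G.
  by rewrite [ltRHS]fine_measureK// lte_fin ltrBlDr ltrDl.
move=> /(gcvg.1 _ _ oG); apply: filterS => m.
by rewrite [ltRHS](fine_measureK (g m) mG) lte_fin.
Qed.

Lemma weak_cvg_total (c : R) :
  eventually_above U (fun m => c * fine (g m setT))%R (c * fine (g0 setT))%R.
Proof.
have [c0|c0] := leP 0%R c.
  by apply: eventually_aboveZ => //; exact: (weak_cvg_open openT).
rewrite (_ : (fun m => _) = (fun m => - c * - fine (g m setT))%R); last first.
  by apply/funext => m; rewrite mulrNN.
rewrite -mulrNN; apply: eventually_aboveZ => //; first by rewrite oppr_ge0 ltW.
move=> e e0.
have : g0 setT < (fine (g0 setT) + e)%:E.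
  by rewrite [ltLHS]fine_measureK// lte_fin ltrDl.
move=> /gcvg.2; apply: filterS => m.
by rewrite [ltLHS](fine_measureK (g m) measurableT) lte_fin -opprD ltrN2.
Qed.

(** A layer cake argument: [c] dominates the staircase [sum_j e 1_(G j)] over its
    open superlevel sets, and the staircase stays within [e] of any bounded simple
    function below [c]. *)
Lemma weak_lsc_integral (c : T -> \bar R) (s : R) :
  (forall x, 0 <= c x) -> lower_semicontinuous c ->
  s%:E < \int[g0]_x c x -> \forall m \near U, s%:E < \int[g m]_x c x.
Proof.
move=> c0 lsc slt.
have oc (t : R) : open [set x | t%:E < c x].
  by move/lower_semicontinuousP : lsc; exact.
have [h hc sh] : exists2 h : {nnsfun (borel T) >-> R},
    forall x, (h x)%:E <= c x & s%:E < \int[g0]_x (h x)%:E.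
  move: slt; rewrite ge0_integralTE// => /ereal_sup_gt[_ [h hc <-] sh].
  by exists h => //; rewrite integralT_nnsfun.
have [M [Mreal /(_ (M + 1)%R)]] := simple_bounded h.
rewrite ltrDl => /(_ ltr01) hM.
have {}hM x : (h x <= M + 1)%R by apply: le_trans (hM x I); exact: ler_norm.
have M0 : (0 <= M + 1)%R by apply: le_trans (hM point); exact: fun_ge0.
pose I := fine (\int[g0]_x (h x)%:E).
have IE : \int[g0]_x (h x)%:E = I%:E.
  rewrite /I fineK// ge0_fin_numE; last first.
    by apply: integral_ge0 => x _; rewrite lee_fin; exact: fun_ge0.
  apply: (@le_lt_trans _ _ (\int[g0]_x (cst (M + 1)%:E x))).
    by apply: le_integral_ge0 => x _; rewrite lee_fin.
  by rewrite integral_cst// [X in _ * X]fine_measureK// -EFinM ltry.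
move: sh; rewrite IE lte_fin => sI.
pose X := fine (g0 setT).
have X0 : (0 <= X)%R by rewrite fine_ge0.
(* The step [e] costs at most [e] times the total mass, and [N] steps reach the
   bound of [h]. *)
have [e e0 eX] : exists2 e : R, (0 < e)%R & (e * X < I - s)%R.
  have X1 : (0 < X + 1)%R by rewrite ltr_wpDl.
  exists ((I - s) / (X + 1))%R; first by rewrite divr_gt0 ?subr_gt0.
  by rewrite mulrAC ltr_pdivrMr// ltr_pM2l ?subr_gt0// ltrDl.
pose N := (Num.trunc ((M + 1) / e)).+1.
have NM : (M + 1 <= N%:R * e)%R.
  rewrite -ler_pdivrMr//; apply: ltW.
  by have := truncnS_gt ((M + 1) / e)%R.
pose G j : set T := [set x | (j.+1%:R * e)%:E < c x].
pose stair n x : R := (\sum_(j < n) e * \1_(G j) x)%R.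
have stair_ge0 n x : (0 <= stair n x)%R.
  by apply: sumr_ge0 => j _; rewrite mulr_ge0// ltW.
have stair_le n x : (stair n x)%:E <= c x.
  have sn m : (stair m x <= m%:R * e)%R.
    elim: m => [|m IHm]; first by rewrite /stair big_ord0 mul0r.
    rewrite /stair big_ord_recr/= -[in leRHS]addn1 natrD mulrDl mul1r.
    by apply: lerD => //; rewrite ler_piMr ?(ltW e0)// indicE; case: (_ \in _).
  elim: n => [|n IH]; first by rewrite /stair big_ord0.
  have [Gx|nGx] := pselect (G n x).
    by apply: le_trans (ltW Gx); rewrite lee_fin.
  rewrite /stair big_ord_recr/= indicE memNset// mulr0 addr0.
  exact: IH.
have stair_ge n x : (Num.min (h x) (n.+1%:R * e) - e <= stair n x)%R.
  elim: n => [|n IH].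
    by rewrite /stair big_ord0 subr_le0 ge_min mul1r lexx orbT.
  rewrite /stair big_ord_recr/= -/(stair n x).
  have [hx|hx] := leP (h x) (n.+1%:R * e)%R.
    apply: (@le_trans _ _ (stair n x)).
      by apply: le_trans IH; rewrite lerB// (min_idPl hx) ge_min lexx.
    by rewrite lerDl mulr_ge0// ltW.
  rewrite indicE mem_set/=; last first.
    by rewrite /G/=; apply: lt_le_trans (hc x); rewrite lte_fin.
  rewrite mulr1 (@le_trans _ _ (n.+1%:R * e)%R)//.
    rewrite lerBlDr ge_min; apply/orP; right.
    by rewrite -[in leLHS]addn1 natrD mulrDl mul1r.
  rewrite -lerBlDr; apply: le_trans IH.
  by rewrite (min_idPr (ltW hx)) -addn1 natrD; lra.
have int_stair (nu : {finite_measure set (borel T) -> \bar R}) :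
    \int[nu]_x (stair N x)%:E = (\sum_(j < N) e * fine (nu (G j)))%:E.
  rewrite /stair; under eq_integral do rewrite -sumEFin.
  rewrite ge0_integral_sum//.
  - rewrite -sumEFin; apply: eq_bigr => j _.
    under eq_integral do rewrite EFinM.
    rewrite ge0_integralZl//; last 2 first.
    + apply/measurable_EFinP; apply: measurable_indic; exact: open_borel (oc _).
    + by rewrite lee_fin ltW.
    rewrite integral_indic//; last exact: open_borel (oc _).
    by rewrite setIT EFinM fineK// fin_num_measure//; exact: open_borel (oc _).
  - move=> j; apply/measurable_EFinP; apply: measurable_funM => //.
    apply: measurable_indic; exact: open_borel (oc _).
  - by move=> j x _; rewrite lee_fin mulr_ge0// ltW.
have sst : (s < \sum_(j < N) e * fine (g0 (G j)))%R.
  rewrite -(ltrD2r (e * X)) -lte_fin; apply: (@lt_le_trans _ _ I%:E).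
    by rewrite lte_fin -ltrBrDl.
  rewrite -IE EFinD -int_stair EFinM /X fineK ?fin_num_measure// -integral_cst//.
  rewrite -ge0_integralD//; last 3 first.
  - by move=> x _; rewrite lee_fin.
  - apply/measurable_EFinP; apply: measurable_sum => j.
    apply: measurable_funM => //; apply: measurable_indic; exact: open_borel (oc _).
  - by move=> x _; rewrite lee_fin ltW.
  apply: le_integral_ge0 => x _.
    by apply: adde_ge0; rewrite lee_fin// ltW.
  rewrite -EFinD lee_fin -lerBlDr; apply: le_trans (stair_ge N x).
  rewrite lerB// le_min lexx/= (le_trans (hM x))// (le_trans NM)//.
  by rewrite ler_pM2r// ler_nat.
have := @eventually_above_sum R U FU N (fun j m => e * fine (g m (G j)))%R
  (fun j => e * fine (g0 (G j)))%R.
have H : forall k : nat, (k < N)%N -> eventually_above U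
    (fun m => e * fine (g m (G k)))%R (e * fine (g0 (G k)))%R.
  move=> k _; apply: eventually_aboveZ; first exact: ltW.
  exact/weak_cvg_open/oc.
move=> /(_ H); move: (sst); rewrite -subr_gt0 => sst0 /(_ _ sst0).
apply: filterS => m; rewrite subKr => Hm.
apply: (@lt_le_trans _ _ (\int[g m]_x (stair N x)%:E)).
  by rewrite int_stair lte_fin.
by apply: le_integral_ge0 => x _; [exact: c0|exact: stair_le].
Qed.

End weak_lsc.

(** * Weak lower semicontinuity of affine sums *)

Lemma separate_family (T : topologicalType) (n : nat) (K : nat -> set T) :
  hausdorff_space T -> (forall k, compact (K k)) -> trivIset setT K ->
  exists W : nat -> set T, [/\ forall k, open (W k),
    forall k, (k < n)%N -> K k `<=` W k &
    forall i j, (i < n)%N -> (j < n)%N -> i != j -> W i `&` W j = set0].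
Proof.
move=> hT cK tK.
have /choice[f Hf] (p : nat * nat) : exists UV : set T * set T,
    [/\ open UV.1, open UV.2, p.1 != p.2 -> K p.1 `<=` UV.1,
        p.1 != p.2 -> K p.2 `<=` UV.2 & p.1 != p.2 -> UV.1 `&` UV.2 = set0].
  have [pp|pp] := eqVneq p.1 p.2.
    by exists (set0, set0); split => //; exact: open0.
  have KK0 : K p.1 `&` K p.2 = set0 by move/trivIsetP : tK; exact.
  have [U [V [oU oV KU KV UV0]]] := separate_compacts hT (cK p.1) (cK p.2) KK0.
  by exists (U, V).
pose F i j : set T := if i == j then setT else (f (i, j)).1 `&` (f (j, i)).2.
have FE i j : i != j -> F i j = (f (i, j)).1 `&` (f (j, i)).2.
  by move=> ij; rewrite /F (negbTE ij).
exists (fun i => \big[setI/setT]_(j < n) F i j); split.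
- move=> i; elim/big_ind : _ => [|A B|j _]; [exact: openT|exact: openI|].
  rewrite /F; case: ifPn => _; first exact: openT.
  by apply: openI; [have [] := Hf (i, nat_of_ord j)|have [] := Hf (nat_of_ord j, i)].
- move=> i iN; elim/big_ind : _ => [//|A B KA KB|j _].
    by move=> x Kx; split; [exact: KA|exact: KB].
  rewrite /F; case: ifPn => // ij x Kx; split.
    by have [_ _ + _ _] := Hf (i, nat_of_ord j); apply.
  by have [_ _ _ + _] := Hf (nat_of_ord j, i); apply => //=; rewrite eq_sym.
- move=> i j iN jN ij; rewrite -!bigcap_mkord.
  apply/seteqP; split => // x [/(_ j jN) + /(_ i iN)].
  rewrite FE// FE; last by rewrite eq_sym.
  move=> [x1 _] [_ x2].
  by have [_ _ _ _ /(_ ij) <-] := Hf (i, j).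
Qed.

Section regular_approximation.
Context {R : realType} {T : ptopologicalType}.
Implicit Types nu : {finite_measure set (borel T) -> \bar R}.
Hypothesis hT : hausdorff_space T.

Lemma Radon_inner2 nu1 nu2 (B : set (borel T)) (e : R) :
  Radon nu1 -> Radon nu2 -> measurable B -> (0 < e)%R ->
  exists K : set T, [/\ compact K, K `<=` B, nu1 (B `\` K) <= e%:E &
                        nu2 (B `\` K) <= e%:E].
Proof.
move=> r1 r2 mB e0.
have [K1 [c1 K1B le1]] := r1 _ mB _ e0.
have [K2 [c2 K2B le2]] := r2 _ mB _ e0.
exists (K1 `|` K2); split; first exact: compactU.
- by move=> x [/K1B|/K2B].
- apply: le_trans le1; apply: le_measure; rewrite ?inE.
  + by apply: measurableD => //; apply: compact_borel => //; exact: compactU.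
  + by apply: measurableD => //; exact: compact_borel.
  + by move=> x [Bx nK]; split => // K1x; apply: nK; left.
- apply: le_trans le2; apply: le_measure; rewrite ?inE.
  + by apply: measurableD => //; apply: compact_borel => //; exact: compactU.
  + by apply: measurableD => //; exact: compact_borel.
  + by move=> x [Bx nK]; split => // K2x; apply: nK; right.
Qed.

(** Each [A k] is replaced by a compact [K k] inside it; these have disjoint open
    neighbourhoods [W k], from which a compact set of almost all the mass
    outside [K k] is removed. *)
Lemma approximate_by_open nu1 nu2 (A : nat -> set (borel T)) n (e : R) :
  Radon nu1 -> Radon nu2 -> (forall k, measurable (A k)) -> trivIset setT A ->
  (0 < e)%R ->
  exists G : nat -> set T, [/\ forall k, open (G k),
    forall i j, (i < n)%N -> (j < n)%N -> i != j -> G i `&` G j = set0,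
    forall k, (k < n)%N -> (`|fine (nu1 (G k)) - fine (nu1 (A k))| <= e)%R &
    forall k, (k < n)%N -> (`|fine (nu2 (G k)) - fine (nu2 (A k))| <= e)%R].
Proof.
move=> r1 r2 mA tA e0.
have /choice[K HK] (k : nat) := Radon_inner2 r1 r2 (mA k) e0.
have mK k : measurable (K k : set (borel T)).
  by apply: compact_borel => //; have [] := HK k.
have /choice[L HL] (k : nat) := Radon_inner2 r1 r2 (measurableC (mK k)) e0.
have mL k : measurable (L k : set (borel T)).
  by apply: compact_borel => //; have [] := HL k.
have cK k : compact (K k) by have [] := HK k.
have KA k : K k `<=` A k by have [] := HK k.
have tK : trivIset setT K.
  apply/trivIsetP => i j _ _ ij.
  move/trivIsetP : tA => /(_ i j I I ij) A0.
  by apply/seteqP; split => // x [/KA Ai /KA Aj]; rewrite -A0.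
have [W [oW KW W0]] := separate_family n hT cK tK.
have oG k : open (W k `&` ~` L k).
  apply: openI => //; apply: closed_openC; apply: compact_closed => //.
  by have [] := HL k.
have est nu k : (k < n)%N -> nu (A k `\` K k) <= e%:E ->
    nu (~` K k `\` L k) <= e%:E ->
    (`|fine (nu (W k `&` ~` L k)) - fine (nu (A k))| <= e)%R.
  move=> kn leA leL.
  have fK (B : set (borel T)) : measurable B -> nu B = (fine (nu B))%:E.
    exact: fine_measureK.
  have mG := open_borel (oG k).
  have mAK : measurable (A k `\` K k) by exact: measurableD.
  have mKL : measurable ((~` K k `\` L k) : set (borel T)).
    by apply: measurableD => //; exact: measurableC.
  have h1 : (fine (nu (A k)) <= fine (nu (K k)) + e)%R.
    rewrite -lee_fin EFinD -!fK//.
    apply: (@le_trans _ _ (nu (K k) + nu (A k `\` K k))); last by rewrite leeD2l.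
    have -> : nu (A k) = nu (K k `|` (A k `\` K k)).
      by congr (nu _); rewrite setDUK//; exact: KA.
    exact: measureU2.
  have h2 : (fine (nu (K k)) <= fine (nu (W k `&` ~` L k)))%R.
    rewrite -lee_fin -!fK//; apply: le_measure; rewrite ?inE//.
    move=> x Kx; split; first exact: KW.
    by have [_ LK _ _] := HL k; move=> /LK; apply.
  have h3 : (fine (nu (W k `&` ~` L k)) <= fine (nu (K k)) + e)%R.
    rewrite -lee_fin EFinD -!fK//.
    apply: (@le_trans _ _ (nu (K k) + nu (~` K k `\` L k))); last by rewrite leeD2l.
    apply: (@le_trans _ _ (nu (K k `|` (~` K k `\` L k)))).
      apply: le_measure; rewrite ?inE//; first exact: measurableU.
      by move=> x [_ nL]; have [Kx|nK] := pselect (K k x); [left|right].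
    exact: measureU2.
  have h4 : (fine (nu (K k)) <= fine (nu (A k)))%R.
    by rewrite -lee_fin -!fK//; apply: le_measure; rewrite ?inE//; exact: KA.
  by rewrite ler_norml; apply/andP; split; lra.
exists (fun k => W k `&` ~` L k); split => //.
- move=> i j iN jN ij; apply/seteqP; split => // x [[Wi _] [Wj _]].
  by rewrite -(W0 i j).
- by move=> k kn; apply: est => //; [have [] := HK k|have [] := HL k].
- by move=> k kn; apply: est => //; [have [] := HK k|have [] := HL k].
Qed.

End regular_approximation.

Section affine_sum_real.
Context {d : measure_display} {T : measurableType d} {R : realType}.
Implicit Types gam mu : {finite_measure set T -> \bar R}.
Variables a b : nat -> R.

Lemma affine_sum_fine gam mu n A : (forall k, measurable (A k)) ->
  affine_sum a b gam mu n A =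
  (\sum_(k < n.+1) (a k * fine (gam (A k)) + b k * fine (mu (A k))))%:E%R.
Proof.
move=> mA; rewrite /affine_sum -sumEFin; apply: eq_bigr => k _.
by rewrite EFinD !EFinM -!fine_measureK.
Qed.

Lemma fin_partition_total gam n A : fin_partition n A ->
  (\sum_(k < n.+1) fine (gam (A k)))%R = fine (gam setT).
Proof.
move=> [mA tA UA]; apply: EFin_inj; rewrite -fine_measureK// -UA -sumEFin.
rewrite measure_bigsetU_ord//; last first.
  by move=> i j _ _ /(tA _ _ I I)/ord_inj.
by apply: eq_bigr => k _; rewrite -fine_measureK.
Qed.

End affine_sum_real.

(** The slopes may be negative, and only the masses of open sets are lower
    semicontinuous. Subtracting the least slope [a k0] from all of them leaves
    nonnegative coefficients and a multiple of the total mass, which converges.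
    The cells other than [k0] can then be taken open, and the [k0]-th one is
    whatever remains: its coefficient has become 0. *)
Lemma affine_sum_lsc {R : realType} {T : ptopologicalType} (a b : nat -> R)
    (U : set_system nat) (g : nat -> {finite_measure set (borel T) -> \bar R})
    (g0 mu : {finite_measure set (borel T) -> \bar R}) n (A : nat -> set (borel T))
    (s : R) :
  UltraFilter U -> hausdorff_space T -> Radon g0 -> Radon mu ->
  weak_cvg U g g0 -> fin_partition n A -> s%:E < affine_sum a b g0 mu n A ->
  exists2 A', fin_partition n A' &
    \forall m \near U, s%:E < affine_sum a b (g m) mu n A'.
Proof.
move=> UU hT rg0 rmu gcvg pA; have [mA tA UA] := pA.
have FU : Filter U by exact: filter_filter.
rewrite affine_sum_fine// lte_fin.
set S := (\sum_(k < n.+1) _)%R => sS.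
pose C : R := (\sum_(k < n.+1) (`|a k| + `|b k|))%R.
have C0 : (0 <= C)%R by apply: sumr_ge0 => k _; rewrite addr_ge0.
have [e e0 eC] : exists2 e : R, (0 < e)%R & (n.+1%:R * e * C < S - s)%R.
  have C1 : (0 < C + 1)%R by rewrite ltr_wpDl.
  have n0 : (0 < n.+1%:R :> R)%R by rewrite ltr0n.
  exists ((S - s) / (C + 1) / n.+1%:R)%R; first by rewrite !divr_gt0 ?subr_gt0.
  rewrite [X in (X * C)%R]mulrC divfK ?gt_eqF// mulrAC.
  by rewrite ltr_pdivrMr// ltr_pM2l ?subr_gt0// ltrDl.
pose k0 : 'I_n.+1 := [arg min_(k < (ord0 : 'I_n.+1)) a k]%O.
have k0min (k : 'I_n.+1) : (a k0 <= a k)%R.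
  by rewrite /k0; case: arg_minP => // i _; apply.
have [G [oG G0 G1 G2]] := approximate_by_open hT n.+1 rg0 rmu mA tA e0.
pose G' k : set T := if (k < n.+1)%N && (k != k0 :> nat) then G k else set0.
have oG' k : open (G' k) by rewrite /G'; case: ifP => _; [|exact: open0].
pose A' k : set (borel T) := if k == k0 :> nat then ~` \bigcup_j G' j else G' k.
have mA' k : measurable (A' k).
  rewrite /A'; case: ifP => _; last exact: open_borel.
  by apply: measurableC; apply: open_borel; exact: bigcup_open.
have G'k0 : G' k0 = set0 by rewrite /G' eqxx andbF.
have tG' : trivIset setT G'.
  apply/trivIsetP => i j _ _ ij; rewrite /G'.
  case: ifP => [/andP[iN _]|_]; last by rewrite set0I.
  by case: ifP => [/andP[jN _]|_]; [exact: G0|rewrite setI0].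
have pA' : fin_partition n A'.
  split => //.
  - apply/trivIsetP => i j _ _ ij; rewrite /A'.
    have [ik|ik] := eqVneq i k0; have [jk|jk] := eqVneq j k0.
    + by move: ij; rewrite ik jk eqxx.
    + by apply/seteqP; split => // x [nx Gx]; apply: nx; exists j.
    + by apply/seteqP; split => // x [Gx nx]; apply: nx; exists i.
    + by move/trivIsetP : tG'; exact.
  - rewrite -bigcup_mkord; apply/seteqP; split => // x _.
    have [[j _ Gx]|nG] := pselect ((\bigcup_j G' j) x).
      exists j; first by move: Gx; rewrite /G'; case: ifP => // /andP[].
      rewrite /A'; case: ifP => // /eqP jk; by rewrite jk G'k0 in Gx.
    by exists k0; [exact: ltn_ord|rewrite /A' eqxx].
exists A' => //.
have fA'S : (s < \sum_(k < n.+1) (a k * fine (g0 (A' k)) + b k * fine (mu (A' k))))%R.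
  have key (nu : {finite_measure set (borel T) -> \bar R}) : (forall k, (k < n.+1)%N ->
      (`|fine (nu (G k)) - fine (nu (A k))| <= e)%R) ->
      forall k : 'I_n.+1, (`|fine (nu (A' k)) - fine (nu (A k))| <= n.+1%:R * e)%R.
    move=> Gnu.
    have e1 (k : 'I_n.+1) : k != k0 ->
        (`|fine (nu (A' k)) - fine (nu (A k))| <= e)%R.
      move=> kk; rewrite /A' ifN// /G' ltn_ord/= ifT//; exact: Gnu.
    move=> k; have [->|kk] := eqVneq k k0; last first.
      by apply: (le_trans (e1 _ kk)); rewrite ler_peMl ?(ltW e0)// ler1n.
    have := fin_partition_total nu pA'; rewrite -(fin_partition_total nu pA).
    rewrite (bigD1 k0)//= [in RHS](bigD1 k0)//= => eqT.
    have -> : (fine (nu (A' k0)) - fine (nu (A k0)) =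
       - \sum_(i < n.+1 | i != k0) (fine (nu (A' i)) - fine (nu (A i))))%R.
      by rewrite sumrB; move: eqT; set x := fine _; set y := fine (nu (A k0)); lra.
    rewrite normrN; apply: (le_trans (ler_norm_sum _ _ _)).
    apply: (@le_trans _ _ (\sum_(i < n.+1 | i != k0) e)%R); first exact: ler_sum.
    rewrite sumr_const -[leLHS]mulr_natl ler_wpM2r ?(ltW e0)// ler_nat.
    by rewrite (leq_trans (max_card _))// card_ord.
  have : (S - \sum_(k < n.+1) (a k * fine (g0 (A' k)) + b k * fine (mu (A' k)))
      <= n.+1%:R * e * C)%R.
    rewrite /S -sumrB /C mulr_sumr; apply: ler_sum => k _.
    have := key g0 G1 k; have := key mu G2 k.
    set x := fine (g0 (A' k)); set y := fine (g0 (A k)).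
    set z := fine (mu (A' k)); set w := fine (mu (A k)).
    set E := (n.+1%:R * e)%R => zw xy.
    have -> : (a k * y + b k * w - (a k * x + b k * z) =
               - (a k * (x - y)) - (b k * (z - w)))%R by lra.
    apply: (@le_trans _ _ (`|a k| * E + `|b k| * E)%R); last by rewrite mulrDr; lra.
    apply: lerD.
      apply: le_trans (ler_norm _) _; rewrite normrN normrM ler_wpM2l//.
    by apply: le_trans (ler_norm _) _; rewrite normrN normrM ler_wpM2l.
  by move=> H; have := le_lt_trans H eC; lra.
pose l := (\sum_(k < n.+1) ((a k - a k0) * fine (g0 (A' k)))
            + a k0 * fine (g0 setT) + \sum_(k < n.+1) b k * fine (mu (A' k)))%R.
have uE (nu : {finite_measure set (borel T) -> \bar R}) :
    (\sum_(k < n.+1) (a k * fine (nu (A' k)) + b k * fine (mu (A' k))) =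
     \sum_(k < n.+1) ((a k - a k0) * fine (nu (A' k)))
            + a k0 * fine (nu setT) + \sum_(k < n.+1) b k * fine (mu (A' k)))%R.
  rewrite -(fin_partition_total nu pA') mulr_sumr -!big_split/=.
  by apply: eq_bigr => k _; lra.
have h1 : eventually_above U
    (fun m => \sum_(k < n.+1) ((a k - a k0) * fine (g m (A' k))))%R
    (\sum_(k < n.+1) ((a k - a k0) * fine (g0 (A' k))))%R.
  pose v k m := ((a k - a k0) * fine (g m (A' k)))%R.
  pose w k := ((a k - a k0) * fine (g0 (A' k)))%R.
  apply: (@eventually_above_sum R U FU n.+1 v w) => k kn.
  have [kk|kk] := eqVneq k k0.
    rewrite /v /w kk subrr mul0r; under eq_fun do rewrite mul0r.
    exact: eventually_above_cst.
  apply: eventually_aboveZ; first by rewrite subr_ge0; exact: (k0min (Ordinal kn)).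
  by rewrite /A' (negbTE kk); exact: (weak_cvg_open UU gcvg (oG' k)).
have h2 := weak_cvg_total UU gcvg (a k0).
have h3 := eventually_above_cst FU (\sum_(k < n.+1) b k * fine (mu (A' k)))%R.
have := eventually_aboveD FU (eventually_aboveD FU h1 h2) h3.
have sl : (0 < l - s)%R by rewrite subr_gt0 /l -uE.
move=> /(_ _ sl); apply: filterS => m; rewrite subKr => sum.
by rewrite affine_sum_fine// lte_fin uE.
Qed.

(** * Convex functions as countable suprema of affine functions *)

Section affine_representation.
Context {R : realType}.
Implicit Types F : R -> \bar R.

(** A line through [(s1, v)], a point strictly below the graph: its slope is the
    supremum of the slopes of the chords from the graph on the left of [s1].
    Convexity places it below the slopes on the right. *)
Lemma affine_minorant F (s1 v : R) : Gamma F -> (0 <= s1)%R -> v%:E < F s1 ->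
  exists a b : R, (forall s, (0 <= s)%R -> (a * s + b)%:E <= F s) /\
                  (v <= a * s1 + b)%R.
Proof.
move=> [F0 Fconv Flsc _] s10 vF.
have [d d0 Fd] : exists2 d : R, (0 < d)%R &
    forall s, (0 <= s)%R -> (`|s1 - s| < d)%R -> v%:E < F s.
  have [V Vs1 VF] := Flsc s1 v vF.
  have s1I : `[0%R, +oo[%classic s1 by rewrite /= in_itv/= s10.
  have : within `[0%R, +oo[%classic (nbhs s1) V.
    by rewrite (nbhs_subspace_in s1I); exact: Vs1.
  move=> /nbhs_ballP[d /= d0 dV].
  exists d => // s s0 sd; apply: VF; apply: dV => //=.
  by rewrite in_itv/= s0.
(* The constant [- |v| / d] makes the set nonempty. By lower semicontinuity
   [F > v] within distance [d] of [s1], which bounds the slopes. *)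
pose L : set R := [set l | l = (- (`|v| / d))%R \/
  exists s, [/\ (0 <= s < s1)%R, F s < +oo & l = ((v - fine (F s)) / (s1 - s))%R]].
have finF s : (0 <= s)%R -> F s < +oo -> F s = (fine (F s))%:E.
  by move=> s0 Fs; rewrite fineK// ge0_fin_numE// F0.
have fF0 s : (0 <= s)%R -> (0 <= fine (F s))%R by move=> s0; rewrite fine_ge0// F0.
have vd0 : (0 <= `|v| / d)%R by rewrite divr_ge0// ltW.
have vabs (y t : R) : (0 <= y)%R -> (d <= t)%R -> ((v - y) / t <= `|v| / d)%R.
  move=> y0 dt; have t0 : (0 < t)%R by exact: lt_le_trans dt.
  apply: (@le_trans _ _ (`|v| / t)%R).
    rewrite ler_pM2r ?invr_gt0//; have := ler_norm v; lra.
  by rewrite ler_wpM2l// lef_pV2// posrE.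
have Lne : L !=set0 by exists (- (`|v| / d))%R; left.
have Lub (s : R) : (s1 < s)%R -> F s < +oo ->
    ubound L ((fine (F s) - v) / (s - s1))%R.
  move=> s1s Fs l [->|[s' [/andP[s'0 s's1] Fs' ->]]].
    have [sd|sd] := ltP (s - s1)%R d.
      have : v%:E < F s.
        by apply: Fd; [lra|rewrite ltr0_norm; lra].
      rewrite finF//; last lra.
      rewrite lte_fin => vFs.
      apply: (@le_trans _ _ 0%R); first by rewrite oppr_le0.
      by rewrite divr_ge0//; lra.
    rewrite lerNl -mulNr opprB; apply: vabs => //.
    by apply: fF0; lra.
  rewrite ler_pdivrMr ?subr_gt0// mulrAC ler_pdivlMr ?subr_gt0//.
  have ss' : (0 < s - s')%R by lra.
  pose la := ((s - s1) / (s - s'))%R.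
  have la01 : (0 <= la <= 1)%R.
    by rewrite divr_ge0 ?ler_pdivrMr//=; lra.
  have s1E : (la * s' + (1 - la) * s = s1)%R.
    have : (la * (s - s') = s - s1)%R by rewrite /la divfK// gt_eqF.
    by lra.
  have := Fconv s' s la s'0 (ltac:(lra)) la01; rewrite s1E.
  rewrite (finF _ s'0 Fs') (finF s)//; last lra.
  rewrite -!EFinM -EFinD => Fs1.
  have := lt_le_trans vF Fs1; rewrite lte_fin => vlt.
  have : (v * (s - s') < (la * fine (F s') + (1 - la) * fine (F s)) * (s - s'))%R.
    by rewrite ltr_pM2r.
  have laE : (la * (s - s') = s - s1)%R by rewrite /la divfK// gt_eqF.
  have -> : ((la * fine (F s') + (1 - la) * fine (F s)) * (s - s') =
    (la * (s - s')) * (fine (F s') - fine (F s)) + fine (F s) * (s - s'))%R by lra.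
  by rewrite laE; lra.
have Lub0 : has_ubound L.
  exists (`|v| / d)%R => l [->|[s [/andP[s0 ss1] Fs ->]]]; first lra.
  have [sd|sd] := ltP (s1 - s)%R d; last by apply: vabs => //; exact: fF0.
  have : v%:E < F s by apply: Fd => //; rewrite gtr0_norm; lra.
  rewrite finF// lte_fin => vFs.
  apply: (@le_trans _ _ 0%R) => //.
  by rewrite pmulr_lle0 ?invr_gt0; lra.
pose a := sup L.
exists a, (v - a * s1)%R; split; last lra.
move=> s s0; have [Fs|] := ltP (F s) +oo; last by rewrite leye_eq => /eqP ->; rewrite leey.
rewrite finF// lee_fin.
have [ss1|s1s|ss1] := ltgtP s s1.
- have : ((v - fine (F s)) / (s1 - s) <= a)%R.
    by apply: sup_ubound => //; right; exists s; rewrite s0.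
  rewrite ler_pdivrMr ?subr_gt0//; lra.
- have : (a <= (fine (F s) - v) / (s - s1))%R by apply: ge_sup => //; exact: Lub.
  rewrite ler_pdivlMr ?subr_gt0//; lra.
- move: vF; rewrite -ss1 finF// lte_fin; lra.
Qed.

(** Rational coefficients make the family of minorants countable. *)
Lemma rational_affine_minorant F (s1 v : R) : Gamma F -> (0 <= s1)%R -> v%:E < F s1 ->
  exists p q : rat, (forall s, (0 <= s)%R -> (ratr p * s + ratr q)%:E <= F s) /\
                    (v <= ratr p * s1 + ratr q)%R.
Proof.
move=> GF s10 vF.
have [w [+ wF]] := real_between vF; rewrite lte_fin => vw.
have [a [b [abF wab]]] := affine_minorant GF s10 wF.
pose e := ((w - v) / (s1 + 1))%R.
have e0 : (0 < e)%R by rewrite divr_gt0; lra.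
have eE : (e * (s1 + 1) = w - v)%R by rewrite /e divfK// gt_eqF//; lra.
have [p /=] : exists p : rat, (ratr p : R) \in `](a - e)%R, a[.
  by apply: rat_in_itvoo; lra.
rewrite in_itv/= => /andP[p1 p2].
have [q /=] : exists q : rat, (ratr q : R) \in `](b - e)%R, b[.
  by apply: rat_in_itvoo; lra.
rewrite in_itv/= => /andP[q1 q2].
exists p, q; split.
  move=> s s0; apply: le_trans (abF s s0); rewrite lee_fin.
  by apply: lerD; [rewrite ler_wpM2r// ltW|exact: ltW].
have : ((a - e) * s1 <= ratr p * s1)%R by rewrite ler_wpM2r// ltW.
by lra.
Qed.

(** The zero function is put at index 0, which makes all finite maxima
    nonnegative. The recession constant is the supremum of the slopes. *)
Definition affine_rep F (a b : nat -> R) : Prop :=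
  [/\ a 0%N = 0%R, b 0%N = 0%R, forall s, (0 <= s)%R -> F s = persp a b 1 s &
      recession F = persp a b 0 1].

Lemma recession_persp F a b : Gamma F ->
  a 0%N = 0%R -> b 0%N = 0%R ->
  (forall s, (0 <= s)%R -> F s = persp a b 1 s) ->
  recession F = persp a b 0 1.
Proof.
move=> [_ _ _ [s0 s00 Fs0]] a0 b0 FE.
apply/cvg_lim => //.
have lower k (s : R) : (0 < s)%R -> (a k + b k / s)%:E <= F s * (s^-1)%:E.
  move=> sp; have -> : (a k + b k / s = (a k * s + b k * 1) / s)%R.
    by rewrite mulrDl mulr1 mulfK// gt_eqF.
  by rewrite EFinM lee_wpmul2r ?lee_fin ?invr_ge0 ?(ltW sp)// FE ?(ltW sp)// persp_ge.
have [A|A] := ltP (persp a b 0 1) +oo; last first.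
  rewrite leye_eq in A; rewrite (eqP A); apply/cvgeyPge => M.
  have : (M + 1)%:E < persp a b 0 1 by rewrite (eqP A) ltry.
  move=> /ereal_sup_gt[_ [k _ <-]]; rewrite mulr1 mulr0 addr0 lte_fin => ak.
  near=> s; apply: le_trans (lower k s _); rewrite ?lee_fin; last by near: s; exact: nbhs_pinfty_gt.
  have bs : (`|b k| <= s)%R by near: s; apply: nbhs_pinfty_ge; rewrite num_real.
  have sp : (0 < s)%R by near: s; exact: nbhs_pinfty_gt.
  have : (- 1 <= b k / s)%R.
    by rewrite ler_pdivlMr// mulN1r; have := ler_norm (- b k); rewrite normrN; lra.
  lra.
have Afin : persp a b 0 1 \is a fin_num by rewrite ge0_fin_numE// persp_ge0.
set l := fine (persp a b 0 1).
have lE : persp a b 0 1 = l%:E by rewrite /l fineK.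
have al k : (a k <= l)%R.
  by rewrite -lee_fin -lE; have := persp_ge a b k 0 1; rewrite mulr1 mulr0 addr0.
have l0 : (0 <= l)%R by rewrite -a0.
have FsE : F s0 = (fine (F s0))%:E.
  by rewrite fineK// ge0_fin_numE// FE ?(ltW s00)// persp_ge0.
set C := fine (F s0).
have C0 : (0 <= C)%R by rewrite fine_ge0// FE ?(ltW s00)// persp_ge0.
have upper (s : R) : (s0 <= s)%R -> F s <= (C + l * s)%:E.
  move=> ss; rewrite FE; last lra.
  apply: ge_ereal_sup => _ [k _ <-]; rewrite lee_fin mulr1.
  have : (a k * s0 + b k <= C)%R.
    rewrite -lee_fin -FsE FE ?(ltW s00)//.
    by have := persp_ge a b k 1 s0; rewrite mulr1.
  have : (a k * (s - s0) <= l * (s - s0))%R by rewrite ler_wpM2r ?al//; lra.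
  have : (0 <= l * s0)%R by rewrite mulr_ge0// ltW.
  lra.
have Fsfin (s : R) : (s0 <= s)%R -> F s = (fine (F s))%:E.
  move=> ss; rewrite fineK// ge0_fin_numE; last by rewrite FE ?persp_ge0//; lra.
  by apply: le_lt_trans (upper s ss) _; rewrite ltry.
rewrite lE; apply/fine_cvgP; split.
  near=> s; rewrite Fsfin; last by near: s; apply: nbhs_pinfty_ge; rewrite num_real.
  by rewrite -EFinM.
apply/cvgrPdist_le => e e0.
have : (l - e)%:E < persp a b 0 1 by rewrite lE lte_fin; lra.
move=> /ereal_sup_gt[_ [k _ <-]]; rewrite mulr1 mulr0 addr0 lte_fin => ak.
pose e' := (a k - (l - e))%R.
have e'0 : (0 < e')%R by rewrite /e'; lra.
near=> s; rewrite /comp.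
have ss : (s0 <= s)%R by near: s; apply: nbhs_pinfty_ge; rewrite num_real.
have sp : (0 < s)%R by lra.
have := upper s ss; have := lower k s sp; rewrite Fsfin// -EFinM /= !lee_fin.
move=> h1 h2.
have Cs : (C / e <= s)%R by near: s; apply: nbhs_pinfty_ge; rewrite num_real.
have bs : (`|b k| / e' <= s)%R by near: s; apply: nbhs_pinfty_ge; rewrite num_real.
have h3 : (fine (F s) / s <= l + e)%R.
  by rewrite ler_pdivrMr//; move: Cs; rewrite ler_pdivrMr//; lra.
have h4 : (- e' <= b k / s)%R.
  rewrite ler_pdivlMr//; move: bs; rewrite ler_pdivrMr//.
  by have := ler_norm (- b k); rewrite normrN; lra.
by rewrite ler_norml; apply/andP; split; rewrite /e' in h4; lra.
Unshelve. all: by end_near. Qed.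

(** Enumerate the pairs of rationals, replacing those that do not give a minorant
    by the pair [(0, 0)]. *)
Lemma affine_rep_exists F : Gamma F -> exists a b, affine_rep F a b.
Proof.
move=> GF; have [F0 _ _ _] := GF.
pose minor (p : rat * rat) :=
  forall s, (0 <= s)%R -> (ratr p.1 * s + ratr p.2)%:E <= F s.
pose pick n : rat * rat :=
  if n is m.+1 then
    if @choice.unpickle (rat * rat)%type m is Some p then if `[< minor p >] then p else (0%R, 0%R)
    else (0%R, 0%R)
  else (0%R, 0%R).
have minor_pick n : minor (pick n).
  have m0 : minor (0%R, 0%R).
    by move=> s s0 /=; rewrite raddf0 mul0r addr0; exact: F0.
  case: n => [//|n]; rewrite /pick.
  by case: (@choice.unpickle (rat * rat)%type n) => [p|//]; case: ifPn => // /asboolP.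
pose a n : R := ratr (pick n).1; pose b n : R := ratr (pick n).2.
have a0 : a 0%N = 0%R by rewrite /a /= raddf0.
have b0 : b 0%N = 0%R by rewrite /b /= raddf0.
have FE s : (0 <= s)%R -> F s = persp a b 1 s.
  move=> s0; apply/eqP; rewrite eq_le; apply/andP; split; last first.
    by apply: ge_ereal_sup => _ [k _ <-]; rewrite mulr1; exact: minor_pick.
  apply: le_real_below => v vF.
  have [p [q [pqF vpq]]] := rational_affine_minorant GF s0 vF.
  have [k kE] : exists k, pick k = (p, q).
    exists (@choice.pickle (rat * rat)%type (p, q)).+1.
    by rewrite /pick choice.pickleK (asboolT (P := minor (p, q))).
  have := persp_ge a b k 1 s.
  by rewrite /a /b kE mulr1; apply: le_trans; rewrite lee_fin.
by exists a, b; split => //; exact: recession_persp.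
Qed.

End affine_representation.

Section persp_algebra.
Context {R : realType}.
Variables a b : nat -> R.
Hypotheses (a0 : a 0%N = 0%R) (b0 : b 0%N = 0%R).

Lemma perspZ (l r t : R) : (0 < l)%R ->
  persp a b (l * r) (l * t) = l%:E * persp a b r t.
Proof.
move=> l0.
have le (m r' t' : R) : (0 < m)%R ->
    persp a b (m * r') (m * t') <= m%:E * persp a b r' t'.
  move=> m0; apply: ge_ereal_sup => _ [k _ <-].
  have -> : (a k * (m * t') + b k * (m * r') = m * (a k * t' + b k * r'))%R by lra.
  by rewrite EFinM lee_pmul2l// persp_ge.
apply/eqP; rewrite eq_le le//=.
rewrite -lee_pdivlMl//.
apply: le_trans (le l^-1%R _ _ _); last by rewrite invr_gt0.
by rewrite !mulrA mulVf ?gt_eqF// !mul1r.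
Qed.

Lemma persp00 : persp a b 0 0 = 0.
Proof.
apply/eqP; rewrite eq_le persp_ge0// andbT.
by apply: ge_ereal_sup => _ [k _ <-]; rewrite !mulr0 addr0.
Qed.

Lemma perspD_le (r r' t t' : R) :
  persp a b (r + r') (t + t') <= persp a b r t + persp a b r' t'.
Proof.
apply: ge_ereal_sup => _ [k _ <-].
have -> : (a k * (t + t') + b k * (r + r') =
           (a k * t + b k * r) + (a k * t' + b k * r'))%R by lra.
by rewrite EFinD leeD// persp_ge.
Qed.

Variable F : R -> \bar R.
Hypothesis (FE : affine_rep F a b).

Lemma rep_at s : (0 <= s)%R -> F s = persp a b 1 s.
Proof. by case: FE => _ _ + _; apply. Qed.

Lemma rep_ge0 s : (0 <= s)%R -> 0 <= F s.
Proof. by move=> s0; rewrite rep_at// persp_ge0. Qed.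

Lemma rep_minorant k s : (0 <= s)%R -> (a k * s + b k)%:E <= F s.
Proof. by move=> s0; rewrite rep_at//; have := persp_ge a b k 1 s; rewrite mulr1. Qed.

Lemma reverse_entropy_persp r : (0 <= r)%R -> reverse_entropy F r = persp a b r 1.
Proof.
rewrite /reverse_entropy le_eqVlt => /predU1P[<-|r0].
  by rewrite eqxx; case: FE.
rewrite gt_eqF// rep_at ?invr_ge0 ?ltW// -perspZ// mulr1 mulfV//.
by rewrite gt_eqF.
Qed.

Lemma scaled_reverse_entropy_persp r t : (0 <= r)%R -> (0 < t)%R ->
  t%:E * reverse_entropy F (r / t) = persp a b r t.
Proof.
move=> r0 t0; rewrite reverse_entropy_persp ?divr_ge0// ?ltW//.
by rewrite -perspZ// mulr1 mulrC divfK// gt_eqF.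
Qed.

Lemma mul_entropy0_persp r : (0 <= r)%R -> F 0%R * r%:E = persp a b r 0.
Proof.
rewrite le_eqVlt => /predU1P[<-|r0]; first by rewrite mule0 persp00.
by rewrite rep_at// muleC -perspZ// mulr1 mulr0.
Qed.

End persp_algebra.

(** * The reduced cost and the marginal perspective cost *)

Section truncated_cost.
Context {R : realType}.
Implicit Types (a b : nat -> R) (c : \bar R).

Lemma pmax_lip_r a b n : a 0%N = 0%R -> b 0%N = 0%R ->
  exists2 B : R, (0 <= B)%R &
    forall r r' t, (pmax a b n r t <= pmax a b n r' t + B * `|r - r'|)%R.
Proof.
move=> a0 b0; exists (\sum_(k < n.+1) `|b k|)%R; first exact: sumr_ge0.
move=> r r' t; have [k kn ->] := pmax_attained a0 b0 n r t.
have -> : (a k * t + b k * r = (a k * t + b k * r') + b k * (r - r'))%R by lra.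
apply: lerD; first exact: pmax_ge.
apply: le_trans (ler_norm _) _; rewrite normrM ler_wpM2r//.
have kn1 : (k < n.+1)%N by [].
by rewrite (bigD1 (Ordinal kn1))//= lerDl sumr_ge0.
Qed.

Lemma pmax_swap a b n r t : pmax a b n r t = pmax b a n t r.
Proof. by elim: n => [|n IH] /=; rewrite ?IH addrC. Qed.

Definition trunc (n : nat) c : R := fine (mine c n%:R%:E).

Lemma trunc_ge0 n c : 0 <= c -> (0 <= trunc n c)%R.
Proof. by move=> c0; rewrite fine_ge0// le_min c0 lee_fin ler0n. Qed.

Lemma truncE n c : 0 <= c -> (trunc n c)%:E = mine c n%:R%:E.
Proof.
move=> c0; rewrite fineK// ge0_fin_numE; last by rewrite le_min c0 lee_fin ler0n.
by rewrite gt_min ltry orbT.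
Qed.

Lemma trunc_le n c : 0 <= c -> (trunc n c)%:E <= c.
Proof. by move=> c0; rewrite truncE// ge_min lexx. Qed.

Lemma trunc_homo c : 0 <= c ->
  {homo (trunc^~ c) : n m / (n <= m)%N >-> (n <= m)%R}.
Proof.
move=> c0 n m nm; rewrite -lee_fin !truncE// le_min ge_min lexx/=.
by rewrite ge_min lee_fin ler_nat nm orbT.
Qed.

Lemma trunc_big (k : R) n c : 0 <= c -> (0 <= k)%R -> k%:E <= c ->
  (k <= n%:R)%R -> (k <= trunc n c)%R.
Proof. by move=> c0 k0 kc kn; rewrite -lee_fin truncE// le_min kc lee_fin. Qed.

Lemma cvg_trunc c : 0 <= c -> (trunc n c)%:E @[n --> \oo] --> c.
Proof.
case: c => [r|_|//].
- rewrite lee_fin => r0; apply: cvg_near_cst.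
  near=> n; rewrite truncE ?lee_fin//; apply/min_idPl; rewrite lee_fin.
  by near: n; exact: nbhs_infty_ger.
- rewrite (_ : (fun n => _) = (fun n => (n%:R : R)%:E)); first exact/cvgenyP.
  by apply/funext => n; rewrite truncE// min_r// leey.
Unshelve. all: by end_near. Qed.

Variables (a1 b1 a2 b2 : nat -> R).

(** A finite approximation of [plan_cost] from below, Lipschitz in [r1], [r2] and
    [t]. *)
Definition truncated_cost (n : nat) (r1 r2 : R) c (t : R) : R :=
  (pmax a1 b1 n r1 t + pmax a2 b2 n r2 t + trunc n c * t)%R.

(** This is [t (R_1(r1 / t) + R_2(r2 / t) + c)], the cost when the plan is
    multiplied by [t]. *)
Definition plan_cost (r1 r2 : R) c (t : R) : \bar R :=
  persp a1 b1 r1 t + persp a2 b2 r2 t + c * t%:E.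

(** The infimum of [plan_cost] over [t], defined as a supremum of infima of
    Lipschitz functions, which is visibly lower semicontinuous and measurable.
    Without coercivity it may be smaller than the infimum. *)
Definition reduced_cost (r1 r2 : R) c : \bar R :=
  ereal_sup (range (fun n =>
    ereal_inf [set (truncated_cost n r1 r2 c t)%:E | t in [set t | (0 <= t)%R]])).

Hypotheses (a10 : a1 0%N = 0%R) (b10 : b1 0%N = 0%R).
Hypotheses (a20 : a2 0%N = 0%R) (b20 : b2 0%N = 0%R).

Lemma truncated_cost_ge0 n r1 r2 c t : 0 <= c -> (0 <= t)%R -> (0 <= truncated_cost n r1 r2 c t)%R.
Proof.
by move=> c0 t0; rewrite !addr_ge0// ?pmax_ge0// mulr_ge0// trunc_ge0.
Qed.

Lemma truncated_cost_homo r1 r2 c t : 0 <= c -> (0 <= t)%R ->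
  {homo (fun n => truncated_cost n r1 r2 c t) : n m / (n <= m)%N >-> (n <= m)%R}.
Proof.
move=> c0 t0 n m nm; rewrite /truncated_cost !lerD// ?pmax_homo//.
by rewrite ler_wpM2r// trunc_homo.
Qed.

Lemma truncated_cost_le n r1 r2 c t : 0 <= c -> (0 <= t)%R ->
  (truncated_cost n r1 r2 c t)%:E <= plan_cost r1 r2 c t.
Proof.
move=> c0 t0; rewrite /truncated_cost !EFinD EFinM !leeD// ?pmax_le//.
by rewrite lee_wpmul2r ?lee_fin// trunc_le.
Qed.

Lemma plan_cost_le r1 r2 c t v : 0 <= c -> (0 <= t)%R ->
  (forall n, (truncated_cost n r1 r2 c t)%:E <= v) -> plan_cost r1 r2 c t <= v.
Proof.
move=> c0 t0 H.
have cv : (truncated_cost n r1 r2 c t)%:E @[n --> \oo] --> plan_cost r1 r2 c t.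
  rewrite /truncated_cost /plan_cost; under eq_fun do rewrite !EFinD EFinM.
  have p1 := @persp_ge0 _ a1 b1 a10 b10 r1 t.
  have p2 := @persp_ge0 _ a2 b2 a20 b20 r2 t.
  apply: cvgeD.
  - by rewrite ge0_adde_def// inE ?adde_ge0// mule_ge0// lee_fin.
  - apply: cvgeD; [by rewrite ge0_adde_def// inE|exact: cvg_pmax..].
  - by apply: cvgeZr => //; exact: cvg_trunc.
rewrite -(cvg_lim _ cv)//; apply: lime_le; first by apply/cvg_ex; eexists; exact: cv.
exact: nearW.
Qed.

Lemma truncated_cost_lip n r1 r2 c : 0 <= c -> exists2 B : R, (0 <= B)%R &
  forall t t', (truncated_cost n r1 r2 c t <= truncated_cost n r1 r2 c t' + B * `|t - t'|)%R.
Proof.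
move=> c0.
have [B1 B10 H1] := pmax_lip_r n b10 a10.
have [B2 B20 H2] := pmax_lip_r n b20 a20.
exists (B1 + B2 + trunc n c)%R; first by rewrite !addr_ge0// trunc_ge0.
move=> t t'; rewrite /truncated_cost !(pmax_swap _ _ _ _ t) !(pmax_swap _ _ _ _ t').
have := H1 t t' r1; have := H2 t t' r2.
have : (trunc n c * (t - t') <= trunc n c * `|t - t'|)%R.
  by rewrite ler_wpM2l ?trunc_ge0// ler_norm.
by lra.
Qed.

Lemma reduced_cost_le r1 r2 c t : 0 <= c -> (0 <= t)%R ->
  reduced_cost r1 r2 c <= plan_cost r1 r2 c t.
Proof.
move=> c0 t0; apply: ge_ereal_sup => _ [n _ <-].
apply: le_trans (truncated_cost_le n r1 r2 c0 t0).
by apply: ereal_inf_lbound; exists t.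
Qed.

Lemma reduced_cost_ge0 r1 r2 c : 0 <= c -> 0 <= reduced_cost r1 r2 c.
Proof.
move=> c0; apply: (@le_trans _ _ (ereal_inf [set (truncated_cost 0 r1 r2 c t)%:E |
    t in [set t | (0 <= t)%R]])); last by apply: ereal_sup_ubound; exists 0%N.
by apply: le_ereal_inf_tmp => _ [t t0 <-]; rewrite lee_fin; exact: truncated_cost_ge0.
Qed.

(** The [n]-th infimum is Lipschitz in [(r1, r2)], uniformly in [t]. *)
Lemma reduced_cost_lsc c : 0 <= c ->
  lower_semicontinuous (fun r : R * R => reduced_cost r.1 r.2 c).
Proof.
move=> c0 [r1 r2] s /= /ereal_sup_gt[_ [n _ <-]] sn.
have [w [+ /ltW wn]] := real_between sn; rewrite lte_fin => sw.
have [B1 B10 H1] := pmax_lip_r n a10 b10.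
have [B2 B20 H2] := pmax_lip_r n a20 b20.
pose e := ((w - s) / (B1 + B2 + 1) / 2)%R.
have BB : (0 < B1 + B2 + 1)%R by lra.
have e0 : (0 < e)%R by rewrite !divr_gt0 ?subr_gt0.
have eB : (e * (B1 + B2 + 1) = (w - s) / 2)%R.
  by rewrite /e mulrAC divfK// gt_eqF.
exists (ball (r1, r2) e); first exact: nbhsx_ballx.
move=> [r1' r2'] /= [/= d1 d2].
apply: (@lt_le_trans _ _ (w - (w - s) / 2)%:E); first by rewrite lte_fin; lra.
apply: (@le_trans _ _ (ereal_inf
    [set (truncated_cost n r1' r2' c t)%:E | t in [set t | (0 <= t)%R]])); last first.
  by apply: ereal_sup_ubound; exists n.
apply: le_ereal_inf_tmp => _ [t t0 <-]; rewrite lee_fin.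
have : (w <= truncated_cost n r1 r2 c t)%R.
  by rewrite -lee_fin; apply: (le_trans wn); apply: ereal_inf_lbound; exists t.
have := H1 r1 r1' t; have := H2 r2 r2' t; rewrite /truncated_cost.
have : (B1 * `|r1 - r1'| <= B1 * e)%R by rewrite ler_wpM2l// ltW.
have : (B2 * `|r2 - r2'| <= B2 * e)%R by rewrite ler_wpM2l// ltW.
lra.
Qed.

End truncated_cost.

Section marginal_perspective_bounds.
Context {R : realType}.
Variables (F1 F2 : R -> \bar R) (a1 b1 a2 b2 : nat -> R).
Hypotheses (rep1 : affine_rep F1 a1 b1) (rep2 : affine_rep F2 a2 b2).

Let a10 : a1 0%N = 0%R. Proof. by case: rep1. Qed.
Let b10 : b1 0%N = 0%R. Proof. by case: rep1. Qed.
Let a20 : a2 0%N = 0%R. Proof. by case: rep2. Qed.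
Let b20 : b2 0%N = 0%R. Proof. by case: rep2. Qed.

Lemma perspective_cost_plan (b r1 r2 t : R) :
  (0 <= b)%R -> (0 <= r1)%R -> (0 <= r2)%R -> (0 < t)%R ->
  t%:E * (reverse_entropy F1 (r1 / t)%R + reverse_entropy F2 (r2 / t)%R + b%:E) =
  plan_cost a1 b1 a2 b2 r1 r2 b%:E t.
Proof.
move=> b0' r10 r20 t0.
have R10 : 0 <= reverse_entropy F1 (r1 / t).
  by rewrite (reverse_entropy_persp rep1) ?persp_ge0// divr_ge0// ltW.
have R20 : 0 <= reverse_entropy F2 (r2 / t).
  by rewrite (reverse_entropy_persp rep2) ?persp_ge0// divr_ge0// ltW.
rewrite ge0_muleDr ?adde_ge0// ge0_muleDr//.
rewrite (scaled_reverse_entropy_persp rep1)// (scaled_reverse_entropy_persp rep2)//.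
by rewrite /plan_cost [X in _ + X]muleC.
Qed.

(** The reduced cost is a lower semicontinuous minorant of the function whose
    envelope is taken; outside the quadrant it is set to [-oo], which does not
    affect the subspace topology. *)
Lemma reduced_cost_le_marginal c r1 r2 :
  0 <= c -> (0 <= r1)%R -> (0 <= r2)%R ->
  reduced_cost a1 b1 a2 b2 r1 r2 c <= marginal_perspective_cost F1 F2 c r1 r2.
Proof.
case: c => [b| |//]; last first.
  move=> _ r10 r20 /=; rewrite (mul_entropy0_persp a10 b10 rep1)//.
  rewrite (mul_entropy0_persp a20 b20 rep2)//.
  apply: (le_trans (@reduced_cost_le _ _ _ _ _ a10 b10 a20 b20 _ _ +oo 0%R _ _)) => //.
  by rewrite /plan_cost mule0 adde0.
move=> b0 r10 r20; rewrite /marginal_perspective_cost /lsc_envelope.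
pose g (r : R * R) : \bar R :=
  if r \in quadrant then reduced_cost a1 b1 a2 b2 r.1 r.2 b%:E else -oo.
have Q12 : quadrant (r1, r2) by split.
have <- : g (r1, r2) = reduced_cost a1 b1 a2 b2 r1 r2 b%:E.
  by rewrite /g mem_set.
apply: ereal_sup_ubound; exists g => //; split.
- move=> r s; rewrite /g; case: ifPn => // rQ sr.
  have [V rV VH] := reduced_cost_lsc a10 b10 a20 b20 b0 sr.
  exists (V `&` quadrant).
    have : within quadrant (nbhs (r : R * R)) (V `&` quadrant).
      by apply: (@filterS _ (nbhs (r : R * R)) _ V) => // x Vx Qx; split.
    move=> W; suff : nbhs_subspace (r : subspace quadrant) (V `&` quadrant) by [].
    by rewrite -(@nbhs_subspace_in (R * R)%type quadrant r (set_mem rQ)).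
  by move=> y [Vy Qy]; rewrite mem_set//; exact: VH.
- move=> r; rewrite /g; case: ifPn => [/set_mem[r0 r0']|_]; last by rewrite leNye.
  apply: le_ereal_inf_tmp => _ [t /= t0 <-].
  rewrite perspective_cost_plan//; apply: reduced_cost_le => //; exact: ltW.
Qed.

Lemma marginal_le_perspective_cost (b : R) r1 r2 :
  marginal_perspective_cost F1 F2 b%:E r1 r2 <= perspective_cost F1 F2 b (r1, r2).
Proof. by apply: ge_ereal_sup => _ [g [_ gf] <-]. Qed.

(** The dilation [t = 1] is admissible. *)
Lemma marginal_le_reverse c r1 r2 :
  0 <= c -> (0 <= r1)%R -> (0 <= r2)%R ->
  marginal_perspective_cost F1 F2 c r1 r2 <=
    reverse_entropy F1 r1 + reverse_entropy F2 r2 + c.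
Proof.
case: c => [b| |//].
  move=> _ r10 r20; apply: (le_trans (marginal_le_perspective_cost _ _ _)).
  apply: ereal_inf_lbound; exists 1%R => //=.
  by rewrite !divr1 mul1e.
move=> _ r10 r20; rewrite addey ?leey// gt_eqF//.
rewrite (reverse_entropy_persp rep1)// (reverse_entropy_persp rep2)//.
by rewrite (lt_le_trans (ltNy0))// adde_ge0// persp_ge0.
Qed.

Lemma marginal_ge0 c r1 r2 : 0 <= c -> (0 <= r1)%R -> (0 <= r2)%R ->
  0 <= marginal_perspective_cost F1 F2 c r1 r2.
Proof.
move=> c0 r10 r20; apply: le_trans (reduced_cost_le_marginal c0 r10 r20).
exact: reduced_cost_ge0.
Qed.

(** The envelope at [(r1, r2)] is controlled by the values at
    [(r1 + t / s1, r2 + t / s2)] with dilation [t], where [F1 s1] and [F2 s2] are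
    finite; by subadditivity of the perspectives these are at most the right-hand
    side plus a multiple of [t]. *)
Lemma marginal_le_entropy0 c r1 r2 :
  (exists2 s, (0 < s)%R & F1 s < +oo) -> (exists2 s, (0 < s)%R & F2 s < +oo) ->
  0 <= c -> (0 <= r1)%R -> (0 <= r2)%R ->
  marginal_perspective_cost F1 F2 c r1 r2 <= F1 0%R * r1%:E + F2 0%R * r2%:E.
Proof.
move=> [s1 s10 Fs1] [s2 s20 Fs2]; case: c => [b b0|//|//] r10 r20.
rewrite (mul_entropy0_persp a10 b10 rep1)// (mul_entropy0_persp a20 b20 rep2)//.
set E1 := persp a1 b1 r1 0; set E2 := persp a2 b2 r2 0.
have E10 : 0 <= E1 by exact: persp_ge0.
have E20 : 0 <= E2 by exact: persp_ge0.
have fin F a' b' s : affine_rep F a' b' -> (0 < s)%R -> F s < +oo ->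
    exists2 C : R, (0 <= C)%R & forall t, (0 < t)%R -> persp a' b' (t / s) t = (t * C)%:E.
  move=> repF sp Fs; have [a0' b0' FE _] := repF.
  have Fs0 : 0 <= F s by rewrite FE ?persp_ge0// ltW.
  exists (fine (F s) / s)%R; first by rewrite divr_ge0 ?fine_ge0// ltW.
  move=> t t0.
  have -> : persp a' b' (t / s) t = persp a' b' ((t / s) * 1) ((t / s) * s).
    by rewrite mulr1 divfK// gt_eqF.
  rewrite perspZ ?divr_gt0// -FE; last exact: ltW.
  rewrite -[in LHS](@fineK _ (F s)) ?ge0_fin_numE// -EFinM.
  by congr EFin; rewrite mulrAC mulrA.
have [C1 C10 H1] := fin _ _ _ _ rep1 s10 Fs1.
have [C2 C20 H2] := fin _ _ _ _ rep2 s20 Fs2.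
apply: ge_ereal_sup => _ [g [glsc gf] <-].
apply: le_real_below => v vg; rewrite leNgt; apply/negP => Ev.
have Q12 : quadrant (r1, r2) by split.
have [V rV VH] := glsc (r1, r2) v vg.
have : within quadrant (nbhs (r1, r2)) V.
  by rewrite (nbhs_subspace_in Q12); exact: rV.
move=> /nbhs_ballP[d /= d0 dV].
have Ef : E1 + E2 \is a fin_num.
  by rewrite ge0_fin_numE ?adde_ge0//; apply: lt_trans Ev _; rewrite ltry.
pose w := (v - fine (E1 + E2))%R.
have w0 : (0 < w)%R by rewrite /w subr_gt0 -lte_fin fineK.
have D0 : (0 < C1 + C2 + b + 1)%R by move: b0; rewrite lee_fin; lra.
(* [t] is small enough for the shifted point to lie in the neighbourhood and for
   the error term to stay below the gap [w]. *)
pose t : R := (Num.min (w / (C1 + C2 + b + 1)) (Num.min (d * s1 / 2) (d * s2 / 2)))%R.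
have t0 : (0 < t)%R.
  by rewrite !lt_min divr_gt0//= !divr_gt0// mulr_gt0.
have tw : (t * (C1 + C2 + b + 1) <= w)%R.
  by rewrite -ler_pdivlMr// ge_min lexx.
have td1 : (t / s1 < d)%R.
  have : (t <= d * s1 / 2)%R by rewrite /t !ge_min lexx orbT.
  rewrite ltr_pdivrMr//; have : (0 < d * s1)%R by rewrite mulr_gt0. lra.
have td2 : (t / s2 < d)%R.
  have : (t <= d * s2 / 2)%R by rewrite /t !ge_min lexx !orbT.
  rewrite ltr_pdivrMr//; have : (0 < d * s2)%R by rewrite mulr_gt0. lra.
have ts1 : (0 < t / s1)%R by rewrite divr_gt0.
have ts2 : (0 < t / s2)%R by rewrite divr_gt0.
have : v%:E < g (r1 + t / s1, r2 + t / s2)%R.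
  apply: VH; apply: dV; last by split => /=; lra.
  split => /=; rewrite /ball/= opprD addNKr normrN gtr0_norm//.
rewrite ltNge => /negP; apply.
apply: (le_trans (gf _)).
apply: (@le_trans _ _ (plan_cost a1 b1 a2 b2 (r1 + t / s1) (r2 + t / s2) b%:E t)).
  rewrite -perspective_cost_plan//; [|lra..].
  by apply: ereal_inf_lbound; exists t.
apply: (@le_trans _ _ ((E1 + (t * C1)%:E) + (E2 + (t * C2)%:E) + (b * t)%:E)).
  rewrite /plan_cost; apply: leeD => //; apply: leeD.
    by rewrite -H1//; have := perspD_le a1 b1 r1 (t / s1) 0 t; rewrite add0r.
  by rewrite -H2//; have := perspD_le a2 b2 r2 (t / s2) 0 t; rewrite add0r.
rewrite addeACA -[X in X + _ + _ <= _](fineK Ef) -!EFinD lee_fin.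
by rewrite /w in tw; lra.
Qed.

End marginal_perspective_bounds.

(** * Measurable choice of the optimal dilation *)

Section nested_minimum.
Context {R : realType}.

Definition lipschitz_above (f : R -> R) : Prop :=
  exists2 B : R, (0 <= B)%R & forall t t', (f t <= f t' + B * `|t - t'|)%R.

(** For an increasing sequence of functions with a linear lower bound at infinity,
    the near-minimizers of [f n] stay in a compact interval, and a cluster point of
    them works for all [n] at once. *)
Lemma nested_attained (D : set R) (f : nat -> R -> R) (v : R) :
  closed D -> (forall t, D t -> (0 <= t)%R) ->
  (forall n, lipschitz_above (f n)) ->
  (forall t, D t -> {homo (f^~ t) : n m / (n <= m)%N >-> (n <= m)%R}) ->
  (exists n0 delta B, (0 < delta)%R /\
     forall t, D t -> (delta * t - B <= f n0 t)%R) ->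
  (forall n e, (0 < e)%R -> exists2 t, D t & (f n t <= v + e)%R) ->
  exists2 t, D t & forall n, (f n t <= v)%R.
Proof.
move=> cD D0 flip fmono [n0 [delta [B [delta0 fcoer]]]] fv.
have /choice[t Ht] (n : nat) : exists t, D t /\ (f n t <= v + n.+1%:R^-1)%R.
  have n0' : (0 < n.+1%:R^-1 :> R)%R by rewrite invr_gt0.
  by have [t] := fv n _ n0'; exists t.
pose M := ((v + 1 + B) / delta)%R.
have cM : compact `[0%R, M] by exact: segment_compact.
have FM : (t @ \oo) `[0%R, M]%classic.
  exists n0 => // n /= n0n; rewrite in_itv/= (D0 _ (Ht n).1)/=.
  rewrite /M ler_pdivlMr//.
  have := fcoer _ (Ht n).1; have := fmono _ (Ht n).1 _ _ n0n.
  have := (Ht n).2; have : (n.+1%:R^-1 <= 1 :> R)%R by rewrite invf_le1// ler1n.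
  by move: (n.+1%:R^-1)%R => u; rewrite [(t n * delta)%R]mulrC; lra.
have [p [_ clp]] := cM _ _ FM.
have Dp : D p.
  rewrite closure_id in cD; rewrite cD => V pV.
  by apply: clp => //; exists 0%N => // n _; exact: (Ht n).1.
exists p => // k; apply/ler_addgt0Pr => e e0.
have [C C0 HC] := flip k.
pose h := (e / 2 / (C + 1))%R.
have h0 : (0 < h)%R by rewrite !divr_gt0// ltr_wpDl.
have hC : (h * (C + 1) = e / 2)%R by rewrite /h divfK// gt_eqF// ltr_wpDl.
have e20 : (0 < e / 2)%R by rewrite divr_gt0.
have [_ [n [kn hn] <-] pn] : exists2 s, [set t n | n in [set n | (k <= n)%N /\
    (n.+1%:R^-1 < e / 2)%R]] s & ball p h s.
  have [n1 _ Hn1] := near_infty_natSinv_lt (PosNum e20).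
  have [] := clp [set t n | n in [set n | (k <= n)%N /\ (n.+1%:R^-1 < e / 2)%R]]
                (ball p h).
  - exists (maxn k n1) => // n /=; rewrite geq_max => /andP[kn n1n].
    by exists n => //; split => //; exact: Hn1.
  - exact: nbhsx_ballx.
  - by move=> s [ts ps]; exists s.
have := HC p (t n); have := (Ht n).2.
have := fmono _ (Ht n).1 _ _ kn.
have : (C * `|p - t n| <= C * h)%R by rewrite ler_wpM2l// ltW.
by move: hn; move: (n.+1%:R^-1)%R => u hn; lra.
Qed.

Lemma dense_sequence : exists q : nat -> R,
  forall t e : R, (0 < e)%R -> exists k, (`|t - q k| < e)%R.
Proof.
pose q n : R := if @choice.unpickle rat n is Some r then ratr r else 0%R.
exists q => t e e0.
have [r] : exists r : rat, (ratr r : R) \in `](t - e)%R, (t + e)%R[.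
  by apply: rat_in_itvoo; lra.
rewrite in_itv/= => /andP[r1 r2].
exists (@choice.pickle rat r); rewrite /q choice.pickleK.
by rewrite ltr_norml; apply/andP; split; lra.
Qed.

(** A retraction [proj] onto [D] that does not increase distances carries a dense
    sequence of the line to one of [D]. *)
Lemma inf_over_dense (q : nat -> R) (D : set R) (proj h : R -> R) :
  (forall t e : R, (0 < e)%R -> exists k, (`|t - q k| < e)%R) ->
  (forall t, D (proj t)) -> (forall t, D t -> proj t = t) ->
  (forall t t', (`|proj t - proj t'| <= `|t - t'|)%R) ->
  lipschitz_above h ->
  ereal_inf [set (h t)%:E | t in D] =
  ereal_inf (range (fun k => (h (proj (q k)))%:E)).
Proof.
move=> qd Dp pD pl [B B0 HB]; apply/eqP; rewrite eq_le; apply/andP; split.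
  apply: le_ereal_inf_tmp => _ [k _ <-]; apply: ereal_inf_lbound.
  by exists (proj (q k)).
apply: le_ereal_inf_tmp => _ [t Dt <-]; apply/lee_addgt0Pr => e e0.
have B1 : (0 < B + 1)%R by rewrite ltr_wpDl.
have [k tk] := qd t _ (divr_gt0 e0 B1).
apply: (@le_trans _ _ (h (proj (q k)))%:E).
  by apply: ereal_inf_lbound; exists k.
rewrite -EFinD lee_fin; apply: (le_trans (HB _ t)); rewrite lerD2l.
have := pl (q k) t; rewrite (pD t Dt) => tq.
apply: (@le_trans _ _ (B * (e / (B + 1)))%R).
  by rewrite ler_wpM2l// (le_trans tq)// distrC ltW.
rewrite mulrA ler_pdivrMr//; lra.
Qed.

End nested_minimum.

Section measurable_range.
Context {d : measure_display} {T : measurableType d} {R : realType}.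

Lemma measurable_sup_range (f : nat -> T -> \bar R) :
  (forall n, measurable_fun setT (f n)) ->
  measurable_fun setT (fun x => ereal_sup (range (fun n => f n x))).
Proof.
move=> mf; have := measurable_fun_esups mf 0%N.
congr (measurable_fun _ _); apply/funext => x; congr ereal_sup.
by apply/seteqP; split => _ [n _ <-]; exists n.
Qed.

Lemma measurable_inf_range (f : nat -> T -> \bar R) :
  (forall n, measurable_fun setT (f n)) ->
  measurable_fun setT (fun x => ereal_inf (range (fun n => f n x))).
Proof.
move=> mf; have := measurable_fun_einfs mf 0%N.
congr (measurable_fun _ _); apply/funext => x; congr ereal_inf.
by apply/seteqP; split => _ [n _ <-]; exists n.
Qed.

Lemma measurable_fun_sublevel (f : T -> R) :
  (forall s, measurable [set x | (f x <= s)%R]) -> measurable_fun setT f.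
Proof.
move=> H; apply: (measurability (RGenOInfty.G (R := R))).
  exact: RGenOInfty.measurableE.
move=> _ [_ [s ->] <-]; rewrite setTI.
rewrite (_ : _ @^-1` _ = ~` [set x | (f x <= s)%R]); last first.
  by apply/seteqP; split => x /=; rewrite in_itv/= andbT ltNge => /negP.
exact: measurableC.
Qed.

End measurable_range.

Section measurable_selection.
Context {d : measure_display} {T : measurableType d} {R : realType}.
Variables (a1 b1 a2 b2 : nat -> R) (p1 p2 : T -> R) (c : T -> \bar R).
Hypotheses (a10 : a1 0%N = 0%R) (b10 : b1 0%N = 0%R).
Hypotheses (a20 : a2 0%N = 0%R) (b20 : b2 0%N = 0%R).
Hypotheses (mp1 : measurable_fun setT p1) (mp2 : measurable_fun setT p2).
Hypotheses (mc : measurable_fun setT c) (c0 : forall x, 0 <= c x).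
Variables (k1 k2 : nat) (kappa : R).
Hypotheses (kappa0 : (0 <= kappa)%R) (kappac : forall x, kappa%:E <= c x).
Hypothesis coer : (0 < a1 k1 + a2 k2 + kappa)%R.

Let cost n x t := truncated_cost a1 b1 a2 b2 n (p1 x) (p2 x) (c x) t.

Let inf_on (D : set R) n x : \bar R := ereal_inf [set (cost n x t)%:E | t in D].
(** For [D] the half-line this is the reduced cost. Restricting [t] to a segment
    makes the sublevel sets of the least optimal dilation measurable. *)
Let least (D : set R) x : \bar R := ereal_sup (range (fun n => inf_on D n x)).

Let cost_lip n x : lipschitz_above (cost n x).
Proof. exact: truncated_cost_lip. Qed.

Let measurable_cost n t : measurable_fun setT (fun x => cost n x t).
Proof.
rewrite /cost /truncated_cost; apply: measurable_funD; [apply: measurable_funD|].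
- exact: measurable_pmax.
- exact: measurable_pmax.
- apply: measurable_funM => //; rewrite /trunc.
  apply: (measurableT_comp (fine_measurable measurableT)).
  exact: measurable_mine.
Qed.

Let measurable_least (D : set R) (proj : R -> R) :
  (forall t, D (proj t)) -> (forall t, D t -> proj t = t) ->
  (forall t t', (`|proj t - proj t'| <= `|t - t'|)%R) ->
  measurable_fun setT (least D).
Proof.
move=> Dp pD pl; have [q qd] := @dense_sequence R.
apply: measurable_sup_range => n.
rewrite (_ : inf_on D n = fun x => ereal_inf (range (fun k =>
    (cost n x (proj (q k)))%:E))); last first.
  by apply/funext => x; apply: inf_over_dense.
by apply: measurable_inf_range => k; apply/measurable_EFinP.
Qed.

(** The linear growth needed to apply [nested_attained] comes from the slopes
    [a1 k1], [a2 k2] and the lower bound [kappa] of the cost. *)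
Let least_attained (D : set R) x : closed D -> (forall t, D t -> (0 <= t)%R) ->
  least D x < +oo -> exists2 t, D t & forall n, (cost n x t)%:E <= least D x.
Proof.
move=> cD D0 lty.
have inf0 n : 0 <= inf_on D n x.
  by apply: le_ereal_inf_tmp => _ [t /D0 t0 <-]; rewrite lee_fin; exact: truncated_cost_ge0.
have l0 : 0 <= least D x.
  by apply: (le_trans (inf0 0%N)); apply: ereal_sup_ubound; exists 0%N.
have lE : least D x = (fine (least D x))%:E by rewrite fineK// ge0_fin_numE.
have [] := @nested_attained R D (fun n => cost n x) (fine (least D x)).
- exact: cD.
- exact: D0.
- by move=> n; exact: cost_lip.
- by move=> t /D0 t0; exact: truncated_cost_homo.
- pose n0 := maxn (maxn k1 k2) (Num.trunc kappa).+1.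
  exists n0, (a1 k1 + a2 k2 + kappa)%R, (- (b1 k1 * p1 x + b2 k2 * p2 x))%R.
  split => // t /D0 t0.
  have h1 : (a1 k1 * t + b1 k1 * p1 x <= pmax a1 b1 n0 (p1 x) t)%R.
    by apply: pmax_ge; rewrite /n0 !leq_max leqnn.
  have h2 : (a2 k2 * t + b2 k2 * p2 x <= pmax a2 b2 n0 (p2 x) t)%R.
    by apply: pmax_ge; rewrite /n0 !leq_max leqnn orbT.
  have h3 : (kappa * t <= trunc n0 (c x) * t)%R.
    rewrite ler_wpM2r// trunc_big//.
    apply: ltW; apply: lt_le_trans (truncnS_gt kappa) _.
    by rewrite ler_nat leq_max leqnn orbT.
  by rewrite /cost /truncated_cost; lra.
- move=> n e e0.
  have : inf_on D n x < (fine (least D x) + e)%:E.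
    apply: (@le_lt_trans _ _ (least D x)).
      by apply: ereal_sup_ubound; exists n.
    by rewrite [ltLHS]lE lte_fin ltrDl.
  by move=> /ereal_inf_lt[_ [t Dt <-]]; rewrite lte_fin => /ltW; exists t.
- by move=> t Dt H; exists t => // n; rewrite lE lee_fin.
Qed.

Let least_le (D : set R) x t v : D t -> (forall n, (cost n x t)%:E <= v) -> least D x <= v.
Proof.
move=> Dt H; apply: ge_ereal_sup => _ [n _ <-].
by apply: le_trans (H n); apply: ereal_inf_lbound; exists t.
Qed.

Let half : set R := [set t | (0 <= t)%R].
Let seg (s : R) : set R := [set t | (0 <= t <= s)%R].

Let closed_half : closed half.
Proof. exact: closed_ge. Qed.

Let closed_seg s : closed (seg s).
Proof.
rewrite (_ : seg s = half `&` [set t | (t <= s)%R]).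
  by apply: closedI => //; exact: closed_le.
by apply/seteqP; split => t /=; rewrite /seg /half/=; [move=> /andP[]|move=> []-> ->].
Qed.

Let measurable_half : measurable_fun setT (least half).
Proof.
apply: (@measurable_least _ (fun t => `|t|%R)).
- by move=> t; exact: normr_ge0.
- by move=> t t0; rewrite ger0_norm.
- by move=> t t'; exact: ler_dist_dist.
Qed.

Let measurable_seg s : (0 <= s)%R -> measurable_fun setT (least (seg s)).
Proof.
move=> s0; apply: (@measurable_least _ (fun t => Num.min `|t| s)%R).
- by move=> t; rewrite /seg/= le_min normr_ge0 s0 ge_min lexx orbT.
- by move=> t /andP[t0 ts]; rewrite ger0_norm// min_l.
- move=> t t'; apply: le_trans (ler_dist_dist t t').
  by case: (leP `|t|%R s); case: (leP `|t'|%R s) => h1 h2;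
    rewrite ?subrr ?normr0 ?normr_ge0// ler_norml; apply/andP; split;
    have := ler_norm (`|t| - `|t'|)%R; have := ler_norm (- (`|t| - `|t'|))%R;
    rewrite normrN; lra.
Qed.

Lemma measurable_reduced_cost :
  measurable_fun setT (fun x => reduced_cost a1 b1 a2 b2 (p1 x) (p2 x) (c x)).
Proof. exact: measurable_half. Qed.

(** Let [theta] be the least optimal dilation: then [theta x <= s] exactly when
    [least (seg s) x <= least half x], and both sides are measurable in [x]. *)
Lemma measurable_optimal_plan : exists theta : T -> R,
  [/\ measurable_fun setT theta, forall x, (0 <= theta x)%R &
      forall x, plan_cost a1 b1 a2 b2 (p1 x) (p2 x) (c x) (theta x) <=
                reduced_cost a1 b1 a2 b2 (p1 x) (p2 x) (c x)].
Proof.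
pose K := least half.
pose C x : set R := [set t | (0 <= t)%R /\ forall n, (cost n x t)%:E <= K x].
pose theta x : R := if K x < +oo then inf (C x) else 0%R.
have C0 x : lbound (C x) 0%R by move=> t [].
have Cne x : K x < +oo -> C x !=set0.
  move=> Kx; have [t t0 H] := least_attained closed_half (fun t h => h) Kx.
  by exists t; split.
have theta0 x : (0 <= theta x)%R.
  rewrite /theta; case: ifPn => // Kx; apply: lb_le_inf => //.
  exact: Cne.
have thetaC x : K x < +oo -> C x (theta x).
  move=> Kx; split=> // n.
  have [B B0 HB] := cost_lip n x.
  apply/lee_addgt0Pr => e e0.
  have B1 : (0 < B + 1)%R by rewrite ltr_wpDl.
  have eB : (0 < e / (B + 1))%R by rewrite divr_gt0.
  have hi : has_inf (C x) by split; [exact: Cne|exists 0%R; exact: C0].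
  have [t Ct tlt] := inf_adherent eB hi.
  have thle : (inf (C x) <= t)%R by apply: ge_inf => //; exists 0%R; exact: C0.
  have thE : theta x = inf (C x) by rewrite /theta Kx.
  apply: (@le_trans _ _ (cost n x t + e)%:E); last first.
    by rewrite EFinD; apply: leeD => //; exact: Ct.2.
  rewrite lee_fin; apply: (le_trans (HB _ t)); rewrite lerD2l thE.
  apply: (@le_trans _ _ (B * (e / (B + 1)))%R).
    rewrite ler_wpM2l// distrC ger0_norm ?subr_ge0// lerBlDl ltW//.
  by rewrite mulrA ler_pdivrMr//; lra.
exists theta; split => //.
- apply: measurable_fun_sublevel => s.
  have [s0|s0] := leP 0%R s; last first.
    rewrite (_ : [set x | _] = set0)//; apply/seteqP; split => // x /= h.
    by have := theta0 x; lra.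
  rewrite (_ : [set x | _] = setT `&` [set x | least (seg s) x <= K x]).
    exact: measurable_lee (measurable_seg s0) measurable_half.
  rewrite setTI; apply/seteqP; split => x /=.
    move=> ts; have [Kx|] := ltP (K x) +oo; last first.
      by rewrite leye_eq => /eqP ->; rewrite leey.
    have [_ Cx] := thetaC x Kx.
    by apply: (least_le _ Cx); rewrite /seg/= theta0.
  have [Kx|Kx] := ltP (K x) +oo; last by rewrite /theta ltNge Kx/=.
  move=> lK; have lx : least (seg s) x < +oo by exact: le_lt_trans Kx.
  have [||t /andP[t0 ts] Ht] := least_attained _ _ lx.
  - exact: closed_seg.
  - by move=> t /andP[].
  - rewrite /theta Kx; apply: le_trans ts; apply: ge_inf; first by exists 0%R; exact: C0.
    by split => // n; exact: le_trans (Ht n) lK.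
- move=> x; have [Kx|] := ltP (K x) +oo; last first.
    by rewrite leye_eq /K => /eqP; rewrite /least/inf_on/cost => h; rewrite /reduced_cost h leey.
  by have [_ H] := thetaC x Kx; apply: plan_cost_le.
Qed.

End measurable_selection.

(** * Densities and Radon measures *)

Section density_measure.
Context {d : measure_display} {T : measurableType d} {R : realType}.
Variables (gam : {finite_measure set T -> \bar R}) (theta : T -> R).
Hypotheses (mtheta : measurable_fun setT theta) (theta0 : forall x, (0 <= theta x)%R).
Hypothesis itheta : \int[gam]_x (theta x)%:E < +oo.

Definition density_measure (A : set T) : \bar R := \int[gam]_(x in A) (theta x)%:E.

Let dm0 : density_measure set0 = 0. Proof. exact: integral_set0. Qed.
Let dm_ge0 A : 0 <= density_measure A.
Proof. by apply: integral_ge0 => x _; rewrite lee_fin. Qed.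
Let dm_sigma_additive : semi_sigma_additive density_measure.
Proof.
apply: semi_sigma_additive_nng_induced; first exact/measurable_EFinP.
by move=> x; rewrite lee_fin.
Qed.

HB.instance Definition _ := isMeasure.Build _ _ _ density_measure
  dm0 dm_ge0 dm_sigma_additive.

Let dm_fin : fin_num_fun density_measure.
Proof.
move=> A mA; rewrite ge0_fin_numE//; apply: le_lt_trans itheta.
apply: ge0_subset_integral => //; first exact/measurable_EFinP.
by move=> x _; rewrite lee_fin.
Qed.

HB.instance Definition _ := @Measure_isFinite.Build _ _ _ density_measure dm_fin.

Lemma density_measure_exists : exists nu : {finite_measure set T -> \bar R},
  forall A, nu A = \int[gam]_(x in A) (theta x)%:E.
Proof. by exists (density_measure : {finite_measure set T -> \bar R}). Qed.

End density_measure.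

Section density_integral.
Context {d : measure_display} {T : measurableType d} {R : realType}.
Variables (gam nu : {finite_measure set T -> \bar R}) (theta : T -> R).
Hypotheses (mtheta : measurable_fun setT theta) (theta0 : forall x, (0 <= theta x)%R).
Hypothesis nuE : forall A, measurable A -> nu A = \int[gam]_(x in A) (theta x)%:E.
Import HBNNSimple.

(** For simple functions below [c] this is an equality; passing to their supremum
    gives one inequality for any [c]. *)
Lemma integral_density_le (c : T -> \bar R) : (forall x, 0 <= c x) ->
  \int[nu]_x c x <= \int[gam]_x (c x * (theta x)%:E).
Proof.
move=> c0; rewrite ge0_integralTE//; apply: ge_ereal_sup => _ [h hc <-].
apply: (@le_trans _ _ (\int[gam]_x ((h x)%:E * (theta x)%:E))); last first.
  apply: le_integral_ge0 => x _; first by rewrite mule_ge0// lee_fin.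
  by rewrite lee_wpmul2r// lee_fin.
have finh : finite_set (range h) by exact: fimfunP.
pose r := finmap.enum_fset (fset_set (range h)).
have rP y : y \in r -> exists x, y = h x.
  by rewrite in_fset_set// => /set_mem[x _ <-]; exists x.
have r0 y : y \in r -> (0 <= y)%R by move=> /rP[x ->]; exact: fun_ge0.
have mh y : measurable (h @^-1` [set y]) by exact: measurable_funPTI.
pose w y : R := Num.max y 0%R.
have w0 y : (0 <= w y)%R by rewrite /w le_max lexx orbT.
have wE y : y \in r -> w y = y by move=> yr; rewrite /w max_l// r0.
have hE x : (h x)%:E * (theta x)%:E = \sum_(y <- r)
    ((w y)%:E * (theta x * \1_(h @^-1` [set y]) x)%:E).
  rewrite [in LHS](fimfunE h) (fsbig_finite _ _ finh)/= -EFinM mulr_suml -sumEFin.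
  apply: eq_big_seq => y yr; rewrite wE//.
  by rewrite -EFinM; congr EFin; rewrite mulrAC mulrA.
have sE : sintegral nu h = \sum_(y <- r) (w y)%:E * nu (h @^-1` [set y]).
  rewrite sintegralE (fsbig_finite _ _ finh)/=.
  by apply: eq_big_seq => y yr; rewrite wE.
rewrite sE; under [leRHS]eq_integral do rewrite hE.
have m1 y : measurable_fun setT (fun x => (theta x * \1_(h @^-1` [set y]) x)%:E).
  by apply/measurable_EFinP; apply: measurable_funM => //; exact: measurable_indic.
have p1 y x : 0 <= (theta x * \1_(h @^-1` [set y]) x)%:E.
  by rewrite lee_fin mulr_ge0// indicE.
rewrite ge0_integral_sum//; last 2 first.
- by move=> y; apply: emeasurable_funM => //; exact: measurable_cst.
- by move=> y x _; rewrite mule_ge0// lee_fin.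
apply: lee_sum => y _; rewrite ge0_integralZl ?lee_fin//.
rewrite lee_wpmul2l ?lee_fin// nuE// [leLHS]integral_mkcond.
apply: le_integral_ge0 => x _; first exact: p1.
by rewrite patchE indicE; case: ifPn => _; rewrite ?mulr1// mulr0.
Qed.

End density_integral.

(** Compact subsets of [B] exhaust [B] up to a [gam]-null set, which is also
    [nu]-null; finite unions of them have [nu]-measure tending to that of [B]. *)
Lemma Radon_dominated {R : realType} {T : ptopologicalType}
    (gam nu : {finite_measure set (borel T) -> \bar R}) :
  hausdorff_space T -> Radon gam ->
  (forall A, measurable A -> gam A = 0 -> nu A = 0) -> Radon nu.
Proof.
move=> hT rg dom B mB e e0.
have n0 (n : nat) : (0 < n.+1%:R^-1 :> R)%R by rewrite invr_gt0.
have /choice[K HK] n := rg B mB _ (n0 n).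
have mK n : measurable (K n : set (borel T)).
  by apply: compact_borel => //; have [] := HK n.
pose L n : set (borel T) := \big[setU/set0]_(i < n.+1) K i.
have cL n : compact (L n : set T).
  by apply: bigsetU_compact => i _; have [] := HK i.
have LB n : L n `<=` B.
  by rewrite /L -bigcup_mkord => x [i _]; have [_ + _] := HK i; apply.
have mL n : measurable (L n) by apply: bigsetU_measurable => i _; exact: mK.
have mU : measurable (\bigcup_n K n : set (borel T)) by exact: bigcup_measurable.
have LU : \bigcup_n L n = \bigcup_n K n.
  apply/seteqP; split => x [n _]; rewrite /L.
    by rewrite -bigcup_mkord => -[i _ Kx]; exists i.
  by move=> Kx; exists n => //; rewrite big_ord_recr/=; right.
have gam0 : gam (B `\` \bigcup_n K n) = 0.
  apply/eqP; rewrite eq_le measure_ge0 andbT; apply/lee_addgt0Pr => r r0.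
  have [n _ Hn] := near_infty_natSinv_lt (PosNum r0).
  rewrite add0e; have [_ _ le] := HK n.
  apply: (@le_trans _ _ (n.+1%:R^-1)%:E); last first.
    by rewrite lee_fin ltW//; exact: (Hn n (leqnn n)).
  apply: le_trans le; apply: le_measure; rewrite ?inE.
  - exact: measurableD.
  - exact: measurableD.
  - by move=> x [Bx nK]; split => // Kx; apply: nK; exists n.
have nu0 : nu (B `\` \bigcup_n K n) = 0 by apply: dom => //; exact: measurableD.
have nuB : nu B = nu (\bigcup_n L n).
  rewrite LU -[in LHS](setDUK (_ : \bigcup_n K n `<=` B)); last first.
    by move=> x [i _]; have [_ + _] := HK i; apply.
  rewrite measureU//; last 2 first.
  - exact: measurableD.
  - by rewrite setDIK.
  by rewrite [X in _ + X]nu0 adde0.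
have cvL : (nu \o L) n @[n --> \oo] --> nu B.
  rewrite nuB; apply: nondecreasing_cvg_mu => //; first by rewrite LU.
  move=> n m nm; apply/subsetPset; rewrite /L -!bigcup_mkord => x [i /= iN Kx].
  by exists i => //=; apply: (leq_trans iN).
have : nbhs (nu B) [set y | (fine (nu B) - e)%:E < y].
  apply: open_nbhs_nbhs; split; first exact: open_ereal_gt_ereal.
  by rewrite /= [ltRHS]fine_measureK// lte_fin; lra.
move=> /cvL[n _ /(_ n (leqnn n)) /= Ln].
exists (L n); split => //.
rewrite measureD//; last by rewrite ltey_eq fin_num_measure.
rewrite (_ : B `&` L n = L n); last by apply/setIidPr.
rewrite [X in X - _]fine_measureK// [X in _ - X]fine_measureK// -EFinB lee_fin.
by move: Ln; rewrite [ltRHS]fine_measureK// lte_fin; lra.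
Qed.

Lemma Radon_image {R : realType} {T1 T2 : ptopologicalType} (f : T1 -> T2)
    (mu : {finite_measure set (borel T1) -> \bar R})
    (nu : {finite_measure set (borel T2) -> \bar R}) :
  hausdorff_space T1 -> hausdorff_space T2 -> continuous f -> Radon mu ->
  measurable_fun setT (f : borel T1 -> borel T2) ->
  (forall A, measurable A -> nu A = mu (f @^-1` A)) -> Radon nu.
Proof.
move=> h1 h2 cf rmu mf nuE B mB e e0.
have mfB : measurable (f @^-1` B : set (borel T1)).
  by rewrite -[X in measurable X]setTI; exact: mf.
have [K [cK KB le]] := rmu _ mfB _ e0.
have cfK : compact (f @` K).
  by apply: continuous_compact => //; exact: continuous_subspaceT.
exists (f @` K); split => //; first by move=> _ [x /KB Bx <-].
have mBK : measurable ((B `\` f @` K) : set (borel T2)).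
  by apply: measurableD => //; exact: compact_borel.
rewrite nuE//; apply: le_trans le; apply: le_measure; rewrite ?inE.
- by rewrite -[X in measurable X]setTI; exact: mf.
- by apply: measurableD => //; exact: compact_borel.
- by move=> x [Bx nK]; split => // Kx; apply: nK; exists x.
Qed.

(** * Entropy functionals *)

Lemma lsc_borel_measurable {R : realType} {T : ptopologicalType} (c : T -> \bar R) :
  lower_semicontinuous c -> measurable_fun setT (c : borel T -> \bar R).
Proof.
move=> lsc; apply: (measurability _ (ErealGenOInfty.measurableE R)).
move=> /= _ [_ [a ->]] <-; rewrite setTI; apply: open_borel.
by rewrite preimage_itvoy; move/lower_semicontinuousP : lsc; exact.
Qed.

Section entropy_functional_facts.
Context {d : measure_display} {T : measurableType d} {R : realType}.
Implicit Types gam mu : {finite_measure set T -> \bar R}.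

Lemma lebesgue_decompositionP gam mu : is_lebesgue_decomposition gam mu
  (Defs.lebesgue_density gam mu) (singular_part gam mu).
Proof. by rewrite /Defs.lebesgue_density /singular_part /lebesgue_decomposition; case: cid. Qed.

Variables (F : R -> \bar R) (a b : nat -> R).
Hypothesis rep : affine_rep F a b.
Let a0 : a 0%N = 0%R. Proof. by case: rep. Qed.
Let b0 : b 0%N = 0%R. Proof. by case: rep. Qed.

Lemma entropy_persp gam mu : entropy_functional F gam mu =
  \int[mu]_x persp a b 1 (Defs.lebesgue_density gam mu x) +
  persp a b 0 1 * singular_part gam mu setT.
Proof.
have [_ s0 _ _] := lebesgue_decompositionP gam mu.
rewrite /entropy_functional; congr (_ + _ * _); last by case: rep.
by apply: eq_integral => x _; case: rep => _ _ -> //.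
Qed.

Lemma affine_sum_le_entropy gam mu n A : fin_partition n A ->
  affine_sum a b gam mu n A <= entropy_functional F gam mu.
Proof.
move=> pA; rewrite entropy_persp; have [ms s0 _ dec] := lebesgue_decompositionP gam mu.
exact: variational_le.
Qed.

Lemma lt_entropy gam mu (s : R) : s%:E < entropy_functional F gam mu ->
  exists n A, fin_partition n A /\ s%:E < affine_sum a b gam mu n A.
Proof.
rewrite entropy_persp; apply: variational_lt => //; exact: lebesgue_decompositionP.
Qed.

Lemma entropy_le gam mu v :
  (forall n A, fin_partition n A -> affine_sum a b gam mu n A <= v) ->
  entropy_functional F gam mu <= v.
Proof.
move=> H; apply: le_real_below => s /lt_entropy[n [A [pA sA]]].
by apply: (le_trans (ltW sA)); exact: H.
Qed.

Lemma entropy_ge0 gam mu : 0 <= entropy_functional F gam mu.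
Proof.
rewrite entropy_persp; apply: adde_ge0.
  by apply: integral_ge0 => x _; exact: persp_ge0.
by apply: mule_ge0 => //; exact: persp_ge0.
Qed.

(** The affine sums are symmetric under exchanging [a] with [b] and the two
    measures, and the perspective of [F] with exchanged coefficients represents
    the reverse entropy. *)
Lemma entropy_reverse gam mu rho mu' : is_lebesgue_decomposition mu gam rho mu' ->
  entropy_functional F gam mu =
  \int[gam]_x reverse_entropy F (rho x) + F 0%R * mu' setT.
Proof.
move=> dec; have [mr r0 _ decE] := dec.
have -> : \int[gam]_x reverse_entropy F (rho x) = \int[gam]_x persp b a 1 (rho x).
  apply: eq_integral => x _.
  by rewrite (reverse_entropy_persp rep)// persp_swap.
have -> : F 0%R = persp b a 0 1.
  by rewrite -persp_swap; case: rep => _ _ -> //.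
have sumC n A : affine_sum a b gam mu n A = affine_sum b a mu gam n A.
  by rewrite /affine_sum; apply: eq_bigr => k _; rewrite addeC.
apply/eqP; rewrite eq_le; apply/andP; split.
  apply: entropy_le => n A pA; rewrite sumC; exact: variational_le.
apply: le_real_below => s /(variational_lt b0 a0 dec)[n [A [pA sA]]].
by apply: (le_trans (ltW sA)); rewrite -sumC; exact: affine_sum_le_entropy.
Qed.

End entropy_functional_facts.

Section entropy_of_image.
Context {d d' : measure_display} {X : measurableType d} {Y : measurableType d'}.
Context {R : realType}.
Variables (F : R -> \bar R) (a b : nat -> R).
Hypothesis rep : affine_rep F a b.
Variables (phi : X -> Y) (gam : {finite_measure set X -> \bar R}).
Variables (nu mu mu' : {finite_measure set Y -> \bar R}) (theta : X -> R) (rho : Y -> R).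
Hypotheses (mphi : measurable_fun setT phi) (mtheta : measurable_fun setT theta).
Hypotheses (mrho : measurable_fun setT rho) (theta0 : forall x, (0 <= theta x)%R).
Hypothesis rho0 : forall y, (0 <= rho y)%R.
Hypothesis nuE : forall A, measurable A ->
  nu A = \int[gam]_(x in phi @^-1` A) (theta x)%:E.
Hypothesis muE : forall A, measurable A ->
  mu A = \int[gam]_(x in phi @^-1` A) (rho (phi x))%:E + mu' A.

(** The variational formula reduces the bound to a finite partition of [Y], whose
    preimage partitions [X]. On each cell [a k * theta + b k * rho] lies below the
    perspective, and [b k] lies below [F 0] on the singular part. *)
Lemma entropy_image_le : entropy_functional F nu mu <=
  \int[gam]_x persp a b (rho (phi x)) (theta x) + F 0%R * mu' setT.
Proof.
have [a0 b0 FE _] := rep.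
apply: (entropy_le rep) => n A pA; have [mA tA UA] := pA.
have F00 : 0 <= F 0%R by exact: (rep_ge0 a0 b0 rep).
have bF k : (b k)%:E <= F 0%R.
  by rewrite FE//; have := persp_ge a b k 1 0; rewrite mulr0 mulr1 add0r.
have mpA k : measurable (phi @^-1` A k) by rewrite -[X in measurable X]setTI; exact: mphi.
have mrp : measurable_fun setT (rho \o phi) by exact: measurableT_comp.
have ppA : fin_partition n (fun k => phi @^-1` A k).
  split => //.
  - apply/trivIsetP => i j _ _ ij; rewrite -preimage_setI.
    by move/trivIsetP : tA => ->//; rewrite preimage_set0.
  - rewrite -(bigcup_mkord _ (fun k => phi @^-1` A k)) -preimage_bigcup.
    by rewrite bigcup_mkord UA preimage_setT.
rewrite (integral_partition gam ppA); last 2 first.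
- by apply: measurable_persp.
- by move=> x; exact: persp_ge0.
rewrite -(integral_cst mu' measurableT) (@integral_partition _ _ _ _ _ _ _ pA)//.
rewrite -big_split; apply: lee_sum => k _ /=.
have -> : \int[mu']_(x in A k) cst (F 0%R) x = F 0%R * mu' (A k).
  exact: integral_cst.
have fin (f : X -> R) (m : {finite_measure set Y -> \bar R}) :
    \int[gam]_(x in phi @^-1` A k) (f x)%:E <= m (A k) ->
    \int[gam]_(x in phi @^-1` A k) (f x)%:E < +oo.
  by move/le_lt_trans; apply; rewrite ltey_eq fin_num_measure.
rewrite muE// muleDr//; last by rewrite fin_num_adde_defl// fin_num_measure.
rewrite addeA; apply: leeD; last by rewrite lee_wpmul2r.
rewrite nuE//.
apply: (@linear_le_integral _ _ _ gam _ theta (rho \o phi)) => //.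
- exact: measurable_funS mtheta.
- exact: measurable_funS mrp.
- by move=> x; exact: rho0.
- by apply: (fin theta nu); rewrite nuE.
- by apply: (fin (rho \o phi) mu); rewrite muE// leeDl.
- by move=> x _; exact: persp_ge0.
- by move=> x _; exact: persp_ge.
Qed.

End entropy_of_image.

(** * The transport cost below the integral of the reduced cost *)

Section marginal_integrals.
Context {R : realType} {X1 X2 : ptopologicalType}.
Variable gam : {finite_measure set (borel (X1 * X2)%type) -> \bar R}.

Lemma marginal1_integral (A : set (borel X1)) (f : borel X1 -> \bar R) :
  measurable A -> measurable_fun setT f -> (forall x, 0 <= f x) ->
  \int[marginal1 gam]_(x in A) f x =
  \int[gam]_(x in (fst : borel (X1 * X2)%type -> borel X1) @^-1` A) f x.1.
Proof.
move=> mA mf f0; apply: (ge0_integral_pushforward measurable_borel_fst) => //.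
exact: measurable_funS mf.
Qed.

Lemma marginal2_integral (A : set (borel X2)) (f : borel X2 -> \bar R) :
  measurable A -> measurable_fun setT f -> (forall x, 0 <= f x) ->
  \int[marginal2 gam]_(x in A) f x =
  \int[gam]_(x in (snd : borel (X1 * X2)%type -> borel X2) @^-1` A) f x.2.
Proof.
move=> mA mf f0; apply: (ge0_integral_pushforward measurable_borel_snd) => //.
exact: measurable_funS mf.
Qed.

Lemma ae_marginal1 (P : borel X1 -> Prop) :
  {ae marginal1 gam, forall x, P x} ->
  {ae gam, forall x : borel (X1 * X2)%type, P x.1}.
Proof.
move=> [N [mN N0 PN]]; exists (fst @^-1` N); split => //; last by move=> x /= /PN.
by rewrite -[X in measurable X]setTI; exact: measurable_borel_fst.
Qed.

Lemma ae_marginal2 (P : borel X2 -> Prop) :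
  {ae marginal2 gam, forall x, P x} ->
  {ae gam, forall x : borel (X1 * X2)%type, P x.2}.
Proof.
move=> [N [mN N0 PN]]; exists (snd @^-1` N); split => //; last by move=> x /= /PN.
by rewrite -[X in measurable X]setTI; exact: measurable_borel_snd.
Qed.

End marginal_integrals.

Lemma hausdorff_prod (X1 X2 : topologicalType) :
  hausdorff_space X1 -> hausdorff_space X2 -> hausdorff_space (X1 * X2)%type.
Proof.
move=> h1 h2 [x1 x2] [y1 y2] cl; congr (_, _).
- apply: h1 => A B Ax By; have [] := cl (A `*` setT) (B `*` setT).
  + by exists (A, setT) => //; split => //; exact: filterT.
  + by exists (B, setT) => //; split => //; exact: filterT.
  + by move=> [z1 z2] [[Az _] [Bz _]]; exists z1.
- apply: h2 => A B Ax By; have [] := cl (setT `*` A) (setT `*` B).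
  + by exists (setT, A) => //; split => //; exact: filterT.
  + by exists (setT, B) => //; split => //; exact: filterT.
  + by move=> [z1 z2] [[_ Az] [_ Bz]]; exists z2.
Qed.

Section entropy_transport_problem.
Context {R : realType} {X1 X2 : ptopologicalType}.
Notation X := (borel (X1 * X2)%type).
Variables (F1 F2 : R -> \bar R) (c : X1 * X2 -> \bar R).
Variables (mu1 : {finite_measure set (borel X1) -> \bar R})
          (mu2 : {finite_measure set (borel X2) -> \bar R}).
Variables (a1 b1 a2 b2 : nat -> R).
Hypotheses (rep1 : affine_rep F1 a1 b1) (rep2 : affine_rep F2 a2 b2).
Hypotheses (h1 : hausdorff_space X1) (h2 : hausdorff_space X2).
Hypotheses (c0 : forall x, 0 <= c x) (lsc : lower_semicontinuous c).
Hypothesis coer : coercive F1 F2 c.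
Implicit Types gam : {finite_measure set X -> \bar R}.

Let a10 : a1 0%N = 0%R. Proof. by case: rep1. Qed.
Let b10 : b1 0%N = 0%R. Proof. by case: rep1. Qed.
Let a20 : a2 0%N = 0%R. Proof. by case: rep2. Qed.
Let b20 : b2 0%N = 0%R. Proof. by case: rep2. Qed.

Let mc : measurable_fun setT (c : X -> \bar R).
Proof. exact: lsc_borel_measurable. Qed.

Let mfst := @measurable_borel_fst X1 X2.
Let msnd := @measurable_borel_snd X1 X2.

Let F10 : 0 <= F1 0%R. Proof. exact: (rep_ge0 a10 b10 rep1). Qed.
Let F20 : 0 <= F2 0%R. Proof. exact: (rep_ge0 a20 b20 rep2). Qed.

(** Both coercivity conditions make a sum of one slope of each entropy and a lower
    bound of the cost positive. *)
Lemma coercive_constants : exists k1 k2 (kappa : R),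
  [/\ (0 <= a1 k1)%R, (0 <= a2 k2)%R, (0 <= kappa)%R,
      forall x, kappa%:E <= c x & (0 < a1 k1 + a2 k2 + kappa)%R].
Proof.
have pos F a b : affine_rep F a b -> 0 < recession F -> exists k, (0 < a k)%R.
  move=> [_ _ _ ->] /ereal_sup_gt[_ [k _ <-]].
  by rewrite mulr1 mulr0 addr0 lte_fin; exists k.
have ge0 F a b : affine_rep F a b -> 0 <= recession F.
  by move=> [a0 b0 _ ->]; exact: persp_ge0.
have [p1|n1] := ltP 0 (recession F1).
  have [k ak] := pos _ _ _ _ rep1 p1.
  by exists k, 0%N, 0%R; rewrite a20; split => //; [exact: ltW|lra].
have [p2|n2] := ltP 0 (recession F2).
  have [k ak] := pos _ _ _ _ rep2 p2.
  by exists 0%N, k, 0%R; rewrite a10; split => //; [exact: ltW|lra].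
have r1 : recession F1 = 0 by apply/eqP; rewrite eq_le n1 (ge0 _ _ _ _ rep1).
have r2 : recession F2 = 0 by apply/eqP; rewrite eq_le n2 (ge0 _ _ _ _ rep2).
case: coer => [[+ _]|[]]; first by rewrite r1.
rewrite r1 r2 !add0e => /real_between[k [k0 kc]] _.
exists 0%N, 0%N, k; rewrite a10 a20; split => //.
- by rewrite -lee_fin ltW.
- by move=> x; apply: (le_trans (ltW kc)); apply: ereal_inf_lbound; exists x.
- by rewrite !add0r -lte_fin.
Qed.

Section fixed_plan.
Variables (gam : {finite_measure set X -> \bar R}).
Variables (rho1 : borel X1 -> R) (rho2 : borel X2 -> R).
Variables (mu1' : {finite_measure set (borel X1) -> \bar R})
          (mu2' : {finite_measure set (borel X2) -> \bar R}).
Hypotheses (dec1 : is_lebesgue_decomposition mu1 (marginal1 gam) rho1 mu1')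
           (dec2 : is_lebesgue_decomposition mu2 (marginal2 gam) rho2 mu2').

Let m1 : measurable_fun setT rho1. Proof. by case: dec1. Qed.
Let m2 : measurable_fun setT rho2. Proof. by case: dec2. Qed.
Let p1 : forall x, (0 <= rho1 x)%R. Proof. by case: dec1. Qed.
Let p2 : forall x, (0 <= rho2 x)%R. Proof. by case: dec2. Qed.

Let mr1 : measurable_fun setT (fun x : X => rho1 x.1).
Proof. exact: (measurableT_comp m1 mfst). Qed.
Let mr2 : measurable_fun setT (fun x : X => rho2 x.2).
Proof. exact: (measurableT_comp m2 msnd). Qed.

Lemma measurable_reverse_integrand :
  measurable_fun setT (reverse_integrand F1 F2 c rho1 rho2 : X -> \bar R).
Proof.
rewrite /reverse_integrand; apply: emeasurable_funD => //.
apply: emeasurable_funD.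
  rewrite (_ : (fun x : X => _) = (fun x : X => persp a1 b1 (rho1 x.1) 1)).
    by apply: measurable_persp => //; exact: measurable_cst.
  by apply/funext => x; rewrite (reverse_entropy_persp rep1).
rewrite (_ : (fun x : X => _) = (fun x : X => persp a2 b2 (rho2 x.2) 1)).
  by apply: measurable_persp => //; exact: measurable_cst.
by apply/funext => x; rewrite (reverse_entropy_persp rep2).
Qed.

Lemma reverse_integrand_ge0 x : 0 <= reverse_integrand F1 F2 c rho1 rho2 x.
Proof.
rewrite /reverse_integrand (reverse_entropy_persp rep1)//.
by rewrite (reverse_entropy_persp rep2)// !adde_ge0// persp_ge0.
Qed.

Lemma ET_functional_reverse : ET_functional F1 F2 c mu1 mu2 gam =
  \int[gam]_x reverse_integrand F1 F2 c rho1 rho2 x +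
  (F1 0%R * mu1' setT + F2 0%R * mu2' setT).
Proof.
rewrite /ET_functional (entropy_reverse rep1 dec1) (entropy_reverse rep2 dec2).
have E1 : \int[marginal1 gam]_x reverse_entropy F1 (rho1 x) =
    \int[gam]_x persp a1 b1 (rho1 x.1) 1.
  under eq_integral do rewrite (reverse_entropy_persp rep1)//.
  apply: marginal1_integral => //; last by move=> x; exact: persp_ge0.
  by apply: measurable_persp => //; exact: measurable_cst.
have E2 : \int[marginal2 gam]_x reverse_entropy F2 (rho2 x) =
    \int[gam]_x persp a2 b2 (rho2 x.2) 1.
  under eq_integral do rewrite (reverse_entropy_persp rep2)//.
  apply: marginal2_integral => //; last by move=> x; exact: persp_ge0.
  by apply: measurable_persp => //; exact: measurable_cst.
rewrite E1 E2 /reverse_integrand.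
under [in RHS]eq_integral do
  rewrite (reverse_entropy_persp rep1)// (reverse_entropy_persp rep2)//.
have q1 : measurable_fun setT (fun x : X => persp a1 b1 (rho1 x.1) 1).
  by apply: measurable_persp => //; exact: measurable_cst.
have q2 : measurable_fun setT (fun x : X => persp a2 b2 (rho2 x.2) 1).
  by apply: measurable_persp => //; exact: measurable_cst.
rewrite ge0_integralD//; last 2 first.
- by move=> x _; rewrite adde_ge0// persp_ge0.
- exact: emeasurable_funD.
rewrite ge0_integralD//; [|by move=> x _; exact: persp_ge0..].
by rewrite [X in X + _ = _]addeACA [LHS]addeAC.
Qed.

(** With [theta] the measurable optimal dilation, the plan [theta gam] is a
    competitor in the definition of [ET]. Its mass is finite because the
    reduced cost grows at least linearly in [theta], with rate [delta]. *)
Lemma ET_le_reduced : Radon gam ->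
  ET F1 F2 c mu1 mu2 <=
  \int[gam]_x reduced_cost a1 b1 a2 b2 (rho1 x.1) (rho2 x.2) (c x) +
  (F1 0%R * mu1' setT + F2 0%R * mu2' setT).
Proof.
move=> rgam; pose K x := reduced_cost a1 b1 a2 b2 (rho1 x.1) (rho2 x.2) (c x).
rewrite -/K.
have [k1 [k2 [kappa [ak1 ak2 kappa0 kc kpos]]]] := coercive_constants.
have [theta [mt t0 tK]] := measurable_optimal_plan a10 b10 a20 b20
  mr1 mr2 mc c0 kappa0 kc kpos.
have mK : measurable_fun setT (K : X -> \bar R).
  exact: (measurable_reduced_cost a10 b10 a20 b20 mr1 mr2 mc).
have K0 x : 0 <= K x.
  exact: reduced_cost_ge0.
have [Kfin|] := ltP (\int[gam]_x K x) +oo; last first.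
  rewrite leye_eq => /eqP ->; rewrite addye ?leey// gt_eqF//.
  by rewrite (lt_le_trans (ltNy0))// adde_ge0// mule_ge0.
have [r1 d1] : measurable_fun setT (fun x : X => (rho1 x.1)%:E) /\
    \int[gam]_x (rho1 x.1)%:E < +oo.
  split; first exact/measurable_EFinP.
  rewrite -(marginal1_integral gam (f := EFin \o rho1) measurableT)//; last first.
    exact/measurable_EFinP.
  apply: (@le_lt_trans _ _ (mu1 setT)); last by rewrite ltey_eq fin_num_measure.
  by case: dec1 => _ _ _ -> //; rewrite leeDl.
have [r2 d2] : measurable_fun setT (fun x : X => (rho2 x.2)%:E) /\
    \int[gam]_x (rho2 x.2)%:E < +oo.
  split; first exact/measurable_EFinP.
  rewrite -(marginal2_integral gam (f := EFin \o rho2) measurableT)//; last first.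
    exact/measurable_EFinP.
  apply: (@le_lt_trans _ _ (mu2 setT)); last by rewrite ltey_eq fin_num_measure.
  by case: dec2 => _ _ _ -> //; rewrite leeDl.
pose delta := (a1 k1 + a2 k2 + kappa)%R.
have it : \int[gam]_x (theta x)%:E < +oo.
  have : \int[gam]_x (delta%:E * (theta x)%:E) <=
      \int[gam]_x (K x + (`|b1 k1|%:E * (rho1 x.1)%:E + `|b2 k2|%:E * (rho2 x.2)%:E)).
    apply: le_integral_ge0 => x _.
      by rewrite !adde_ge0// mule_ge0// lee_fin.
    have h : (delta * theta x + (b1 k1 * rho1 x.1 + b2 k2 * rho2 x.2))%:E <= K x.
      apply: (le_trans _ (tK x)); rewrite /plan_cost.
      have -> : (delta * theta x + (b1 k1 * rho1 x.1 + b2 k2 * rho2 x.2) =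
        (a1 k1 * theta x + b1 k1 * rho1 x.1) + (a2 k2 * theta x + b2 k2 * rho2 x.2)
        + kappa * theta x)%R by rewrite /delta; lra.
      rewrite EFinD EFinD EFinM; apply: leeD; [apply: leeD; exact: persp_ge|].
      by rewrite lee_wpmul2r// lee_fin.
    apply: (@le_trans _ _ ((delta * theta x + (b1 k1 * rho1 x.1 + b2 k2 * rho2 x.2))%:E
       + (`|b1 k1| * rho1 x.1 + `|b2 k2| * rho2 x.2)%:E)).
      rewrite -EFinM -EFinD lee_fin.
      have : (0 <= (b1 k1 + `|b1 k1|) * rho1 x.1)%R.
        by rewrite mulr_ge0//; have := ler_norm (- b1 k1); rewrite normrN; lra.
      have : (0 <= (b2 k2 + `|b2 k2|) * rho2 x.2)%R.
        by rewrite mulr_ge0//; have := ler_norm (- b2 k2); rewrite normrN; lra.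
      by lra.
    by apply: leeD => //; rewrite EFinD !EFinM.
  rewrite ge0_integralZl//; last 3 first.
  - exact/measurable_EFinP.
  - by move=> x _; rewrite lee_fin.
  - by rewrite lee_fin ltW.
  rewrite -lee_pdivlMl// => /le_lt_trans; apply.
  rewrite ge0_integralD//; last 2 first.
  - by move=> x _; rewrite adde_ge0// mule_ge0// lee_fin.
  - by apply: emeasurable_funD; apply: emeasurable_funM => //; exact: measurable_cst.
  rewrite ge0_integralD//; last 4 first.
  - by move=> x _; rewrite mule_ge0// lee_fin.
  - by apply: emeasurable_funM => //; exact: measurable_cst.
  - by move=> x _; rewrite mule_ge0// lee_fin.
  - by apply: emeasurable_funM => //; exact: measurable_cst.
  rewrite !ge0_integralZl//; [|by move=> x _; rewrite lee_fin..].
  apply: lte_mul_pinfty => //; first by rewrite lee_fin invr_ge0 ltW.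
  apply: lte_add_pinfty => //; apply: lte_add_pinfty;
    by apply: lte_mul_pinfty => //; rewrite lee_fin.
have [nu nuE] := density_measure_exists mt t0 it.
have rnu : Radon nu.
  apply: (Radon_dominated (hausdorff_prod h1 h2) rgam) => A mA A0.
  by rewrite nuE; apply: null_set_integral => //; apply/measurable_EFinP; exact: measurable_funS mt.
apply: (@le_trans _ _ (ET_functional F1 F2 c mu1 mu2 nu)).
  by apply: ereal_inf_lbound; exists nu.
(* The entropies of the marginals are bounded by integrals over the product of the
   perspectives at the densities and [theta], which together with the cost are
   the optimal value of [plan_cost]. *)
have e1 : entropy_functional F1 (marginal1 nu) mu1 <=
    \int[gam]_x persp a1 b1 (rho1 x.1) (theta x) + F1 0%R * mu1' setT.
  apply: (entropy_image_le rep1 mfst mt m1 t0 p1) => A mA.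
    exact: nuE.
  case: dec1 => _ _ _ -> //; congr (_ + _).
  by apply: marginal1_integral => //; exact/measurable_EFinP.
have e2 : entropy_functional F2 (marginal2 nu) mu2 <=
    \int[gam]_x persp a2 b2 (rho2 x.2) (theta x) + F2 0%R * mu2' setT.
  apply: (entropy_image_le rep2 msnd mt m2 t0 p2) => A mA.
    exact: nuE.
  case: dec2 => _ _ _ -> //; congr (_ + _).
  by apply: marginal2_integral => //; exact/measurable_EFinP.
have e3 : \int[nu]_x c x <= \int[gam]_x (c x * (theta x)%:E).
  by apply: integral_density_le => // A mA; exact: nuE.
apply: (le_trans (leeD (leeD e1 e2) e3)).
have q1 : measurable_fun setT (fun x : X => persp a1 b1 (rho1 x.1) (theta x)).
  by apply: measurable_persp.
have q2 : measurable_fun setT (fun x : X => persp a2 b2 (rho2 x.2) (theta x)).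
  by apply: measurable_persp.
rewrite [X in X + _ <= _]addeACA [leLHS]addeAC; apply: leeD => //.
rewrite -ge0_integralD//; [|by move=> x _; exact: persp_ge0..].
rewrite -ge0_integralD//; last 4 first.
- by move=> x _; rewrite adde_ge0// persp_ge0.
- exact: emeasurable_funD.
- by move=> x _; rewrite mule_ge0// lee_fin.
- by apply: emeasurable_funM => //; exact/measurable_EFinP.
apply: le_integral_ge0 => x _; [exact: K0|exact: tK].
Qed.

End fixed_plan.

End entropy_transport_problem.

(** * Existence of optimal plans *)

Section affine_lower_bounds.
Context {d : measure_display} {T : measurableType d} {R : realType}.
Implicit Types gam mu : {finite_measure set T -> \bar R}.
Variables (F : R -> \bar R) (a b : nat -> R).
Hypothesis rep : affine_rep F a b.
Hypothesis Fs : exists2 s, (0 < s)%R & F s < +oo.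

Let a0 : a 0%N = 0%R. Proof. by case: rep. Qed.
Let b0 : b 0%N = 0%R. Proof. by case: rep. Qed.

(** Beyond a point where [F] is finite, [F] grows with slope at most its recession
    constant. *)
Lemma slope_le_recession (alpha beta : R) :
  (forall s, (0 <= s)%R -> (alpha * s + beta)%:E <= F s) ->
  alpha%:E <= persp a b 0 1.
Proof.
move=> H; have [s0 s00 Fs0] := Fs.
have [rfin|] := ltP (persp a b 0 1) +oo; last by rewrite leye_eq => /eqP ->; rewrite leey.
set l := fine (persp a b 0 1).
have lE : persp a b 0 1 = l%:E by rewrite /l fineK// ge0_fin_numE// persp_ge0.
rewrite lE lee_fin leNgt; apply/negP => la.
have FE s : (0 <= s)%R -> F s = persp a b 1 s by case: rep => _ _ + _; apply.
pose C := fine (F s0).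
have CE : F s0 = C%:E by rewrite /C fineK// ge0_fin_numE// FE ?persp_ge0// ltW.
pose t := ((`|C| + `|beta| + `|alpha * s0| + 1) / (alpha - l))%R.
have N0 : (0 < `|C| + `|beta| + `|alpha * s0| + 1)%R.
  by rewrite ltr_wpDl// !addr_ge0.
have al0 : (0 < alpha - l)%R by rewrite subr_gt0.
have t0 : (0 < t)%R by rewrite divr_gt0.
have tE : (t * (alpha - l) = `|C| + `|beta| + `|alpha * s0| + 1)%R.
  by rewrite /t divfK// gt_eqF.
have : F (s0 + t)%R <= (C + t * l)%:E.
  rewrite FE; last by rewrite addr_ge0// ltW.
  rewrite -[X in persp a b X _](addr0 1%R).
  apply: (le_trans (perspD_le _ _ _ _ _ _)).
  rewrite -FE ?(ltW s00)// CE EFinD leeD2l//.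
  rewrite -[X in persp a b X _ <= _](mulr0 t) -[X in persp a b _ X <= _](mulr1 t).
  by rewrite perspZ// lE -EFinM.
have := H (s0 + t)%R (addr_ge0 (ltW s00) (ltW t0)) => /le_trans h /h.
rewrite lee_fin.
have := ler_norm C; have := ler_norm (- beta); rewrite normrN.
have := ler_norm (- (alpha * s0)); rewrite normrN.
by lra.
Qed.

Lemma affine_sum_le_of_minorants (alpha beta : nat -> R) gam mu n A :
  (forall k s, (k <= n)%N -> (0 <= s)%R -> (alpha k * s + beta k)%:E <= F s) ->
  fin_partition n A ->
  affine_sum alpha beta gam mu n A <= entropy_functional F gam mu.
Proof.
move=> H pA; rewrite (entropy_persp rep).
have [ms s0 _ dec] := lebesgue_decompositionP gam mu.
have FE s : (0 <= s)%R -> F s = persp a b 1 s by case: rep => _ _ + _; apply.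
apply: (affine_sum_le ms s0 dec) => //.
- exact: (@measurable_persp _ a b a0 b0 _ T (cst 1%R) _ _ ms).
- by move=> x; exact: persp_ge0.
- by move=> k x kn; rewrite -FE//; exact: H.
- exact: persp_ge0.
- by move=> k kn; apply: slope_le_recession => s; exact: H.
Qed.

(** The partition consisting of [A] and its complement, with the zero function on
    the complement. *)
Lemma affine_le_entropy (alpha beta : R) gam mu A : measurable A ->
  (forall s, (0 <= s)%R -> (alpha * s + beta)%:E <= F s) ->
  alpha%:E * gam A + beta%:E * mu A <= entropy_functional F gam mu.
Proof.
move=> mA H.
pose al (k : nat) : R := if k == 1%N then alpha else 0%R.
pose be (k : nat) : R := if k == 1%N then beta else 0%R.
pose B (k : nat) : set T := if k == 1%N then A else if k == 0%N then ~` A else set0.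
have pB : fin_partition 1 B.
  split.
  - by case=> [|[|k]]; rewrite /B //=; exact: measurableC.
  - by apply/trivIsetP; case=> [|[|i]] [|[|j]] //= _ _ _; rewrite /B/=
      ?setI0 ?set0I// ?setICl ?setICr.
  - by rewrite big_ord_recl big_ord1/= setUC setUv.
have := @affine_sum_le_of_minorants al be gam mu 1 B.
rewrite /affine_sum big_ord_recl big_ord1/= /al /be /B/= !mul0e !add0e; apply => //.
case=> [|[|k]] s //= _ s0; last exact: H.
by rewrite mul0r addr0; case: rep => _ _ -> // _; exact: persp_ge0.
Qed.

End affine_lower_bounds.

Lemma lt_adde_real {R : realType} (x : R) (A B : \bar R) :
  0 <= A -> 0 <= B -> x%:E < A + B ->
  exists s1 s2 : R, [/\ s1%:E < A, s2%:E < B & (x < s1 + s2)%R].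
Proof.
case: A B => [A| |] [B| |]//.
- move=> _ _; rewrite -EFinD lte_fin => xAB.
  exists (A - (A + B - x) / 3)%R, (B - (A + B - x) / 3)%R.
  by rewrite !lte_fin; split; lra.
- by move=> _ _ _; exists (A - 1)%R, (x - A + 2)%R; rewrite ltry lte_fin; split => //; lra.
- by move=> _ _ _; exists (x - B + 2)%R, (B - 1)%R; rewrite ltry lte_fin; split => //; lra.
- move=> _ _ _; exists (`|x| + 1)%R, (`|x| + 1)%R; rewrite !ltry; split => //.
  by have := ler_norm x; have := normr_ge0 x; lra.
Qed.

Lemma markov_superlevel {d} {T : measurableType d} {R : realType}
    (gam : {finite_measure set T -> \bar R}) (c : T -> \bar R) (t : R) :
  measurable_fun setT c -> (forall x, 0 <= c x) -> (0 <= t)%R ->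
  t%:E * gam (~` [set x | c x <= t%:E]) <= \int[gam]_x c x.
Proof.
move=> mc c0 t0.
have mS : measurable (~` [set x | c x <= t%:E]).
  by apply: measurableC; rewrite -[X in measurable X]setTI; exact: emeasurable_fun_infty_c.
apply: (@le_trans _ _ (\int[gam]_(x in ~` [set x | c x <= t%:E]) c x)).
  have <- : \int[gam]_(x in ~` [set x | c x <= t%:E]) cst t%:E x =
      t%:E * gam (~` [set x | c x <= t%:E]) by exact: integral_cst.
  by apply: le_integral_ge0 => // x /= /negP; rewrite -ltNge => /ltW.
exact: ge0_subset_integral.
Qed.

Section minimizers.
Context {R : realType} {X1 X2 : ptopologicalType}.
Notation X := (borel (X1 * X2)%type).
Variables (F1 F2 : R -> \bar R) (c : X1 * X2 -> \bar R).
Variables (mu1 : {finite_measure set (borel X1) -> \bar R})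
          (mu2 : {finite_measure set (borel X2) -> \bar R}).
Variables (a1 b1 a2 b2 : nat -> R).
Hypotheses (rep1 : affine_rep F1 a1 b1) (rep2 : affine_rep F2 a2 b2).
Hypotheses (Fs1 : exists2 s, (0 < s)%R & F1 s < +oo)
           (Fs2 : exists2 s, (0 < s)%R & F2 s < +oo).
Hypotheses (h1 : hausdorff_space X1) (h2 : hausdorff_space X2).
Hypotheses (c0 : forall x, 0 <= c x) (lsc : lower_semicontinuous c).
Hypothesis coer : coercive F1 F2 c.
Hypotheses (rmu1 : Radon mu1) (rmu2 : Radon mu2).
Implicit Types gam : {finite_measure set X -> \bar R}.

Let a10 : a1 0%N = 0%R. Proof. by case: rep1. Qed.
Let b10 : b1 0%N = 0%R. Proof. by case: rep1. Qed.
Let a20 : a2 0%N = 0%R. Proof. by case: rep2. Qed.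
Let b20 : b2 0%N = 0%R. Proof. by case: rep2. Qed.
Let mc : measurable_fun setT (c : X -> \bar R).
Proof. exact: lsc_borel_measurable. Qed.

Let E gam := ET_functional F1 F2 c mu1 mu2 gam.

Let e1_ge0 gam : 0 <= entropy_functional F1 (marginal1 gam) mu1.
Proof. exact: entropy_ge0 rep1 _ _. Qed.
Let e2_ge0 gam : 0 <= entropy_functional F2 (marginal2 gam) mu2.
Proof. exact: entropy_ge0 rep2 _ _. Qed.
Let ic_ge0 gam : 0 <= \int[gam]_x c x.
Proof. by apply: integral_ge0. Qed.

Lemma ET_functional_ge0 gam : 0 <= E gam.
Proof. exact: (adde_ge0 (adde_ge0 (e1_ge0 gam) (e2_ge0 gam)) (ic_ge0 gam)). Qed.

Lemma ET_ge0 : 0 <= ET F1 F2 c mu1 mu2.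
Proof. by apply: le_ereal_inf_tmp => _ [gam _ <-]; exact: ET_functional_ge0. Qed.

Let e1_le gam : entropy_functional F1 (marginal1 gam) mu1 <= E gam.
Proof. by rewrite /E /ET_functional -addeA leeDl//; exact: (adde_ge0 (e2_ge0 gam) (ic_ge0 gam)). Qed.
Let e2_le gam : entropy_functional F2 (marginal2 gam) mu2 <= E gam.
Proof. by rewrite /E /ET_functional [leRHS]addeAC leeDr//; exact: (adde_ge0 (e1_ge0 gam) (ic_ge0 gam)). Qed.
Let ic_le gam : \int[gam]_x c x <= E gam.
Proof. by rewrite /E /ET_functional leeDr//; exact: (adde_ge0 (e1_ge0 gam) (e2_ge0 gam)). Qed.

(** The three constants of [coercive_constants] give
    [delta * gam setT <= E gam + constant]. *)
Lemma bounded_mass (M : R) : exists N : R, forall gam, E gam <= M%:E ->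
  gam setT <= N%:E.
Proof.
have [k1 [k2 [kappa [ak1 ak2 kappa0 kc kpos]]]] := coercive_constants rep1 rep2 c0 coer.
pose delta := (a1 k1 + a2 k2 + kappa)%R.
pose m1 := fine (mu1 setT); pose m2 := fine (mu2 setT).
exists ((M - b1 k1 * m1 - b2 k2 * m2) / delta)%R => gam EM.
pose x := fine (gam setT).
have xE : gam setT = x%:E by rewrite /x fineK// fin_num_measure.
have l1 : (a1 k1)%:E * gam setT + (b1 k1)%:E * mu1 setT <=
    entropy_functional F1 (marginal1 gam) mu1.
  exact: (affine_le_entropy rep1 Fs1 (marginal1 gam) mu1 measurableT (rep_minorant rep1 k1)).
have l2 : (a2 k2)%:E * gam setT + (b2 k2)%:E * mu2 setT <=
    entropy_functional F2 (marginal2 gam) mu2.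
  exact: (affine_le_entropy rep2 Fs2 (marginal2 gam) mu2 measurableT (rep_minorant rep2 k2)).
have l3 : kappa%:E * gam setT <= \int[gam]_x c x.
  have <- : \int[gam]_x cst kappa%:E x = kappa%:E * gam setT by exact: integral_cst.
  by apply: le_integral_ge0.
have := le_trans (leeD (leeD l1 l2) l3) EM.
rewrite xE (fine_measureK mu1 measurableT) (fine_measureK mu2 measurableT).
rewrite -!EFinM -!EFinD !lee_fin -/m1 -/m2 => H.
by rewrite ler_pdivlMr// /delta; lra.
Qed.

(** Superlinear case: a slope [a k] large compared with [M / e], tested on the
    complement of a compact set of small [mu]-mass. *)
Let tight_marginal {T : ptopologicalType} F a b
    (mu : {finite_measure set (borel T) -> \bar R}) (M e : R) :
  affine_rep F a b -> (exists2 s, (0 < s)%R & F s < +oo) ->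
  hausdorff_space T -> recession F = +oo -> Radon mu -> (0 < e)%R ->
  exists2 K : set T, compact K & forall nu : {finite_measure set (borel T) -> \bar R},
    entropy_functional F nu mu <= M%:E -> nu (~` K) <= e%:E.
Proof.
move=> rep Fs hT rinf rmu e0.
have [k ak] : exists k, (2 * (`|M| + 1) / e < a k)%R.
  have : (2 * (`|M| + 1) / e)%:E < recession F by rewrite rinf ltry.
  case: rep => _ _ _ -> /ereal_sup_gt[_ [k _ <-]].
  by rewrite mulr1 mulr0 addr0 lte_fin; exists k.
have M0 : (0 < `|M| + 1)%R by rewrite ltr_wpDl.
have a0 : (0 < a k)%R.
  by apply: lt_trans ak; rewrite divr_gt0// mulr_gt0.
pose r := (a k * e / 2 / (`|b k| + 1))%R.
have r0 : (0 < r)%R by rewrite !divr_gt0 ?mulr_gt0// ltr_wpDl.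
have rE : (r * (`|b k| + 1) = a k * e / 2)%R.
  by rewrite /r divfK// gt_eqF// ltr_wpDl.
have [K [cK _ leK]] := rmu _ measurableT _ r0.
rewrite setTD in leK.
exists K => // nu nuM.
have mK : measurable (~` K : set (borel T)).
  by apply: measurableC; exact: compact_borel.
have := le_trans (affine_le_entropy rep Fs nu mu mK (rep_minorant rep k)) nuM.
move: leK; rewrite (fine_measureK mu mK) (fine_measureK nu mK).
rewrite -!EFinM -EFinD !lee_fin.
set y := fine (nu _); set z := fine (mu _) => zr H.
have z0 : (0 <= z)%R by rewrite fine_ge0.
have H1 : (`|b k| * z <= `|b k| * r)%R by rewrite ler_wpM2l.
have H2 : (- (`|b k| * z) <= b k * z)%R.
  by rewrite -mulNr ler_wpM2r//; have := ler_norm (- b k); rewrite normrN; lra.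
move: ak; rewrite ltr_pdivrMr// => ak.
rewrite -(ler_pM2l a0); have := ler_norm M; lra.
Qed.

(** In the superlinear case the compact set is a product; otherwise it is a sublevel
    set of [c], by the inequality of Markov. *)
Lemma tight_sublevel (M e : R) : (0 < e)%R ->
  exists2 K : set (X1 * X2), compact K &
    forall gam, E gam <= M%:E -> gam (~` K) <= e%:E.
Proof.
move=> e0; case: coer => [[r1 r2]|[_ cc]].
  have e20 : (0 < e / 2)%R by rewrite divr_gt0.
  have [K1 cK1 H1] := tight_marginal M rep1 Fs1 h1 r1 rmu1 e20.
  have [K2 cK2 H2] := tight_marginal M rep2 Fs2 h2 r2 rmu2 e20.
  exists (K1 `*` K2); first exact: compact_setX.
  move=> gam EM.
  have l1 := H1 (marginal1 gam) (le_trans (e1_le gam) EM).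
  have l2 := H2 (marginal2 gam) (le_trans (e2_le gam) EM).
  have m1 : measurable (fst @^-1` (~` K1) : set X).
    rewrite -[X in measurable X]setTI; apply: measurable_borel_fst => //.
    by apply: measurableC; exact: compact_borel.
  have m2 : measurable (snd @^-1` (~` K2) : set X).
    rewrite -[X in measurable X]setTI; apply: measurable_borel_snd => //.
    by apply: measurableC; exact: compact_borel.
  rewrite [e]splitr EFinD; apply: le_trans (leeD l1 l2).
  apply: (@le_trans _ _ (gam ((fst @^-1` (~` K1)) `|` (snd @^-1` (~` K2))))).
    apply: le_measure; rewrite ?inE.
    - apply: measurableC; apply: compact_borel; last exact: compact_setX.
      exact: hausdorff_prod.
    - exact: measurableU.
    - by move=> [x y] nK /=; have [Kx|] := pselect (K1 x); [right => Ky; apply: nK|left].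
  exact: measureU2.
pose t := ((`|M| + 1) / e)%R.
have t0 : (0 < t)%R by rewrite divr_gt0// ltr_wpDl.
exists [set x | c x <= t%:E]; first exact: cc.
move=> gam EM.
have := le_trans (markov_superlevel gam mc c0 (ltW t0)) (le_trans (ic_le gam) EM).
rewrite -lee_pdivlMl// => /le_trans; apply; rewrite -EFinM lee_fin.
rewrite /t invf_div mulrAC ler_pdivrMr ?ltr_wpDl//.
by rewrite ler_pM2l//; have := ler_norm M; lra.
Qed.

Lemma weak_cvg_marginal1 (U : set_system nat)
    (g : nat -> {finite_measure set X -> \bar R}) g0 :
  @weak_cvg R (X1 * X2)%type U g g0 ->
  @weak_cvg R X1 U (fun m => marginal1 (g m)) (marginal1 g0).
Proof.
move=> [H1 H2]; split => // G s oG; apply: H1.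
by move: G oG; apply/continuousP => x; exact: cvg_fst.
Qed.

Lemma weak_cvg_marginal2 (U : set_system nat)
    (g : nat -> {finite_measure set X -> \bar R}) g0 :
  @weak_cvg R (X1 * X2)%type U g g0 ->
  @weak_cvg R X2 U (fun m => marginal2 (g m)) (marginal2 g0).
Proof.
move=> [H1 H2]; split => // G s oG; apply: H1.
by move: G oG; apply/continuousP => x; exact: cvg_snd.
Qed.

Lemma Radon_marginal1 gam : Radon gam -> @Radon R X1 (marginal1 gam).
Proof.
move=> rg; apply: (@Radon_image _ (X1 * X2)%type X1 (fst : X1 * X2 -> X1) gam) => //.
- exact: hausdorff_prod.
- by move=> x; exact: cvg_fst.
- exact: measurable_borel_fst.
Qed.

Lemma Radon_marginal2 gam : Radon gam -> @Radon R X2 (marginal2 gam).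
Proof.
move=> rg; apply: (@Radon_image _ (X1 * X2)%type X2 (snd : X1 * X2 -> X2) gam) => //.
- exact: hausdorff_prod.
- by move=> x; exact: cvg_snd.
- exact: measurable_borel_snd.
Qed.

Let entropy_lsc {T : ptopologicalType} F a b (U : set_system nat)
    (g : nat -> {finite_measure set (borel T) -> \bar R})
    (g0 mu : {finite_measure set (borel T) -> \bar R}) (s : R) :
  affine_rep F a b -> UltraFilter U -> hausdorff_space T -> Radon g0 -> Radon mu ->
  weak_cvg U g g0 -> s%:E < entropy_functional F g0 mu ->
  \forall m \near U, s%:E < entropy_functional F (g m) mu.
Proof.
move=> rep UU hT rg0 rmu gcv /(lt_entropy rep)[n [A [pA sA]]].
have [A' pA'] := affine_sum_lsc UU hT rg0 rmu gcv pA sA.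
have FU : Filter U by exact: filter_filter.
apply: filterS => m /lt_le_trans; apply; exact: affine_sum_le_entropy.
Qed.

(** Direct method: a minimizing sequence is tight, so it has a limit along an
    ultrafilter finer than the filter of cofinite sets, and each of the three terms
    of [E] is lower semicontinuous. *)
Lemma minimizer_exists : ET F1 F2 c mu1 mu2 < +oo ->
  exists2 gam, Radon gam & E gam = ET F1 F2 c mu1 mu2.
Proof.
move=> ETy; have ETfin : ET F1 F2 c mu1 mu2 \is a fin_num.
  by rewrite ge0_fin_numE// ET_ge0.
set l := fine (ET F1 F2 c mu1 mu2).
have lE : ET F1 F2 c mu1 mu2 = l%:E by rewrite /l fineK.
have /choice[g Hg] (n : nat) : exists gam, Radon gam /\ E gam <= (l + n.+1%:R^-1)%:E.
  have n0 : (0 < n.+1%:R^-1 :> R)%R by rewrite invr_gt0.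
  have [_ [gam rg <-] /ltW] := lb_ereal_inf_adherent n0 ETfin.
  by rewrite -/(ET F1 F2 c mu1 mu2) lE -EFinD; exists gam.
have gM n : E (g n) <= (l + 1)%:E.
  apply: (le_trans (Hg n).2); rewrite lee_fin lerD2l invf_le1// ler1n //.
have [U [UU subU]] := ultraFilterLemma (eventually_filter : ProperFilter \oo).
have [N HN] := bounded_mass (l + 1)%R.
have hX := hausdorff_prod h1 h2.
have [g0 rg0 gcv] := tight_weak_cvg UU hX (fun n => HN _ (gM n))
  (fun e e0 => let: ex_intro2 K cK H := tight_sublevel (l + 1) e0 in
     ex_intro2 _ _ K cK (fun n => H _ (gM n))).
exists g0 => //; apply/eqP; rewrite eq_le; apply/andP; split; last first.
  by apply: ereal_inf_lbound; exists g0.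
(* If [E g0] exceeded the infimum, a real [x] between them would split into three
   parts, each eventually exceeded by one term of [E (g m)]. *)
rewrite leNgt; apply/negP => /real_between[x [ETx xE]].
have FU : Filter U by exact: filter_filter.
have PU : ProperFilter U by exact: ultra_proper.
have [s12 [s3 [s12E s3E xs]]] := lt_adde_real (adde_ge0 (e1_ge0 g0) (e2_ge0 g0))
  (ic_ge0 g0) xE.
have [s1 [s2 [s1E s2E s12s]]] := lt_adde_real (e1_ge0 g0) (e2_ge0 g0) s12E.
have n1 := entropy_lsc rep1 UU h1 (Radon_marginal1 rg0) rmu1 (weak_cvg_marginal1 gcv) s1E.
have n2 := entropy_lsc rep2 UU h2 (Radon_marginal2 rg0) rmu2 (weak_cvg_marginal2 gcv) s2E.
have n3 := weak_lsc_integral UU gcv c0 lsc s3E.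
have n4 : \forall m \near U, E (g m) < x%:E.
  move: ETx; rewrite lE lte_fin -subr_gt0 => lx.
  have : \forall m \near \oo, E (g m) < x%:E.
    have [k _ Hk] := near_infty_natSinv_lt (PosNum lx).
    exists k => // m km; apply: (le_lt_trans (Hg m).2).
    by rewrite lte_fin -ltrBrDl; exact: Hk.
  exact: subU.
have [m [[[H1 H2] H3] H4]] := filter_ex (filterI (filterI (filterI n1 n2) n3) n4).
move: H4; rewrite ltNge => /negP; apply; apply: ltW.
apply: (@lt_trans _ _ (s1 + s2 + s3)%:E); first by rewrite lte_fin; lra.
by rewrite /E /ET_functional !EFinD; apply: lteD => //; exact: lteD.
Qed.

End minimizers.

(** * The dual bound *)

Section simple_integral.
Context {d : measure_display} {T : measurableType d} {R : realType}.

Lemma integral_on_partition (nu : {finite_measure set T -> \bar R}) n A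
    (v : nat -> R) (f : T -> R) :
  fin_partition n A -> (forall k x, (k <= n)%N -> A k x -> f x = v k) ->
  \int[nu]_x (f x)%:E = \sum_(k < n.+1) (v k)%:E * nu (A k).
Proof.
move=> pA fv; have [mA tA UA] := pA.
have mf : measurable_fun setT f.
  rewrite (_ : f = fun x => \sum_(k < n.+1) v k * \1_(A k) x)%R.
    by apply: measurable_sum => k; exact: measurable_funM.
  apply/funext => x.
  have : (\big[setU/set0]_(k < n.+1) A k) x by rewrite UA.
  rewrite -bigcup_mkord => -[k /= kn Akx].
  rewrite (bigD1 (Ordinal kn))//= big1 ?addr0.
    by rewrite indicE mem_set// mulr1; apply: fv.
  move=> i ik; rewrite indicE memNset ?mulr0// => Aix.
  move/eqP : ik; apply; apply: val_inj => /=.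
  by apply: tA => //; exists x.
have part (g : T -> \bar R) (w : nat -> R) : measurable_fun setT g ->
    (forall x, 0 <= g x) -> (forall k x, (k <= n)%N -> A k x -> g x = (w k)%:E) ->
    \int[nu]_x g x = (\sum_(k < n.+1) w k * fine (nu (A k)))%:E.
  move=> mg g0 gw; rewrite (integral_partition nu pA mg g0) -sumEFin.
  apply: eq_bigr => k _; rewrite EFinM -fine_measureK//.
  rewrite -integral_cst//; apply: eq_integral => x /set_mem Ax.
  by rewrite (gw k)// -ltnS.
have mfE : measurable_fun setT (EFin \o f) by exact/measurable_EFinP.
rewrite integralE.
rewrite (part ((EFin \o f)^\+) (fun k => Num.max (v k) 0)%R); last 3 first.
- exact: measurable_funepos.
- by move=> x; exact: funepos_ge0.
- by move=> k x kn Ax; rewrite funeposE /= (fv k)// EFin_max.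
rewrite (part ((EFin \o f)^\-) (fun k => Num.max (- v k) 0)%R); last 3 first.
- exact: measurable_funeneg.
- by move=> x; exact: funeneg_ge0.
- by move=> k x kn Ax; rewrite funenegE /= (fv k)// EFin_max.
rewrite -EFinB -sumrB -sumEFin; apply: eq_bigr => k _.
rewrite -mulrBl EFinM -fine_measureK//; congr (_%:E * _).
by case: (leP (v k) 0%R) => h1; case: (leP (- v k)%R 0%R) => h2; lra.
Qed.

Lemma finite_range_partition (f : T -> R) :
  measurable_fun setT f -> finite_set (range f) ->
  exists n A (v : nat -> R), [/\ fin_partition n A,
    forall k x, (k <= n)%N -> A k x -> f x = v k &
    forall k, (k <= n)%N -> exists x, f x = v k].
Proof.
move=> mf finf.
pose r : seq R := finmap.enum_fset (fset_set (range f)).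
have ur : uniq r by exact: finmap.fset_uniq.
have rP y : (y \in r) = (y \in range f) by rewrite in_fset_set.
have r0 : (0 < size r)%N.
  have : f point \in r by rewrite rP mem_set//; exists point.
  by case: r {ur rP}.
pose A k : set T := if (k < size r)%N then f @^-1` [set nth 0%R r k] else set0.
have Ak k x : A k x -> (k < size r)%N /\ f x = nth 0%R r k.
  by rewrite /A; case: ifP.
exists (size r).-1, A, (nth 0%R r); split.
- split.
  + move=> k; rewrite /A; case: ifP => // _.
    by rewrite -[X in measurable X]setTI; exact: mf.
  + apply/trivIsetP => i j _ _ ij; apply/seteqP; split => // x [/Ak[ir fi] /Ak[jr fj]].
    by move/eqP : ij; apply; apply/eqP; rewrite -(nth_uniq 0%R ir jr ur) -fi -fj.
  + rewrite prednK// -bigcup_mkord; apply/seteqP; split => // x _.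
    have fr : f x \in r by rewrite rP mem_set//; exists x.
    exists (index (f x) r); first by rewrite /= index_mem.
    by rewrite /A index_mem fr /= nth_index.
- by move=> k x _ /Ak[].
- move=> k kn; have kr : (k < size r)%N by rewrite -(prednK r0) ltnS.
  have : nth 0%R r k \in r by exact: mem_nth.
  by rewrite rP => /set_mem[x _ <-]; exists x.
Qed.

End simple_integral.

Lemma lsc_real_measurable {R : realType} {T : ptopologicalType} (f : T -> R) :
  lower_semicontinuous (EFin \o f) -> measurable_fun setT (f : borel T -> R).
Proof. by move=> /lsc_borel_measurable/measurable_EFinP. Qed.

Section entropy_dual_bound.
Context {R : realType} {T : ptopologicalType}.
Variables (F : R -> \bar R) (a b : nat -> R).
Hypotheses (rep : affine_rep F a b) (Fs : exists2 s, (0 < s)%R & F s < +oo).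

Lemma concave_conjugate_minorant (p s : R) : (0 <= s)%R ->
  concave_conjugate F p \is a fin_num ->
  (- p * s + fine (concave_conjugate F p))%:E <= F s.
Proof.
move=> s0 fp; rewrite EFinD fineK//.
have : concave_conjugate F p <= F s + (s * p)%:E by apply: ereal_inf_lbound; exists s.
move=> /(leeD2l (- p * s)%:E) /le_trans; apply.
by rewrite addeCA -EFinD (_ : - p * s + s * p = 0)%R ?adde0//; lra.
Qed.

(** As [phi] has finitely many values [v k], both integrals are finite sums over the
    level sets, and the functions [- v k * s + w k], [w k] being the conjugate at
    [v k], are affine minorants of [F]. *)
Lemma entropy_ge_dual (phi : T -> R) (nu mu : {finite_measure set (borel T) -> \bar R}) :
  lower_semicontinuous (EFin \o phi) -> finite_set (range phi) ->
  (exists M : R, forall x, `|concave_conjugate F (phi x)| <= M%:E) ->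
  exists D I : R, [/\ \int[mu]_x concave_conjugate F (phi x) = D%:E,
    nu.-integrable setT (EFin \o (phi : borel T -> R)),
    \int[nu]_x (phi x)%:E = I%:E &
    (D - I)%:E <= entropy_functional F nu mu].
Proof.
move=> lphi finphi [M HM].
have mphi := lsc_real_measurable lphi.
have fc x : concave_conjugate F (phi x) \is a fin_num.
  by rewrite fin_num_abs; apply: le_lt_trans (HM x) _; rewrite ltry.
have [n [A [v [pA Av vx]]]] := @finite_range_partition _ (borel T) R phi
  mphi finphi.
have [mA tA UA] := pA.
pose w k := fine (concave_conjugate F (v k)).
have nuE := integral_on_partition nu pA Av.
have absE := @integral_on_partition _ _ _ nu n A (fun k => `|v k|)%R
  (fun x => `|phi x|)%R pA (fun k x kn Ax => congr1 _ (Av k x kn Ax)).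
have muE : \int[mu]_x concave_conjugate F (phi x) =
    \sum_(k < n.+1) (w k)%:E * mu (A k).
  rewrite -(@integral_on_partition _ _ _ mu n A w
    (fun x => fine (concave_conjugate F (phi x))) pA); last first.
    by move=> k x kn Ax; rewrite /w (Av k).
  by apply: eq_integral => x _; rewrite fineK.
exists (\sum_(k < n.+1) w k * fine (mu (A k)))%R,
       (\sum_(k < n.+1) v k * fine (nu (A k)))%R; split.
- rewrite muE -sumEFin; apply: eq_bigr => k _.
  by rewrite EFinM -fine_measureK.
- apply/integrableP; split; first exact/measurable_EFinP.
  under eq_integral do rewrite /=.
  rewrite absE.
  rewrite (eq_bigr (fun k : 'I_n.+1 => (`|v k| * fine (nu (A k)))%:E)) ?sumEFin ?ltry//.
  by move=> k _; rewrite EFinM -fine_measureK.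
- rewrite nuE -sumEFin; apply: eq_bigr => k _.
  by rewrite EFinM -fine_measureK.
- have := @affine_sum_le_of_minorants _ _ _ F a b rep Fs (fun k => - v k)%R w nu mu n A.
  rewrite affine_sum_fine//.
  rewrite (_ : (\sum_(k < n.+1) (- v k * fine (nu (A k)) + w k * fine (mu (A k))))%R =
    (\sum_(k < n.+1) w k * fine (mu (A k)) - \sum_(k < n.+1) v k * fine (nu (A k)))%R).
    apply => // k s kn s0; apply: concave_conjugate_minorant => //.
    by have [x <-] := vx k kn.
  by rewrite -sumrB; apply: eq_bigr => k _; lra.
Qed.

End entropy_dual_bound.

Lemma dual_le_ET_functional {R : realType} {X1 X2 : ptopologicalType}
    (F1 F2 : R -> \bar R) (c : X1 * X2 -> \bar R)
    (mu1 : {finite_measure set (borel X1) -> \bar R})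
    (mu2 : {finite_measure set (borel X2) -> \bar R})
    (a1 b1 a2 b2 : nat -> R) phi
    (gam : {finite_measure set (borel (X1 * X2)%type) -> \bar R}) :
  affine_rep F1 a1 b1 -> affine_rep F2 a2 b2 ->
  (exists2 s, (0 < s)%R & F1 s < +oo) -> (exists2 s, (0 < s)%R & F2 s < +oo) ->
  (forall x, 0 <= c x) -> Phi F1 F2 c phi ->
  dual_functional F1 F2 mu1 mu2 phi <= ET_functional F1 F2 c mu1 mu2 gam.
Proof.
move=> rep1 rep2 Fs1 Fs2 c0 [[l1 l2] [f1 f2] [B1 B2] phic].
have [D1 [I1 [D1E i1 I1E H1]]] := entropy_ge_dual rep1 Fs1 (marginal1 gam) mu1 l1 f1 B1.
have [D2 [I2 [D2E i2 I2E H2]]] := entropy_ge_dual rep2 Fs2 (marginal2 gam) mu2 l2 f2 B2.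
have /integrableP[mi1 fi1] := i1; have /integrableP[mi2 fi2] := i2.
have j1 : gam.-integrable setT (fun x : borel (X1 * X2)%type => (phi.1 x.1)%:E).
  apply/integrableP; split; first exact: (measurableT_comp mi1 measurable_borel_fst).
  rewrite -(marginal1_integral gam (f := fun x => `|(phi.1 x)%:E|) measurableT)//.
  exact: measurableT_comp.
have j2 : gam.-integrable setT (fun x : borel (X1 * X2)%type => (phi.2 x.2)%:E).
  apply/integrableP; split; first exact: (measurableT_comp mi2 measurable_borel_snd).
  rewrite -(marginal2_integral gam (f := fun x => `|(phi.2 x)%:E|) measurableT)//.
  exact: measurableT_comp.
have e1 : \int[gam]_x (phi.1 x.1)%:E = I1%:E.
  by rewrite -I1E; apply/esym; exact: (integral_pushforward measurable_borel_fst mi1 j1).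
have e2 : \int[gam]_x (phi.2 x.2)%:E = I2%:E.
  by rewrite -I2E; apply/esym; exact: (integral_pushforward measurable_borel_snd mi2 j2).
(* The pushforward moves the integrals of [phi] to the plan, where the constraint
   compares their sum with the cost. *)
have ic : (I1 + I2)%:E <= \int[gam]_x c x.
  rewrite EFinD -e1 -e2 -integralD//; apply: le_integral_ge0 => // -[x1 x2] _ /=.
  by rewrite -EFinD; exact: phic.
rewrite /dual_functional D1E D2E /ET_functional.
apply: le_trans (leeD (leeD H1 H2) ic).
by rewrite -!EFinD lee_fin; lra.
Qed.

(** * Uniqueness of decompositions and gluing *)

Section almost_everywhere.
Context {d : measure_display} {T : measurableType d} {R : realType}.

Lemma decomposition_integrable (mu g mu' : {finite_measure set T -> \bar R})
    (rho : T -> R) : is_lebesgue_decomposition mu g rho mu' ->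
  g.-integrable setT (EFin \o rho).
Proof.
move=> [mr r0 _ dec]; apply/integrableP; split; first exact/measurable_EFinP.
under eq_integral do rewrite /= ger0_norm//.
apply: (@le_lt_trans _ _ (mu setT)); last by rewrite ltey_eq fin_num_measure.
by rewrite dec// leeDl.
Qed.

(** On the intersection of two sets that carry [g] and that the two singular
    parts do not charge, both densities represent [mu]. *)
Lemma lebesgue_decomposition_unique (mu g mu' mu'' : {finite_measure set T -> \bar R})
    (rho sigma : T -> R) :
  is_lebesgue_decomposition mu g rho mu' ->
  is_lebesgue_decomposition mu g sigma mu'' ->
  ae_eq g setT (EFin \o rho) (EFin \o sigma) /\ mu' setT = mu'' setT.
Proof.
move=> d1 d2; have [mr r0 [N [mN N0 NC0]] dec] := d1.
have [ms s0 [N' [mN' N'0 N'C0]] dec'] := d2.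
have ir := decomposition_integrable d1; have is_ := decomposition_integrable d2.
pose B := N `&` N'.
have mB : measurable B by exact: measurableI.
have BC0 : g (~` B) = 0.
  rewrite setCI; apply/eqP; rewrite eq_le measure_ge0 andbT.
  apply: (le_trans (measureU2 _ _ _)); [exact: measurableC..|].
  by rewrite [X in X + _]NC0 [X in _ + X]N'C0 adde0.
have part (nu : {finite_measure set T -> \bar R}) (f : T -> R) P A :
    measurable A -> measurable P -> B `<=` P ->
    measurable_fun setT f -> (forall x, 0 <= f x)%R -> nu P = 0 ->
    (forall A, measurable A -> mu A = \int[g]_(x in A) (f x)%:E + nu A) ->
    mu (A `&` B) = \int[g]_(x in A) (f x)%:E.
  move=> mA mP BP mf f0 nP decf.
  have mAB : measurable (A `&` B) by exact: measurableI.
  rewrite decf// (_ : nu (A `&` B) = 0) ?adde0; last first.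
    by apply: (subset_measure0 mAB mP) => // x [_ /BP].
  rewrite [RHS](@ge0_negligible_integral _ _ _ _ _ (~` B))//; last 3 first.
  - exact: measurableC.
  - by apply/measurable_EFinP; exact: measurable_funS mf.
  - by move=> x _; rewrite lee_fin.
  by rewrite setDE setCK.
have eqA A : measurable A ->
    \int[g]_(x in A) (rho x)%:E = \int[g]_(x in A) (sigma x)%:E.
  move=> mA.
  rewrite -(part _ _ _ _ mA mN (@subIsetl _ N N') mr r0 N0 dec).
  by rewrite -(part _ _ _ _ mA mN' (@subIsetr _ N N') ms s0 N'0 dec').
split.
  apply: integral_ae_eq => //; first exact/measurable_EFinP.
  by move=> E _ mE; exact: eqA.
have h1 := dec _ measurableT; have h2 := dec' _ measurableT.
have fr : \int[g]_x (rho x)%:E \is a fin_num by exact: integrable_fin_num.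
have : \int[g]_x (rho x)%:E + mu' setT = \int[g]_x (rho x)%:E + mu'' setT.
  by rewrite -h1 h2 eqA.
move/(congr1 (fun z => z - \int[g]_x (rho x)%:E)).
by rewrite ![\int[g]_x _ + _]addeC !addeK.
Qed.

(** If the integrals of [k] and [r] differed on some set, the inequality would be
    strict on the whole space, the integral over the complement being finite. *)
Lemma ae_eq_of_integral_le (g : {measure set T -> \bar R}) (k r : T -> \bar R) :
  measurable_fun setT k -> measurable_fun setT r ->
  (forall x, 0 <= k x) -> (forall x, k x <= r x) ->
  \int[g]_x r x <= \int[g]_x k x -> \int[g]_x r x < +oo ->
  ae_eq g setT k r.
Proof.
move=> mk mr k0 kr rk rfin.
have r0 x : 0 <= r x by exact: le_trans (kr x).
have ir : g.-integrable setT r.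
  apply/integrableP; split => //.
  by under eq_integral do rewrite gee0_abs//.
have ik : g.-integrable setT k.
  apply/integrableP; split => //; under eq_integral do rewrite gee0_abs//.
  by apply: le_lt_trans rfin; exact: le_integral_ge0.
apply: integral_ae_eq => // E _ mE.
have le (D : set T) : \int[g]_(x in D) k x <= \int[g]_(x in D) r x.
  exact: le_integral_ge0.
apply/eqP; rewrite eq_le le/= leNgt; apply/negP => lt.
move: rk; rewrite leNgt => /negP; apply.
have mEC : measurable (~` E) by exact: measurableC.
have split_ f : measurable_fun setT f -> (forall x, 0 <= f x) ->
    \int[g]_x f x = \int[g]_(x in E) f x + \int[g]_(x in ~` E) f x.
  move=> mf f0; rewrite -ge0_integral_setU ?setUv//.
  by rewrite disj_set2E setICr.
rewrite (split_ k)// (split_ r)//; apply: lte_leD => //.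
apply: integrable_fin_num => //; exact: (integrableS measurableT mEC _ ik).
Qed.

End almost_everywhere.

Section glued_measure.
Context {d d1 d2 : measure_display} {T : measurableType d}.
Context {T1 : measurableType d1} {T2 : measurableType d2} {R : realType}.
Variables (g : {finite_measure set T -> \bar R}).
Variables (nu1 : {finite_measure set T1 -> \bar R})
          (nu2 : {finite_measure set T2 -> \bar R}).
Variables (f1 : T1 -> T) (f2 : T2 -> T).
Hypotheses (mf1 : measurable_fun setT f1) (mf2 : measurable_fun setT f2).

Let p1 : {measure set T -> \bar R} :=
  measure_function_pushforward__canonical__measure_function_Measure nu1 mf1.
Let p2 : {measure set T -> \bar R} :=
  measure_function_pushforward__canonical__measure_function_Measure nu2 mf2.

Definition glued_measure : set T -> \bar R := measure_add g (measure_add p1 p2).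

HB.instance Definition _ := Measure.on glued_measure.

Let glued_fin : fin_num_fun glued_measure.
Proof.
move=> A mA.
have m1 : measurable (f1 @^-1` A) by rewrite -[X in measurable X]setTI; exact: mf1.
have m2 : measurable (f2 @^-1` A) by rewrite -[X in measurable X]setTI; exact: mf2.
have -> : glued_measure A = g A + (nu1 (f1 @^-1` A) + nu2 (f2 @^-1` A)).
  by rewrite /glued_measure measure_addE; congr (_ + _); exact: (measure_addE p1 p2 A).
by rewrite !fin_numD !fin_num_measure.
Qed.

HB.instance Definition _ := @Measure_isFinite.Build _ _ _ glued_measure glued_fin.

Lemma glued_measure_exists : exists h : {finite_measure set T -> \bar R},
  (forall A, h A = g A + nu1 (f1 @^-1` A) + nu2 (f2 @^-1` A)) /\
  (forall (D : set T) (f : T -> \bar R), measurable D -> measurable_fun setT f ->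
    (forall x, 0 <= f x) ->
    \int[h]_(x in D) f x = \int[g]_(x in D) f x +
      \int[nu1]_(x in f1 @^-1` D) f (f1 x) + \int[nu2]_(x in f2 @^-1` D) f (f2 x)).
Proof.
exists (glued_measure : {finite_measure set T -> \bar R}); split.
  move=> A; rewrite -addeA /= /glued_measure measure_addE; congr (_ + _).
  exact: (measure_addE p1 p2 A).
move=> D f mD mf f0.
have mfD : measurable_fun D f by exact: measurable_funS mf.
rewrite -[LHS]/(\int[measure_add g (measure_add p1 p2)]_(x in D) f x).
rewrite !ge0_integral_measure_add// -addeA; congr (_ + (_ + _)).
  exact: (ge0_integral_pushforward mf1).
exact: (ge0_integral_pushforward mf2).
Qed.

End glued_measure.

(** The measure [h] is [g + mu'] plus a mass [t] at [z]. A density of [mu] with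
    respect to [h] is [rho] where [g] is carried, 1 where [mu'] is carried, and 0
    at [z] when [t] is not zero, which is allowed since [mu] does not charge
    [z]. *)
Lemma glued_density {d : measure_display} {Y : measurableType d} {R : realType}
    (g mu mu' h : {finite_measure set Y -> \bar R}) (t : R) (rho : Y -> R) (z : Y) :
  is_lebesgue_decomposition mu g rho mu' -> measurable [set z] ->
  (t = 0%R \/ mu [set z] = 0) ->
  (forall (A : set Y) (f : Y -> R), measurable A -> measurable_fun setT f ->
    (forall x, 0 <= f x)%R ->
    \int[h]_(x in A) (f x)%:E = \int[g]_(x in A) (f x)%:E +
      \int[mu']_(x in A) (f x)%:E + (f z * t * \1_A z)%:E) ->
  exists sigma : Y -> R, [/\ has_density mu h sigma,
    {ae g, forall x, sigma x = rho x},
    {ae mu', forall x, sigma x = 1%R} & t != 0%R -> sigma z = 0%R].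
Proof.
move=> dec mz tz hE; have [mr r0 [N [mN N0 NC0]] decE] := dec.
pose Z : set Y := if t == 0%R then set0 else [set z].
have mZ : measurable Z by rewrite /Z; case: ifP.
have muZ : mu Z = 0.
  rewrite /Z; case: ifPn => [_|t0]; first exact: measure0.
  by case: tz => // tE; rewrite tE eqxx in t0.
have mu'Z : mu' Z = 0.
  apply/eqP; rewrite eq_le measure_ge0 andbT -muZ decE// leeDr//.
  by apply: integral_ge0 => x _; rewrite lee_fin.
pose sigma x : R := if x \in Z then 0%R else if x \in N then rho x else 1%R.
have mmem (A : set Y) : measurable A -> measurable_fun setT (fun x => x \in A).
  move=> mA; apply: (@measurable_fun_bool _ _ _ _ true) => //.
  rewrite setTI (_ : _ @^-1` _ = A)//.
  by apply/seteqP; split => x /=; [move/set_mem|move/mem_set].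
have ms : measurable_fun setT sigma.
  apply: measurable_fun_ifT => //; first exact: mmem.
  by apply: measurable_fun_ifT => //; exact: mmem.
have s0 x : (0 <= sigma x)%R by rewrite /sigma; case: ifP => // _; case: ifP.
have aeg : {ae g, forall x, sigma x = rho x}.
  have irZ : \int[g]_(x in Z) (rho x)%:E = 0.
    apply/eqP; rewrite eq_le integral_ge0 ?andbT; last by move=> x _; rewrite lee_fin.
    by rewrite -muZ decE// leeDl.
  have [M [mM M0 HM]] : {ae g, forall x, Z x -> rho x = 0%R}.
    have : ae_eq g Z (EFin \o rho) (cst 0).
      apply/ae_eq_integral_abs => //.
        by apply/measurable_EFinP; exact: measurable_funS mr.
      by rewrite -[RHS]irZ; apply: eq_integral => x _; rewrite /= ger0_norm.
    by apply: filterS => x H Zx; have [] := H Zx.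
  exists (M `|` ~` N); split.
  - by apply: measurableU => //; exact: measurableC.
  - apply/eqP; rewrite eq_le measure_ge0 andbT.
    apply: (le_trans (measureU2 _ _ _)) => //; first exact: measurableC.
    by rewrite [X in X + _]M0 [X in _ + X]NC0 adde0.
  - move=> x /= sx; have [Nx|nN] := pselect (N x); last by right.
    left; apply: HM => /= Zr; apply: sx; rewrite /sigma.
    by case: ifPn => [/set_mem /Zr ->//|_]; rewrite mem_set.
have aem : {ae mu', forall x, sigma x = 1%R}.
  exists (Z `|` N); split.
  - exact: measurableU.
  - apply/eqP; rewrite eq_le measure_ge0 andbT.
    apply: (le_trans (measureU2 _ _ _)) => //.
    by rewrite [X in X + _]mu'Z [X in _ + X]N0 adde0.
  - move=> x /= sx; apply: contrapT => /not_orP[nZ nN]; apply: sx.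
    by rewrite /sigma memNset// memNset.
have sz : t != 0%R -> sigma z = 0%R.
  by move=> t0; rewrite /sigma mem_set// /Z (negbTE t0).
exists sigma; split => //; split => // A mA.
rewrite hE//.
have -> : (sigma z * t * \1_A z)%R = 0%R.
  by have [->|/sz ->] := eqVneq t 0%R; rewrite ?mulr0 !mul0r.
rewrite adde0 decE//; congr (_ + _).
  apply: ae_eq_integral => //; [exact/measurable_EFinP/(measurable_funS measurableT)..|].
  by apply: filterS aeg => x -> _.
rewrite -[LHS]mul1e -(integral_cst mu' mA 1%:E); apply: ae_eq_integral => //.
  exact/measurable_EFinP/(measurable_funS measurableT).
by apply: filterS aem => x -> _.
Qed.

(** * Plans whose marginals dominate the given measures *)

Lemma density_of_dominated {d : measure_display} {T : measurableType d} {R : realType}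
    (mu g : {finite_measure set T -> \bar R}) :
  (forall A, measurable A -> g A = 0 -> mu A = 0) ->
  exists rho, has_density mu g rho.
Proof.
move=> dom; have [mr r0 [N [mN N0 NC0]] dec] := lebesgue_decompositionP mu g.
exists (Defs.lebesgue_density mu g); split => // A mA.
rewrite dec// (_ : singular_part mu g A = 0) ?adde0//.
have mNC : measurable (~` N) by exact: measurableC.
have sNC : singular_part mu g (~` N) = 0.
  apply/eqP; rewrite eq_le measure_ge0 andbT -(dom _ mNC NC0) dec// leeDr//.
  by apply: integral_ge0 => x _; rewrite lee_fin.
have : singular_part mu g setT = 0.
  apply/eqP; rewrite eq_le measure_ge0 andbT -(setUv N).
  apply: (le_trans (measureU2 _ mN mNC)).
  by rewrite [X in X + _]N0 [X in _ + X]sNC adde0.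
exact: (subset_measure0 mA measurableT).
Qed.

Lemma has_density_decomposition {d : measure_display} {T : measurableType d}
    {R : realType} (mu g : {finite_measure set T -> \bar R}) rho :
  has_density mu g rho ->
  is_lebesgue_decomposition mu g rho (mzero : {finite_measure set T -> \bar R}).
Proof.
move=> [mr r0 dec]; split => //.
  exists setT; split => //; rewrite setCT; exact: measure0.
by move=> A mA; rewrite dec// /mzero adde0.
Qed.

Lemma Radon_glued {R : realType} {T T1 T2 : ptopologicalType}
    (f1 : T1 -> T) (f2 : T2 -> T)
    (h g : {finite_measure set (borel T) -> \bar R})
    (nu1 : {finite_measure set (borel T1) -> \bar R})
    (nu2 : {finite_measure set (borel T2) -> \bar R}) :
  hausdorff_space T -> hausdorff_space T1 -> hausdorff_space T2 ->
  continuous f1 -> continuous f2 ->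
  measurable_fun setT (f1 : borel T1 -> borel T) ->
  measurable_fun setT (f2 : borel T2 -> borel T) ->
  (forall A : set (borel T), h A = g A + nu1 (f1 @^-1` A) + nu2 (f2 @^-1` A)) ->
  Radon g -> Radon nu1 -> Radon nu2 -> Radon h.
Proof.
move=> hT hT1 hT2 c1 c2 m1 m2 hE rg r1 r2 B mB e e0.
have e30 : (0 < e / 3)%R by rewrite divr_gt0.
have mp1 (A : set (borel T)) : measurable A -> measurable (f1 @^-1` A : set (borel T1)).
  by move=> mA; rewrite -[X in measurable X]setTI; exact: m1.
have mp2 (A : set (borel T)) : measurable A -> measurable (f2 @^-1` A : set (borel T2)).
  by move=> mA; rewrite -[X in measurable X]setTI; exact: m2.
have [K [cK KB lK]] := rg B mB _ e30.
have [K1 [cK1 K1B lK1]] := r1 _ (mp1 _ mB) _ e30.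
have [K2 [cK2 K2B lK2]] := r2 _ (mp2 _ mB) _ e30.
pose L : set T := K `|` f1 @` K1 `|` f2 @` K2.
have cL : compact L.
  apply: compactU; first apply: compactU => //.
    by apply: continuous_compact => //; exact: continuous_subspaceT.
  by apply: continuous_compact => //; exact: continuous_subspaceT.
have mBL : measurable (B `\` L : set (borel T)).
  by apply: measurableD => //; exact: compact_borel.
exists L; split => //.
  by move=> x [[/KB|[y /K1B By <-]]|[y /K2B By <-]].
have -> : e = (e / 3 + e / 3 + e / 3)%R by lra.
rewrite hE !EFinD; apply: leeD; first apply: leeD.
- apply: le_trans lK; apply: le_measure; rewrite ?inE//.
    by apply: measurableD => //; exact: compact_borel.
  by move=> x [Bx nL]; split => // Kx; apply: nL; left; left.
- apply: le_trans lK1; apply: le_measure; rewrite ?inE; [exact: mp1| |].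
    by apply: measurableD; [exact: mp1|exact: compact_borel].
  by move=> x [Bx nL]; split => // Kx; apply: nL; left; right; exists x.
- apply: le_trans lK2; apply: le_measure; rewrite ?inE; [exact: mp2| |].
    by apply: measurableD; [exact: mp2|exact: compact_borel].
  by move=> x [Bx nL]; split => // Kx; apply: nL; right; exists x.
Qed.

Lemma continuous_borel_measurable {T1 T2 : ptopologicalType} (f : T1 -> T2) :
  continuous f -> measurable_fun setT (f : borel T1 -> borel T2).
Proof.
move=> cf; apply: (@measurability _ _ (borel T1) (borel T2) setT f (@open T2) erefl).
by move=> _ [B oB <-]; rewrite setTI; apply: open_borel; move: B oB; exact/continuousP.
Qed.

Lemma le_singular_part {d : measure_display} {T : measurableType d} {R : realType}
    (mu g mu' : {finite_measure set T -> \bar R}) rho A :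
  is_lebesgue_decomposition mu g rho mu' -> measurable A -> mu' A <= mu A.
Proof.
move=> [mr r0 _ dec] mA; rewrite dec// leeDr//.
by apply: integral_ge0 => x _; rewrite lee_fin.
Qed.

Section full_mass_plans.
Context {R : realType} {X1 X2 : ptopologicalType}.
Notation X := (borel (X1 * X2)%type).
Variables (F1 F2 : R -> \bar R) (c : X1 * X2 -> \bar R).
Variables (mu1 : {finite_measure set (borel X1) -> \bar R})
          (mu2 : {finite_measure set (borel X2) -> \bar R}).
Variables (a1 b1 a2 b2 : nat -> R).
Hypotheses (rep1 : affine_rep F1 a1 b1) (rep2 : affine_rep F2 a2 b2).
Hypotheses (Fs1 : exists2 s, (0 < s)%R & F1 s < +oo)
           (Fs2 : exists2 s, (0 < s)%R & F2 s < +oo).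
Hypotheses (h1 : hausdorff_space X1) (h2 : hausdorff_space X2).
Hypotheses (c0 : forall x, 0 <= c x) (lsc : lower_semicontinuous c).
Hypotheses (rmu1 : Radon mu1) (rmu2 : Radon mu2).

Variables (gam : {finite_measure set X -> \bar R}).
Variables (rho1 : borel X1 -> R) (rho2 : borel X2 -> R).
Variables (mu1' : {finite_measure set (borel X1) -> \bar R})
          (mu2' : {finite_measure set (borel X2) -> \bar R}).
Hypotheses (dec1 : is_lebesgue_decomposition mu1 (marginal1 gam) rho1 mu1')
           (dec2 : is_lebesgue_decomposition mu2 (marginal2 gam) rho2 mu2').
Hypothesis rgam : @Radon R (X1 * X2)%type gam.
Variables (z1 : X1) (z2 : X2).

Let f1 (x : X1) : X1 * X2 := (x, z2).
Let f2 (y : X2) : X1 * X2 := (z1, y).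
Let cf1 : continuous f1.
Proof. by move=> x; apply: cvg_pair; [exact: cvg_id|exact: cvg_cst]. Qed.
Let cf2 : continuous f2.
Proof. by move=> x; apply: cvg_pair; [exact: cvg_cst|exact: cvg_id]. Qed.
Let mf1 : measurable_fun setT (f1 : borel X1 -> X).
Proof. exact: continuous_borel_measurable. Qed.
Let mf2 : measurable_fun setT (f2 : borel X2 -> X).
Proof. exact: continuous_borel_measurable. Qed.

Let rmu1' : Radon mu1'.
Proof.
apply: (Radon_dominated h1 rmu1) => A mA A0; apply/eqP.
by rewrite eq_le measure_ge0 andbT -A0; exact: le_singular_part dec1 mA.
Qed.
Let rmu2' : Radon mu2'.
Proof.
apply: (Radon_dominated h2 rmu2) => A mA A0; apply/eqP.
by rewrite eq_le measure_ge0 andbT -A0; exact: le_singular_part dec2 mA.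
Qed.

(** The marginals of [gam + (x, z2)_# mu1' + (z1, y)_# mu2'] dominate [mu1] and
    [mu2]. *)
Lemma full_mass_plan_exists : exists (h : {finite_measure set X -> \bar R}) s1 s2,
  [/\ Radon h, has_density mu1 (marginal1 h) s1 & has_density mu2 (marginal2 h) s2].
Proof.
have [h [hE _]] := glued_measure_exists gam mu1' mu2' mf1 mf2.
have rh : Radon h.
  exact: (Radon_glued (hausdorff_prod h1 h2) h1 h2 cf1 cf2 mf1 mf2 hE rgam).
have sum0 (x y z : \bar R) : 0 <= x -> 0 <= y -> 0 <= z -> x + y + z = 0 ->
    [/\ x = 0, y = 0 & z = 0].
  move=> x0 y0 z0 /eqP; rewrite padde_eq0 ?adde_ge0// padde_eq0//.
  by move=> /andP[/andP[/eqP -> /eqP ->] /eqP ->].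
have [s1 d1] : exists s1, has_density mu1 (marginal1 h) s1.
  apply: density_of_dominated => A mA hA0.
  have := hE (fst @^-1` A); rewrite [LHS]hA0 => /esym/sum0[]// gA mA0 _.
  have [mr r0 _ ->] := dec1 => //.
  rewrite (_ : mu1' A = 0) ?adde0//; apply: null_set_integral => //.
  by apply/measurable_EFinP; exact: measurable_funS mr.
have [s2 d2] : exists s2, has_density mu2 (marginal2 h) s2.
  apply: density_of_dominated => A mA hA0.
  have := hE (snd @^-1` A); rewrite [LHS]hA0 => /esym/sum0[]// gA _ mA0.
  have [mr r0 _ ->] := dec2 => //.
  rewrite (_ : mu2' A = 0) ?adde0//; apply: null_set_integral => //.
  by apply/measurable_EFinP; exact: measurable_funS mr.
by exists h, s1, s2.
Qed.

Let t1 := fine (mu1' setT).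
Let t2 := fine (mu2' setT).

(** The first added part lies over [z2], where the density of [mu2] vanishes, while
    the density of [mu1] equals 1 there: its cost is at most [F1 0] times its mass.
    Likewise for the second part, and on [gam] the densities are unchanged. *)
Lemma full_mass_plan_le :
  (t2 = 0%R \/ mu1 [set z1] = 0) -> (t1 = 0%R \/ mu2 [set z2] = 0) ->
  exists (h : {finite_measure set X -> \bar R}) s1 s2,
  [/\ Radon h, has_density mu1 (marginal1 h) s1, has_density mu2 (marginal2 h) s2 &
      \int[h]_x perspective_integrand F1 F2 c s1 s2 x <=
      ET_functional F1 F2 c mu1 mu2 gam].
Proof.
move=> H1 H2.
have [h [hE hI]] := glued_measure_exists gam mu1' mu2' mf1 mf2.
have rh : Radon h.
  exact: (Radon_glued (hausdorff_prod h1 h2) h1 h2 cf1 cf2 mf1 mf2 hE rgam).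
have mset1 (T : ptopologicalType) (z : T) : hausdorff_space T ->
    measurable ([set z] : set (borel T)).
  by move=> hT; apply: compact_borel => //; exact: compact_set1.
have mfst := @measurable_borel_fst X1 X2.
have msnd := @measurable_borel_snd X1 X2.
have cst_int (T : ptopologicalType) (Y : Type) (nu : {finite_measure set (borel T) -> \bar R})
    (A : set Y) (z : Y) (y : R) :
    \int[nu]_(x in [set _ | A z]) y%:E = (y * fine (nu setT) * \1_A z)%:E.
  have [Az|nAz] := pselect (A z).
    rewrite (_ : [set _ | A z] = setT); last by apply/seteqP; split.
    rewrite indicE mem_set// mulr1 EFinM -fine_measureK//.
    exact: (integral_cst nu measurableT y%:E).
  rewrite (_ : [set _ | A z] = set0); last by apply/seteqP; split.
  by rewrite integral_set0 indicE memNset// mulr0.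
have [s1 [d1 ae1 ae1' sz1]] : exists s1 : borel X1 -> R,
    [/\ has_density mu1 (marginal1 h) s1,
     {ae marginal1 gam, forall x, s1 x = rho1 x},
     {ae mu1', forall x, s1 x = 1%R} & t2 != 0%R -> s1 z1 = 0%R].
  apply: (glued_density dec1 (mset1 _ z1 h1) H1) => A f mA mf f0.
  have mE : measurable_fun setT (EFin \o f) by exact/measurable_EFinP.
  rewrite (marginal1_integral h mA mE)//.
  rewrite (marginal1_integral gam mA mE)//.
  rewrite (hI (fst @^-1` A) (fun x => (f x.1)%:E))//.
  - by congr (_ + _ + _); exact: (cst_int _ _ mu2' A z1 (f z1)).
  - by rewrite -[X in measurable X]setTI; exact: mfst.
  - exact: (measurableT_comp mE mfst).
  - by move=> x; rewrite lee_fin.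
have [s2 [d2 ae2 ae2' sz2]] : exists s2 : borel X2 -> R,
    [/\ has_density mu2 (marginal2 h) s2,
     {ae marginal2 gam, forall x, s2 x = rho2 x},
     {ae mu2', forall x, s2 x = 1%R} & t1 != 0%R -> s2 z2 = 0%R].
  apply: (glued_density dec2 (mset1 _ z2 h2) H2) => A f mA mf f0.
  have mE : measurable_fun setT (EFin \o f) by exact/measurable_EFinP.
  rewrite (marginal2_integral h mA mE)//.
  rewrite (marginal2_integral gam mA mE)//.
  rewrite (hI (snd @^-1` A) (fun x => (f x.2)%:E))//.
  - by rewrite [LHS]addeAC; congr (_ + _ + _); exact: (cst_int _ _ mu1' A z2 (f z2)).
  - by rewrite -[X in measurable X]setTI; exact: msnd.
  - exact: (measurableT_comp mE msnd).
  - by move=> x; rewrite lee_fin.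
exists h, s1, s2; split => //.
have [ms1 s10 _] := d1; have [ms2 s20 _] := d2.
have [_ r10 _ _] := dec1; have [_ r20 _ _] := dec2.
have [a10 b10 _ _] := rep1; have [a20 b20 _ _] := rep2.
(* A measurable majorant of the perspective integrand, so that the integral against
   the glued plan can be split. The first argument is used on [gam], the second on
   the added parts. *)
pose U (x : X) : \bar R := mine (reverse_integrand F1 F2 c s1 s2 x)
  (F1 0%R * (s1 x.1)%:E + F2 0%R * (s2 x.2)%:E).
have F10 : 0 <= F1 0%R by exact: (rep_ge0 a10 b10 rep1).
have F20 : 0 <= F2 0%R by exact: (rep_ge0 a20 b20 rep2).
have E0 x : 0 <= F1 0%R * (s1 x.1)%:E + F2 0%R * (s2 x.2)%:E.
  by rewrite adde_ge0// mule_ge0// lee_fin.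
have Rev0 := reverse_integrand_ge0 rep1 rep2 c0
  (has_density_decomposition d1) (has_density_decomposition d2).
have U0 x : 0 <= U x by rewrite /U le_min Rev0 E0.
have mU : measurable_fun setT U.
  apply: measurable_mine.
    exact: (measurable_reverse_integrand rep1 rep2 lsc
      (has_density_decomposition d1) (has_density_decomposition d2)).
  apply: emeasurable_funD; apply: emeasurable_funM; try exact: measurable_cst.
    by apply/measurable_EFinP; exact: (measurableT_comp ms1 mfst).
  by apply/measurable_EFinP; exact: (measurableT_comp ms2 msnd).
apply: (@le_trans _ _ (\int[h]_x U x)).
  apply: le_integral_ge0 => // x _; rewrite le_min; apply/andP; split.
    exact: (marginal_le_reverse rep1 rep2).
  exact: (marginal_le_entropy0 rep1 rep2).
rewrite hI// (ET_functional_reverse rep1 rep2 c0 lsc dec1 dec2) -addeA.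
apply: leeD; last apply: leeD.
- apply: ae_le_integral_ge0 => //.
    exact: (reverse_integrand_ge0 rep1 rep2 c0 dec1 dec2).
  have l1 := ae_marginal1 ae1.
  have l2 := ae_marginal2 ae2.
  apply: filterS2 l1 l2 => x e1 e2.
  by rewrite /U ge_min /reverse_integrand e1 e2 lexx.
- have -> : F1 0%R * mu1' setT = \int[mu1']_x cst (F1 0%R) x.
    by rewrite integral_cst.
  apply: ae_le_integral_ge0 => //.
  have [t0|t0] := eqVneq t1 0%R.
    exists setT; split => //.
    by rewrite [LHS](fine_measureK mu1' measurableT) -/t1 t0.
  apply: filterS ae1' => x e1.
  by rewrite /U ge_min /= e1 sz2// mule1 mule0 adde0 lexx orbT.
- have -> : F2 0%R * mu2' setT = \int[mu2']_x cst (F2 0%R) x.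
    by rewrite integral_cst.
  apply: ae_le_integral_ge0 => //.
  have [t0|t0] := eqVneq t2 0%R.
    exists setT; split => //.
    by rewrite [LHS](fine_measureK mu2' measurableT) -/t2 t0.
  apply: filterS ae2' => x e2.
  by rewrite /U ge_min /= e2 sz1// mule1 mule0 add0e lexx orbT.
Qed.

End full_mass_plans.

(** * Comparison of the three functionals *)

Section perspective_functional_bounds.
Context {R : realType} {X1 X2 : ptopologicalType}.
Notation X := (borel (X1 * X2)%type).
Variables (F1 F2 : R -> \bar R) (c : X1 * X2 -> \bar R).
Variables (mu1 : {finite_measure set (borel X1) -> \bar R})
          (mu2 : {finite_measure set (borel X2) -> \bar R}).
Variables (a1 b1 a2 b2 : nat -> R).
Hypotheses (rep1 : affine_rep F1 a1 b1) (rep2 : affine_rep F2 a2 b2).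
Hypotheses (h1 : hausdorff_space X1) (h2 : hausdorff_space X2).
Hypotheses (c0 : forall x, 0 <= c x) (lsc : lower_semicontinuous c).
Hypothesis coer : coercive F1 F2 c.
Variables (gam : {finite_measure set X -> \bar R}).
Variables (rho1 : borel X1 -> R) (rho2 : borel X2 -> R).
Variables (mu1' : {finite_measure set (borel X1) -> \bar R})
          (mu2' : {finite_measure set (borel X2) -> \bar R}).
Hypotheses (dec1 : is_lebesgue_decomposition mu1 (marginal1 gam) rho1 mu1')
           (dec2 : is_lebesgue_decomposition mu2 (marginal2 gam) rho2 mu2').

Let r1 x : (0 <= rho1 x)%R. Proof. by case: dec1. Qed.
Let r2 x : (0 <= rho2 x)%R. Proof. by case: dec2. Qed.

Lemma perspective_integrand_ge0 x : 0 <= perspective_integrand F1 F2 c rho1 rho2 x.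
Proof. exact: (marginal_ge0 rep1 rep2). Qed.

Lemma perspective_le_reverse_integrand x :
  perspective_integrand F1 F2 c rho1 rho2 x <= reverse_integrand F1 F2 c rho1 rho2 x.
Proof. exact: (marginal_le_reverse rep1 rep2). Qed.

Lemma reduced_le_perspective_integrand x :
  reduced_cost a1 b1 a2 b2 (rho1 x.1) (rho2 x.2) (c x) <=
  perspective_integrand F1 F2 c rho1 rho2 x.
Proof. exact: (reduced_cost_le_marginal rep1 rep2). Qed.

Lemma ET_le_perspective : Radon gam ->
  ET F1 F2 c mu1 mu2 <= \int[gam]_x perspective_integrand F1 F2 c rho1 rho2 x +
    (F1 0%R * mu1' setT + F2 0%R * mu2' setT).
Proof.
move=> rg; apply: (le_trans (ET_le_reduced rep1 rep2 h1 h2 c0 lsc coer dec1 dec2 rg)).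
rewrite leeD2r//; apply: le_integral_ge0 => x _; first exact: perspective_integrand_ge0.
exact: reduced_le_perspective_integrand.
Qed.

Lemma perspective_le_ET_functional :
  \int[gam]_x perspective_integrand F1 F2 c rho1 rho2 x +
    (F1 0%R * mu1' setT + F2 0%R * mu2' setT) <= ET_functional F1 F2 c mu1 mu2 gam.
Proof.
rewrite (ET_functional_reverse rep1 rep2 c0 lsc dec1 dec2) leeD2r//.
apply: le_integral_ge0 => x _; last exact: perspective_le_reverse_integrand.
exact: (reverse_integrand_ge0 rep1 rep2 c0 dec1 dec2).
Qed.

(** Optimality forces the integral of the reverse integrand to equal that of the
    reduced cost, which lies below it pointwise and is measurable; the perspective
    integrand lies between the two. *)
Lemma optimal_integrands_ae_eq : Radon gam ->
  ET_functional F1 F2 c mu1 mu2 gam = ET F1 F2 c mu1 mu2 ->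
  ET F1 F2 c mu1 mu2 < +oo ->
  {ae gam, forall x, perspective_integrand F1 F2 c rho1 rho2 x =
                     reverse_integrand F1 F2 c rho1 rho2 x}.
Proof.
move=> rg EE ETy; pose K x := reduced_cost a1 b1 a2 b2 (rho1 x.1) (rho2 x.2) (c x).
have [a10 b10 _ _] := rep1; have [a20 b20 _ _] := rep2.
have [m1 _ _ _] := dec1; have [m2 _ _ _] := dec2.
have mr1 : measurable_fun setT (fun x : X => rho1 x.1).
  exact: (measurableT_comp m1 (@measurable_borel_fst X1 X2)).
have mr2 : measurable_fun setT (fun x : X => rho2 x.2).
  exact: (measurableT_comp m2 (@measurable_borel_snd X1 X2)).
have mc : measurable_fun setT (c : X -> \bar R) by exact: lsc_borel_measurable.
have mK : measurable_fun setT (K : X -> \bar R).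
  exact: (measurable_reduced_cost a10 b10 a20 b20 mr1 mr2 mc).
have mR := measurable_reverse_integrand rep1 rep2 lsc dec1 dec2.
have R0 := reverse_integrand_ge0 rep1 rep2 c0 dec1 dec2.
have K0 x : 0 <= K x by exact: reduced_cost_ge0.
have KR x : K x <= reverse_integrand F1 F2 c rho1 rho2 x.
  by apply: (le_trans (reduced_le_perspective_integrand x));
    exact: perspective_le_reverse_integrand.
have F10 : 0 <= F1 0%R by exact: (rep_ge0 a10 b10 rep1).
have F20 : 0 <= F2 0%R by exact: (rep_ge0 a20 b20 rep2).
set S := F1 0%R * mu1' setT + F2 0%R * mu2' setT.
have S0 : 0 <= S by rewrite adde_ge0// mule_ge0.
have IR0 : 0 <= \int[gam]_x reverse_integrand F1 F2 c rho1 rho2 x.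
  by apply: integral_ge0.
have := ET_functional_reverse rep1 rep2 c0 lsc dec1 dec2; rewrite EE -/S => RE.
have Sfin : S \is a fin_num.
  by rewrite ge0_fin_numE//; apply: le_lt_trans ETy; rewrite RE leeDr.
have Rfin : \int[gam]_x reverse_integrand F1 F2 c rho1 rho2 x < +oo.
  by apply: le_lt_trans ETy; rewrite RE leeDl.
have RK : \int[gam]_x reverse_integrand F1 F2 c rho1 rho2 x <= \int[gam]_x K x.
  have := ET_le_reduced rep1 rep2 h1 h2 c0 lsc coer dec1 dec2 rg.
  by rewrite RE leeD2rE.
have := ae_eq_of_integral_le mK mR K0 KR RK Rfin.
apply: filterS => x /(_ Logic.I) KE; apply/eqP; rewrite eq_le.
by rewrite perspective_le_reverse_integrand -KE reduced_le_perspective_integrand.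
Qed.

Lemma ET_functional_le_of_ae_eq :
  {ae gam, forall x, perspective_integrand F1 F2 c rho1 rho2 x =
                     reverse_integrand F1 F2 c rho1 rho2 x} ->
  ET_functional F1 F2 c mu1 mu2 gam <=
  \int[gam]_x perspective_integrand F1 F2 c rho1 rho2 x +
    (F1 0%R * mu1' setT + F2 0%R * mu2' setT).
Proof.
move=> eqR; rewrite (ET_functional_reverse rep1 rep2 c0 lsc dec1 dec2) leeD2r//.
apply: ae_le_integral_ge0.
- exact: (reverse_integrand_ge0 rep1 rep2 c0 dec1 dec2).
- exact: perspective_integrand_ge0.
- by case: eqR => N [mN N0 sN]; exists N; split => // x /= ne; apply: sN => /= eqx;
    apply: ne; rewrite eqx.
Qed.

End perspective_functional_bounds.

(** The functional is defined through one choice of decomposition; the densities of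
    any two agree almost everywhere and the singular masses are equal. *)
Lemma perspective_functional_decomposition {R : realType} {X1 X2 : ptopologicalType}
    (F1 F2 : R -> \bar R) (c : X1 * X2 -> \bar R)
    (mu1 : {finite_measure set (borel X1) -> \bar R})
    (mu2 : {finite_measure set (borel X2) -> \bar R})
    (a1 b1 a2 b2 : nat -> R)
    (gam : {finite_measure set (borel (X1 * X2)%type) -> \bar R})
    (rho1 : borel X1 -> R) (rho2 : borel X2 -> R) mu1' mu2' :
  affine_rep F1 a1 b1 -> affine_rep F2 a2 b2 -> (forall x, 0 <= c x) ->
  is_lebesgue_decomposition mu1 (marginal1 gam) rho1 mu1' ->
  is_lebesgue_decomposition mu2 (marginal2 gam) rho2 mu2' ->
  perspective_functional F1 F2 c mu1 mu2 gam =
  \int[gam]_x perspective_integrand F1 F2 c rho1 rho2 x +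
    (F1 0%R * mu1' setT + F2 0%R * mu2' setT).
Proof.
move=> rep1 rep2 c0 dec1 dec2.
have dec1' := lebesgue_decompositionP mu1 (marginal1 gam).
have dec2' := lebesgue_decompositionP mu2 (marginal2 gam).
have [ae1 e1] := lebesgue_decomposition_unique dec1' dec1.
have [ae2 e2] := lebesgue_decomposition_unique dec2' dec2.
have l1 := ae_marginal1 ae1; have l2 := ae_marginal2 ae2.
rewrite /perspective_functional /singular_cost e1 e2; congr (_ + _).
have g0 := perspective_integrand_ge0 rep1 rep2 c0 dec1 dec2.
have g0' := perspective_integrand_ge0 rep1 rep2 c0 dec1' dec2'.
apply/eqP; rewrite eq_le; apply/andP; split; apply: ae_le_integral_ge0 => //.
  by apply: filterS2 l1 l2 => x /(_ Logic.I)[E1] /(_ Logic.I)[E2];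
    rewrite /perspective_integrand E1 E2.
by apply: filterS2 l1 l2 => x /(_ Logic.I)[E1] /(_ Logic.I)[E2];
    rewrite /perspective_integrand E1 E2.
Qed.

Theorem theorem5p5 (R : realType) (X1 X2 : ptopologicalType)
    (F1 F2 : R -> \bar R) (c : X1 * X2 -> \bar R)
    (mu1 : {finite_measure set (borel X1) -> \bar R})
    (mu2 : {finite_measure set (borel X2) -> \bar R}) :
  basic_setting F1 F2 c mu1 mu2 -> coercive F1 F2 c ->
  [/\ forall (gamma : {finite_measure set (borel (X1 * X2)%type) -> \bar R})
        (phi : (X1 -> R) * (X2 -> R)),
        Radon gamma -> Phi F1 F2 c phi ->
        perspective_functional F1 F2 c mu1 mu2 gamma
          <= reverse_functional F1 F2 c mu1 mu2 gamma /\
        dual_functional F1 F2 mu1 mu2 phi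
          <= perspective_functional F1 F2 c mu1 mu2 gamma,
      is_minimum (ET F1 F2 c mu1 mu2)
        [set perspective_functional F1 F2 c mu1 mu2 gamma | gamma in Radon],
      (* If the infimum ET is +oo, then every gamma is a minimizer of both
         functionals and the pointwise identity may fail. *)
      forall (gamma : {finite_measure set (borel (X1 * X2)%type) -> \bar R})
        (rho1 : borel X1 -> R) (rho2 : borel X2 -> R)
        (mu1' : {finite_measure set (borel X1) -> \bar R})
        (mu2' : {finite_measure set (borel X2) -> \bar R}),
        Radon gamma ->
        is_lebesgue_decomposition mu1 (marginal1 gamma) rho1 mu1' ->
        is_lebesgue_decomposition mu2 (marginal2 gamma) rho2 mu2' ->
        OptET F1 F2 c mu1 mu2 gamma <->
        minimizes (perspective_functional F1 F2 c mu1 mu2) Radon gamma /\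
        (ET F1 F2 c mu1 mu2 < +oo ->
         {ae gamma, forall x, perspective_integrand F1 F2 c rho1 rho2 x =
                              reverse_integrand F1 F2 c rho1 rho2 x}) &
      F1 0%R = +oo \/ (exists x2 : X2, mu2 [set x2] = 0) ->
      F2 0%R = +oo \/ (exists x1 : X1, mu1 [set x1] = 0) ->
      is_minimum (ET F1 F2 c mu1 mu2)
        [set v | exists
           (gamma : {finite_measure set (borel (X1 * X2)%type) -> \bar R})
           (rho1 : borel X1 -> R) (rho2 : borel X2 -> R),
           [/\ Radon gamma, has_density mu1 (marginal1 gamma) rho1,
               has_density mu2 (marginal2 gamma) rho2 &
               v = \int[gamma]_x perspective_integrand F1 F2 c rho1 rho2 x]]].
Proof.
move=> [[h1 h2] [G1 G2] [c0 lsc _] [rmu1 rmu2] _] coer.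
have [a1 [b1 rep1]] := affine_rep_exists G1.
have [a2 [b2 rep2]] := affine_rep_exists G2.
have [_ _ _ Fs1] := G1; have [_ _ _ Fs2] := G2.
have [a10 b10 _ _] := rep1; have [a20 b20 _ _] := rep2.
have F10 : 0 <= F1 0%R by exact: (rep_ge0 a10 b10 rep1).
have F20 : 0 <= F2 0%R by exact: (rep_ge0 a20 b20 rep2).
pose m := ET F1 F2 c mu1 mu2.
pose E := ET_functional F1 F2 c mu1 mu2.
pose H := perspective_functional F1 F2 c mu1 mu2.
have dec1 (gamma : {finite_measure set (borel (X1 * X2)%type) -> \bar R}) :=
  lebesgue_decompositionP mu1 (marginal1 gamma).
have dec2 (gamma : {finite_measure set (borel (X1 * X2)%type) -> \bar R}) :=
  lebesgue_decompositionP mu2 (marginal2 gamma).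
have ET_H gamma : Radon gamma -> m <= H gamma.
  move=> rg; rewrite /H.
  rewrite (perspective_functional_decomposition rep1 rep2 c0 (dec1 gamma) (dec2 gamma)).
  exact: (ET_le_perspective rep1 rep2 h1 h2 c0 lsc coer (dec1 gamma) (dec2 gamma) rg).
have H_E gamma : H gamma <= E gamma.
  rewrite /H (perspective_functional_decomposition rep1 rep2 c0 (dec1 gamma) (dec2 gamma)).
  exact: (perspective_le_ET_functional rep1 rep2 c0 lsc (dec1 gamma) (dec2 gamma)).
have Rev_E gamma : reverse_functional F1 F2 c mu1 mu2 gamma = E gamma.
  rewrite /E.
  by rewrite (ET_functional_reverse rep1 rep2 c0 lsc (dec1 gamma) (dec2 gamma)).
have ET_E gamma : Radon gamma -> m <= E gamma.
  by move=> rg; apply: ereal_inf_lbound; exists gamma.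
pose zero : {finite_measure set (borel (X1 * X2)%type) -> \bar R} := mzero.
have rzero : @Radon R (X1 * X2)%type zero.
  move=> B mB e e0; exists set0; split; [exact: compact0|by []|].
  by rewrite /zero /= /mzero lee_fin ltW.
have [opt ropt optE] : exists2 gamma, Radon gamma & E gamma = m.
  have [my|] := ltP m +oo.
    exact: (minimizer_exists rep1 rep2 Fs1 Fs2 h1 h2 c0 lsc coer rmu1 rmu2 my).
  rewrite leye_eq => /eqP mE; exists zero => //.
  by apply/eqP; rewrite eq_le ET_E// andbT mE leey.
have optH : H opt = m by apply/eqP; rewrite eq_le ET_H// andbT -optE H_E.
split.
- move=> gamma phi rg Hphi; rewrite Rev_E; split; first exact: H_E.
  apply: (le_trans _ (ET_H gamma rg)); rewrite -optE.
  exact: (dual_le_ET_functional _ _ _ rep1 rep2 Fs1 Fs2 c0 Hphi).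
- split; first by exists opt.
  by move=> _ [gamma rg <-]; exact: ET_H.
- move=> gamma rho1 rho2 mu1' mu2' rg d1 d2; split.
    move=> [_ Hopt].
    have EE : E gamma = m.
      by apply/eqP; rewrite eq_le ET_E// andbT -optE; exact: Hopt.
    split.
      split => // y ry; apply: (le_trans (H_E gamma)); rewrite EE; exact: ET_H.
    move=> my.
    exact: (optimal_integrands_ae_eq rep1 rep2 h1 h2 c0 lsc coer d1 d2 rg EE my).
  move=> [[_ Hmin] Hae]; split => // y ry.
  apply: (le_trans _ (ET_E y ry)).
  have [my|] := ltP m +oo; last by rewrite leye_eq => /eqP ->; exact: leey.
  rewrite -optH; apply: (le_trans _ (Hmin opt ropt)).
  rewrite (perspective_functional_decomposition rep1 rep2 c0 d1 d2).
  exact: (ET_functional_le_of_ae_eq rep1 rep2 c0 lsc d1 d2 (Hae my)).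
- move=> C1 C2.
  have low gamma rho1 rho2 : Radon gamma ->
      has_density mu1 (marginal1 gamma) rho1 ->
      has_density mu2 (marginal2 gamma) rho2 ->
      m <= \int[gamma]_x perspective_integrand F1 F2 c rho1 rho2 x.
    move=> rg d1 d2.
    have := ET_le_perspective rep1 rep2 h1 h2 c0 lsc coer
      (has_density_decomposition d1) (has_density_decomposition d2) rg.
    by rewrite /mzero !mule0 !adde0.
  split; last by move=> _ [gamma [rho1 [rho2 [rg d1 d2 ->]]]]; exact: low.
  have [my|] := ltP m +oo; last first.
    rewrite leye_eq => /eqP mE.
    have [g [s1 [s2 [rg d1 d2]]]] := full_mass_plan_exists h1 h2 rmu1 rmu2
      (dec1 opt) (dec2 opt) ropt point point.
    exists g, s1, s2; split => //.
    by apply/eqP; rewrite eq_le low//= -/m mE leey.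
  have sing_fin : F1 0%R * singular_part mu1 (marginal1 opt) setT < +oo /\
      F2 0%R * singular_part mu2 (marginal2 opt) setT < +oo.
    have I0 : 0 <= \int[opt]_x reverse_integrand F1 F2 c
        (Defs.lebesgue_density mu1 (marginal1 opt))
        (Defs.lebesgue_density mu2 (marginal2 opt)) x.
      apply: integral_ge0 => x _.
      exact: (reverse_integrand_ge0 rep1 rep2 c0 (dec1 opt) (dec2 opt)).
    move: my; rewrite -optE /E.
    rewrite (ET_functional_reverse rep1 rep2 c0 lsc (dec1 opt) (dec2 opt)) => lt.
    have S10 : 0 <= F1 0%R * singular_part mu1 (marginal1 opt) setT by rewrite mule_ge0.
    have S20 : 0 <= F2 0%R * singular_part mu2 (marginal2 opt) setT by rewrite mule_ge0.
    split; apply: le_lt_trans lt.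
      by rewrite addeC -addeA leeDl// adde_ge0.
    by rewrite addeA leeDr// adde_ge0.
  (* If the entropy at 0 is infinite, finiteness of the cost makes the singular part
     vanish and any point can be chosen. *)
  have mass0 (F0 : \bar R) (t : \bar R) : F0 = +oo -> 0 <= t -> F0 * t < +oo -> fine t = 0%R.
    move=> -> t0; have [->//|tn0] := eqVneq t 0.
    by rewrite gt0_mulye ?lt_neqAle ?t0 ?andbT 1?eq_sym// ltxx.
  have [z2 Hz2] : exists z2 : X2,
      fine (singular_part mu1 (marginal1 opt) setT) = 0%R \/ mu2 [set z2] = 0.
    case: C1 => [F1y|[z2 Hz2]]; last by exists z2; right.
    by exists point; left; exact: (mass0 _ _ F1y (measure_ge0 _ _) sing_fin.1).
  have [z1 Hz1] : exists z1 : X1,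
      fine (singular_part mu2 (marginal2 opt) setT) = 0%R \/ mu1 [set z1] = 0.
    case: C2 => [F2y|[z1 Hz1]]; last by exists z1; right.
    by exists point; left; exact: (mass0 _ _ F2y (measure_ge0 _ _) sing_fin.2).
  have [g [s1 [s2 [rg d1 d2 le]]]] := full_mass_plan_le rep1 rep2 Fs1 Fs2 h1 h2
    c0 lsc rmu1 rmu2 (dec1 opt) (dec2 opt) ropt Hz1 Hz2.
  exists g, s1, s2; split => //.
  by apply/eqP; rewrite eq_le low//= -/m -optE.
Qed.
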